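(* Let $\Gamma$ be an unoriented graph in which every vertex has exactly $g$ outgoing edges, let $D\subset\Gamma$ be a subgraph whose Green's function is finite, and let $F_1,F_2$ be two disjoint finite sets of vertices of $D$. Consider the soup of unoriented unrooted loops in $D$ with intensity $c=1$ (a Poisson point process with intensity $\nu$). Let $\eta=(\tilde\eta_1,\dots,\tilde\eta_{\mathcal N})$ be the collection of all unoriented excursions away from $F_2$ that reach $F_1$, of the loops of the soup that intersect both $F_1$ and $F_2$; let $\mathcal Z=(\mathcal Z_1,\dots,\mathcal Z_{2\mathcal N})$ be the vector of the endpoints (in $F_2$) of these excursions, and let $\beta$ be the unoriented unordered $\mathcal Z$-bridge in $D\setminus F_1$ formed by the missing parts of these loops. Then the conditional distribution of $\beta$ given $\eta$ is exactly the unordered unoriented bridge measure $B^{D\setminus F_1}_{\mathcal Z}$.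
   Context: **Graph, loops.** $\Gamma$ is a discrete unoriented graph; parallel edges and edges from a vertex to itself are allowed. Each unoriented edge can be traversed in two opposite directions, and an edge from $x$ to $x$ counts twice among the $g$ outgoing edges of $x$ (once for each direction of traversal). A rooted oriented loop with $n=|l|\ge1$ steps is $l=(l_0,e_1,l_1,\dots,e_n,l_n)$ with $l_0=l_n$ and $e_i$ an edge traversed from $l_{i-1}$ to $l_i$ (edges used and direction of traversal are part of the information). Put $p(l)=g^{-n}$, $\rho(l)=p(l)/n$. The time-reversal of $l$ is $\hat l=(l_n,e_n,l_{n-1},\dots,e_1,l_0)$ with all edges traversed in the opposite direction. An unrooted unoriented loop is an equivalence class of rooted oriented loops modulo rerooting (cyclic shift) and time-reversal. The measure $\nu$ on unrooted unoriented loops in $D$ is the image of $\rho/2$, restricted to loops in $D$, under the map sending a rooted oriented loop to its class. The soup of unoriented loops with intensity $c$ is a Poisson point process with intensity $c\,\nu$. **Bridges.** For a subgraph $D'$ and vertices $x,y$ of $D'$, a bridge $b$ from $x$ to $y$ in $D'$ is a finite nearest-neighbour path in $D'$ from $x$ to $y$ (keeping track of the edges used); $n(b)$ is its number of steps, and $n(b)=0$ is allowed if $x=y$. The Green's function is $G_{D'}(x,y)=\sum_b g^{-n(b)}$, summed over all bridges from $x$ to $y$ in $D'$; ''the Green's function of $D$ is finite'' means $G_D(x,y)<\infty$ for all $x,y$ in $D$. The bridge probability measure from $x$ to $y$ in $D'$ gives mass $g^{-n(b)}/G_{D'}(x,y)$ to each $b$; its image under time-reversal is the bridge probability measure from $y$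 to $x$. For $Z=(z_1,\dots,z_{2N})$, an unoriented (unordered) $Z$-bridge in $D'$ is a pairing $t$ of $\{1,\dots,2N\}$ into $N$ pairs together with, for each pair $\{i,j\}$ of $t$, an unoriented bridge in $D'$ joining the extremity labelled $i$ (at $z_i$) to the extremity labelled $j$ (at $z_j$), i.e. a bridge from $z_i$ to $z_j$ identified with its time-reversal viewed as a bridge from $z_j$ to $z_i$. The measure $B^{D'}_Z$ is the probability measure obtained by first sampling a pairing $\tau$ with $P(\tau=t)$ proportional to $\prod_{\{i,j\}\in t}G_{D'}(z_i,z_j)$, and then, given $\tau$, sampling independent unoriented bridges in $D'$ for the $N$ pairs according to the bridge probability measures. Equivalently, each $Z$-bridge has probability proportional to $g^{-K}$, with $K$ the total length of its $N$ bridges. (It is defined when this product is positive for some $t$.) $D\setminus F_1$ is $D$ with the vertices of $F_1$ removed. **Excursions and missing parts.** Let $\overline{\mathcal L}$ be the (a.s. finite) family, with multiplicities, of the loops of the soup that intersect both $F_1$ and $F_2$. The excursions of such a loop away from $F_2$ reaching $F_1$ are its portions $(a_0,e_1,a_1,\dots,e_k,a_k)$, viewed up to time-reversal, with $a_0,a_k\in F_2$, $\{a_1,\dots,a_{k-1}\}\cap F_2=\emptyset$ and at least one $a_i\in F_1$ ($a_0=a_k$ is allowed, and the excursion may be the whole loop). $\eta$ is the list of all such excursions of all loops in $\overline{\mathcal L}$, counted with multiplicity, ordered by a fixed deterministic rule, and $\mathcal Z$ lists the two extremities of each excursion (in a deterministic order). Removing the excursions from the loops of $\overline{\mathcal L}$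 leaves $\mathcal N$ unoriented paths (possibly of length zero) in $D\setminus F_1$, which pair the $2\mathcal N$ excursion extremities and join the paired extremities; this is the $\mathcal Z$-bridge $\beta$. When some excursions in $\eta$ coincide, or equal their own time-reversal, $\beta$ is only determined up to the corresponding relabelling of extremities; it is then chosen uniformly at random among all unoriented $\mathcal Z$-bridges in $D\setminus F_1$ whose concatenation with $\eta$ gives $\overline{\mathcal L}$. *)

(* Defs.v *)
From HB Require Import structures.
From mathcomp Require Import all_boot all_order all_algebra finmap.
From mathcomp Require Import all_classical all_reals all_analysis.
Set Implicit Arguments.
Unset Strict Implicit.
Unset Printing Implicit Defensive.
Import Order.TTheory GRing.Theory Num.Theory.
Local Open Scope classical_set_scope.
Local Open Scope ring_scope.

(* An unoriented edge is a pair {e, drev e} of darts, i.e. of directions of    *)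
(* traversal. As drev has no fixed point, an edge from x to x gives two darts  *)
(* with source x. Parallel edges are allowed.                                  *)
Record graph := Graph {
  vertex : choiceType;
  dart : choiceType;
  src : dart -> vertex;
  drev : dart -> dart;
  drevK : involutive drev;
  drev_neq : forall e, drev e != e }.

Definition tgt (Gam : graph) (e : dart Gam) : vertex Gam := src (drev e).

Definition regular (g : nat) (Gam : graph) : Prop :=
  forall x : vertex Gam, ([set e : dart Gam | src e = x] #= `I_g)%card.

Record subgraph (Gam : graph) := Subgraph {
  vset : set (vertex Gam);
  dset : set (dart Gam);
  dset_drev : forall e, dset e -> dset (drev e);
  dset_src : forall e, dset e -> vset (src e) }.

Section RemoveVertices.
Variables (Gam : graph) (D : subgraph Gam) (F : {fset vertex Gam}).

Definition remove_vset : set (vertex Gam) := [set x | vset D x /\ x \notin F].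
Definition remove_dset : set (dart Gam) :=
  [set e | [/\ dset D e, src e \notin F & tgt e \notin F]].

Fact remove_dset_drev e : remove_dset e -> remove_dset (drev e).
Proof.
by case=> De se te; split; [exact: dset_drev | | rewrite /tgt drevK].
Qed.

Fact remove_dset_src e : remove_dset e -> remove_vset (src e).
Proof. by case=> De se te; split; [exact: dset_src |]. Qed.

Definition remove_vertices : subgraph Gam :=
  Subgraph remove_dset_drev remove_dset_src.
End RemoveVertices.

(** * Walks, Green's function, bridges, loops *)

Section Paths.
Variable Gam : graph.
Implicit Types (x y : vertex Gam) (w l : seq (dart Gam)) (D : subgraph Gam).

Definition revpath w : seq (dart Gam) := rev (map (@drev Gam) w).

Fixpoint walk x w y : bool :=
  if w is e :: w' then (src e == x) && walk (tgt e) w' y else x == y.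

Definition bridge D x y w : Prop :=
  [/\ vset D x, vset D y, walk x w y & forall e, e \in w -> dset D e].

Definition rooted_loop D l : Prop := l != [::] /\ exists x, bridge D x x l.

Definition path_class w : set (seq (dart Gam)) := [set w; revpath w].

Definition loop_class l : set (seq (dart Gam)) :=
  [set l' | exists k, l' = rot k l \/ l' = rot k (revpath l)].

(* Unrooted unoriented loops, resp. unoriented paths, are represented by the   *)
(* equivalence classes themselves, as sets of dart sequences.                  *)
Definition uloop : choiceType := set (seq (dart Gam)).
Definition upath : choiceType := set (seq (dart Gam)).

Definition uloops D : set uloop := [set loop_class l | l in rooted_loop D].

Definition uloop_meets (F : {fset vertex Gam}) (c : uloop) : bool :=
  `[< exists2 l, c l & has (fun e => src e \in F) l >].

Variables (R : realType) (g : nat).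
Local Open Scope ereal_scope.

Definition path_weight w : R := ((g%:R : R)^-1 ^+ size w)%R.

Definition green D x y : \bar R := \esum_(w in bridge D x y) (path_weight w)%:E.

Definition green_finite D : Prop :=
  forall x y, vset D x -> vset D y -> green D x y < +oo.

(* The measure nu: the image of rho / 2, restricted to loops in D. *)
Definition loop_measure D (A : set uloop) : \bar R :=
  \esum_(l in [set l | rooted_loop D l /\ A (loop_class l)])
    (path_weight l / (size l)%:R / 2)%:E.

Definition bridge_prob D x y w : R :=
  (if `[< bridge D x y w >] then path_weight w / fine (green D x y) else 0)%R.

(** * Pairings, Z-bridges and the measure B *)

(* A pairing of the labels 'I_M is a fixed-point-free involution. *)
Definition pairing M (s : {ffun 'I_M -> 'I_M}) : bool :=
  [forall i, (s i != i) && (s (s i) == i)].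

(* To each label i are attached its partner and the bridge starting at i; an   *)
(* unoriented bridge joining i and j is stored once from i and once, reversed, *)
(* from j.                                                                     *)
Definition zpaths M : choiceType := {ffun 'I_M -> 'I_M * seq (dart Gam)}.

Definition partner M (b : zpaths M) : {ffun 'I_M -> 'I_M} := [ffun i => (b i).1].

Definition zbridge D M (z : 'I_M -> vertex Gam) (b : zpaths M) : Prop :=
  pairing (partner b) /\
  forall i, bridge D (z i) (z (partner b i)) (b i).2 /\
            (b (partner b i)).2 = revpath (b i).2.

(* The condition i < s i selects one label in each pair. *)
Definition pairing_weight D M (z : 'I_M -> vertex Gam) (s : {ffun 'I_M -> 'I_M})
    : R :=
  (\prod_(i < M | (i < s i)%N) fine (green D (z i) (z (s i))))%R.

Definition pairing_sum D M (z : 'I_M -> vertex Gam) : R :=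
  (\sum_(s : {ffun 'I_M -> 'I_M} | pairing s) pairing_weight D z s)%R.

Definition zbridge_mass D M (z : 'I_M -> vertex Gam) (b : zpaths M) : R :=
  let s := partner b in
  (if `[< zbridge D z b >] then
    pairing_weight D z s / pairing_sum D z *
    \prod_(i < M | (i < s i)%N) bridge_prob D (z i) (z (s i)) (b i).2
  else 0)%R.

(* Z-bridges for all possible numbers of labels. *)
Definition any_zpaths : Type := {M : nat & zpaths M}.

Definition zbridge_measure D (Z : seq (vertex Gam)) (A : set any_zpaths)
    : \bar R :=
  \esum_(b in [set b : zpaths (size Z) | A (existT zpaths (size Z) b)])
    (zbridge_mass D (tnth (in_tuple Z)) b)%:E.

End Paths.

(** * Excursions and their concatenation with Z-bridges *)

Section Excursions.
Variables (Gam : graph) (D : subgraph Gam) (F1 F2 : {fset vertex Gam}).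
Implicit Types (w l : seq (dart Gam)) (h : seq (seq (dart Gam))).

Definition excursion w : bool :=
  if w is e :: w' then
    [&& src e \in F2, tgt (last e w') \in F2,
        all (fun f => src f \notin F2) w' &
        has (fun x => x \in F1) (src e :: map (@tgt Gam) w)]
  else false.

(* All the portions take k (rot i l), indexed by starting point and length.    *)
Definition excursions_of l : seq (seq (dart Gam)) :=
  [seq w <- [seq take k (rot i l) | i <- iota 0 (size l), k <- iota 1 (size l)]
     | excursion w].

(* Multisets of loops are multiplicity functions. xget picks a representative  *)
(* of the class c; the count does not depend on it.                            *)
Definition excursion_mult (L : uloop Gam -> nat) (u : upath Gam) : nat :=
  (\sum_(c <- fset_set [set c | L c != 0%N])
     L c * count (fun w => `[< path_class w = u >])
                 (excursions_of (xget [::] c)))%N.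

(* A deterministic rule listing finite multisets of unoriented excursions. The *)
(* orientation under which an excursion appears in the list encodes the order  *)
(* of its two extremities in Z.                                                *)
Definition listing_rule (listing : (upath Gam -> nat) -> seq (seq (dart Gam)))
    : Prop :=
  forall m : upath Gam -> nat,
    finite_set [set u | m u != 0%N] ->
    (forall u, m u != 0%N -> exists2 w, excursion w & path_class w = u) ->
    forall u, count (fun w => `[< path_class w = u >]) (listing m) = m u.

(* Labels 2j and 2j+1 are the start and the end of the j-th excursion.         *)
Definition extremities h : seq (vertex Gam) :=
  flatten [seq if w is e :: w' then [:: src e; tgt (last e w')] else [::]
             | w <- h].

Definition zpoint h : 'I_(size (extremities h)) -> vertex Gam :=
  tnth (in_tuple (extremities h)).

Definition other_end M (i : 'I_M) : 'I_M :=
  insubd i (if odd i then i.-1 else i.+1).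

Definition excursion_from h M (i : 'I_M) : seq (dart Gam) :=
  let w := nth [::] h i./2 in if odd i then revpath w else w.

(* Enter an excursion at label i, follow it to its other end, and then the     *)
(* bridge attached there, up to the label next_label b i.                     *)
Definition next_label M (b : zpaths Gam M) (i : 'I_M) : 'I_M :=
  partner b (other_end i).

Definition piece h M (b : zpaths Gam M) (i : 'I_M) : seq (dart Gam) :=
  excursion_from h i ++ (b (other_end i)).2.

Definition loop_through h M (b : zpaths Gam M) (i : 'I_M) : uloop Gam :=
  loop_class (flatten [seq piece h b j | j <- orbit (next_label b) i]).

(* The concatenation has one loop for each connected component of the graph on *)
(* labels whose edges are the excursions and the bridges. Each such component  *)
(* consists of two orbits of next_label b, one for each orientation of the loop. *)
Definition label_rel M (b : zpaths Gam M) : rel 'I_M :=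
  fun i j => (j == partner b i) || (j == other_end i).

Definition concatenation h M (b : zpaths Gam M) (c : uloop Gam) : nat :=
  #|[pred i : 'I_M | roots (label_rel b) i && `[< loop_through h b i = c >]]|.

(* The unoriented Z-bridges in D \ F1 whose concatenation with h gives L.      *)
Definition completions h (L : uloop Gam -> nat) : set (any_zpaths Gam) :=
  [set existT (zpaths Gam) (size (extremities h)) b |
     b in [set b | zbridge (remove_vertices D F1) (@zpoint h) b /\
                   concatenation h b = L]].

End Excursions.

(** * Poisson point processes and conditional distributions *)

Section Probability.
Context {R : realType} {d : measure_display} {Om : measurableType d}.
Variable P : probability Om R.
Local Open Scope ereal_scope.

Definition npoints (X : choiceType) (m : X -> nat) (A : set X) : \bar R :=
  \esum_(x in A) (m x)%:R%:E.

(* A Poisson point process on a discrete space S with intensity nu, given by   *)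
(* the multiplicities N w x of its points. The nat argument of poisson_prob is *)
(* a dummy; poisson_pmf is avoided because it is not the mass function of the  *)
(* Poisson law when the rate is 0.                                             *)
Definition poisson_point_process (X : choiceType) (S : set X)
    (nu : set X -> \bar R) (N : Om -> X -> nat) : Prop :=
  [/\ forall w x, N w x != 0%N -> S x,
      forall (A : set X) (k : nat), nu A < +oo ->
        measurable [set w | npoints (N w) A = k%:R%:E] /\
        P [set w | npoints (N w) A = k%:R%:E]
          = poisson_prob (fine (nu A)) 0%N [set k]
    & forall (n : nat) (A : 'I_n -> set X) (k : 'I_n -> nat),
        (forall i, nu (A i) < +oo) -> trivIset setT A ->
        P (\bigcap_i [set w | npoints (N w) (A i) = (k i)%:R%:E])
          = \prod_(i < n) P [set w | npoints (N w) (A i) = (k i)%:R%:E]].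

Definition uniform_mass (T : choiceType) (C : set T) (x : T) : R :=
  (if `[< C x >] then (#|` fset_set C|%fset)%:R^-1 else 0)%R.

(* The kernel kappa is a conditional distribution of Y given X; the spaces X   *)
(* and Y take their values in carry the discrete sigma-algebra.                *)
Definition conditional_distribution (TX TY : Type) (X : Om -> TX) (Y : Om -> TY)
    (kappa : TX -> set TY -> \bar R) : Prop :=
  forall (E : set TX) (A : set TY),
    measurable (X @^-1` E) /\
    P (X @^-1` E `&` Y @^-1` A) = \int[P]_(w in X @^-1` E) kappa (X w) A.

Section Soup.
Variables (g : nat) (Gam : graph) (D : subgraph Gam).
Variables (F1 F2 : {fset vertex Gam}).
Variable N : Om -> uloop Gam -> nat.

Definition loop_soup (c : R) : Prop :=
  poisson_point_process (uloops D) (fun A => c%:E * loop_measure R g D A) N.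

Definition crossing_loops (w : Om) (l : uloop Gam) : nat :=
  if uloop_meets F1 l && uloop_meets F2 l then N w l else 0%N.

(* On the null event where infinitely many loops meet both F1 and F2, fset_set *)
(* makes excursion_mult the empty multiset.                                    *)
Definition excursion_list (listing : (upath Gam -> nat) -> seq (seq (dart Gam)))
    (w : Om) : seq (seq (dart Gam)) :=
  listing (excursion_mult F1 F2 (crossing_loops w)).

(* Given the loops that meet both F1 and F2, beta is uniform among the         *)
(* Z-bridges that complete eta into these loops. When the excursions in eta    *)
(* are distinct and differ from their time-reversals, there is only one: the   *)
(* missing parts of the loops.                                                 *)
Definition missing_parts (listing : (upath Gam -> nat) -> seq (seq (dart Gam)))
    (beta : Om -> any_zpaths Gam) : Prop :=
  (forall A, measurable (beta @^-1` A)) /\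
  forall L : uloop Gam -> nat, finite_set [set l | L l != 0%N] ->
  forall b : any_zpaths Gam,
    P ([set w | crossing_loops w = L] `&` [set w | beta w = b])
    = P [set w | crossing_loops w = L] *
      (uniform_mass
         (completions D F1 (listing (excursion_mult F1 F2 L)) L) b)%:E.

End Soup.
End Probability.

(* Main.v *)
(* The finite multisets L of crossing loops have probability proportional to      *)
(* g^-|L| / |Aut L|, where |L| is the total length and |Aut L| the product over    *)
(* the classes c of L(c)! times the L(c)-th power of the number of dihedral        *)
(* symmetries of c. Given the list h of excursions, a Z-bridge b glues h into such *)
(* an L. The relabellings of the extremities that preserve the excursions act      *)
(* transitively on the Z-bridges that complete h into L, and the stabilizer of b   *)
(* is isomorphic to Aut L. So there are |Aut h| / |Aut L| completions, and the     *)
(* uniform choice among them gives to the pair (h, b) a probability proportional   *)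
(* to g^-|L| / |Aut h|, in which only the factor g^-|b| depends on b.              *)

(* The Poisson law gives a finite multiset [L] of crossing classes the probability e^-rate times the
   product over c of nu(c)^L(c) / L(c)!. By orbit-stabilizer for the dihedral action on rooted
   loops, nu(c) = g^-|c| / |sym c| ([loop_measure_class]), so this is a constant times g^-|L| / |Aut
   L| ([probability_crossing_loops]). The uniform choice of the bridge among |Aut h| / |Aut L|
   completions ([card_completions]) cancels |Aut L|, and P(eta = h, beta = b) becomes
   [list_weight h] times g^-|b| ([probability_bridge_event]). Summing over b, the weights g^-|b| add
   up to the partition function [pairing_sum] ([esum_zbridge]); the quotient is the bridge measure.

   The combinatorics rests on [gluing]: a finite set of labels, the ends of the excursions, with two
   fixed-point-free involutions, one following an excursion and the other a bridge. From each label
   one reads a cyclic word. Bridges avoid F1 and excursions avoid F2 in their interior, so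
   excursions can start in this word only where the gluing puts them ([estart_rot_word]). Hence the
   words read in a component are, with multiplicities, the dihedral images of one loop that start
   with an excursion ([dihedral_component]), and a word determines its component as a pointed
   structure ([similar_wordE]). The count [card_isos], done one component at a time, then yields
   |Aut L| isomorphisms between any two gluings of [L].

   That some completion exists follows by cutting each crossing loop at its visits to F2
   ([excursion_decomposition]), gluing the pieces back on abstract labels ([gluing_exists]), and
   identifying these labels with those of the list ([matching], [completion_exists]). *)
Require Import Defs.
From HB Require Import structures.
From mathcomp Require Import all_boot finmap zify boolp.
Set Implicit Arguments.
Unset Strict Implicit.
Unset Printing Implicit Defensive.

(** * Rotations and reversals of loops *)

Lemma sumn_flatten_size (T : Type) (ss : seq (seq T)) :
  size (flatten ss) = (\sum_(s <- ss) size s)%N.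
Proof. by elim: ss => [|s ss IH];
  rewrite ?big_nil ?big_cons //= size_cat IH. Qed.

Section Rotations.
Variable T : eqType.
Implicit Types l : seq T.

Definition rotations l := [seq rot k l | k <- iota 0 (size l)].

Lemma size_rotations l : size (rotations l) = size l.
Proof. by rewrite size_map size_iota. Qed.

Lemma rotations_rot1 l : rotations (rot 1 l) = rot 1 (rotations l).
Proof.
case: (posnP (size l)) => [/size0nil ->//|n_gt0].
rewrite /rotations size_rot -[in RHS](prednK n_gt0) /= rot1_cons rot0.
have -> : [seq rot k (rot 1 l) | k <- iota 0 (size l)] =
          [seq rot k l | k <- iota 1 (size l)].
  rewrite [iota 1 _](iotaDl 1 0) -map_comp; apply/eq_in_map => k.
  by rewrite mem_iota /= => k_lt; rewrite rot_rot -rotS ?add1n //; lia.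
rewrite -{1}(prednK n_gt0) -(addn1 _.-1) iotaD map_cat cats1 /=.
by rewrite add1n prednK // rot_size.
Qed.

Lemma rotations_rot k l : perm_eq (rotations (rot k l)) (rotations l).
Proof.
have [k_lt|/rot_oversize -> //] := ltnP k (size l).
elim: k k_lt => [|k IH] k_lt; first by rewrite rot0.
rewrite rotS ?(ltnW k_lt) // rotations_rot1 perm_rot.
exact: IH (ltnW k_lt).
Qed.

Lemma mem_rotations l x : l != [::] ->
  reflect (exists k, x = rot k l) (x \in rotations l).
Proof.
move=> l0; apply: (iffP mapP) => [[k _ ->]|[k ->]]; first by exists k.
have [k_lt|/rot_oversize ->] := ltnP k (size l).
  by exists k => //; rewrite mem_iota.
by exists 0%N; rewrite ?rot0 // mem_iota /= add0n lt0n size_eq0.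
Qed.

Lemma map_rot_rotations k l : perm_eq (map (rot k) (rotations l)) (rotations l).
Proof.
rewrite -map_comp /= (_ : map _ _ = rotations (rot k l)) ?rotations_rot //.
by rewrite /rotations size_rot; apply: eq_map => j /=; rewrite rot_rot.
Qed.

End Rotations.

(** * The dihedral action on words of darts, and walks *)

Section Words.
Variable Gam : graph.
Implicit Types (l x w : seq (dart Gam)) (p q : vertex Gam).

Lemma revpathK : involutive (@revpath Gam).
Proof.
move=> w; rewrite /revpath map_rev revK -map_comp -[RHS]map_id.
by apply: eq_map => e /=; rewrite drevK.
Qed.

Lemma revpath_cat w w' : revpath (w ++ w') = revpath w' ++ revpath w.
Proof. by rewrite /revpath map_cat rev_cat. Qed.

Lemma size_revpath w : size (revpath w) = size w.
Proof. by rewrite /revpath size_rev size_map. Qed.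

Lemma revpath_rot k l : revpath (rot k l) = rotr k (revpath l).
Proof. by rewrite /revpath map_rot rev_rot. Qed.

Lemma revpath_take k w : revpath (take k w) = drop (size w - k) (revpath w).
Proof.
by rewrite /revpath map_take -[in LHS](revK (map _ w)) take_rev revK size_rev
  size_map.
Qed.

Lemma mem_revpath w e : (e \in revpath w) = (drev e \in w).
Proof.
rewrite /revpath mem_rev; apply/mapP/idP => [[f fw ->]|ew]; first by
  rewrite drevK.
by exists (drev e); rewrite ?drevK.
Qed.

(** Kept as a list with repetitions, so that the number of occurrences of a word measures a
    stabilizer. *)
Definition dihedral l := rotations l ++ rotations (revpath l).

Lemma size_dihedral l : size (dihedral l) = (size l).*2.
Proof. by rewrite size_cat !size_rotations size_revpath addnn. Qed.

(** Reversal turns a rotation by k into one by -k: the entry k = 0 is fixed and the others come in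
    the opposite order. *)
Lemma rotations_revpath l :
  perm_eq (map (@revpath Gam) (rotations l)) (rotations (revpath l)).
Proof.
rewrite /rotations -map_comp size_revpath.
have -> : map (@revpath Gam \o rot^~ l) (iota 0 (size l)) =
  [seq rotr k (revpath l) | k <- iota 0 (size l)].
  by apply: eq_map => k /=; rewrite revpath_rot.
have [->//|l0] := eqVneq l [::].
set r := revpath l; have sr : size r = size l by rewrite size_revpath.
have n_gt0 : (0 < size l)%N by rewrite lt0n size_eq0.
rewrite -(prednK n_gt0) /= {1}/rotr subn0 rot_size rot0 perm_cons.
rewrite -perm_rev -map_rev; apply/permP => a; congr count.
apply: (@eq_from_nth _ [::]) => [|i]; rewrite !size_map ?size_rev size_iota //.
move=> i_lt; rewrite !(nth_map 0%N) ?size_rev ?size_iota // nth_rev ?size_iota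
  //.
by rewrite !nth_iota ?size_iota; try lia; rewrite /rotr sr; congr rot; lia.
Qed.

Lemma dihedral_rot k l : perm_eq (dihedral (rot k l)) (dihedral l).
Proof.
apply: perm_cat; first exact: rotations_rot.
by rewrite revpath_rot /rotr rotations_rot.
Qed.

Lemma dihedral_revpath l : perm_eq (dihedral (revpath l)) (dihedral l).
Proof. by rewrite /dihedral revpathK perm_catC. Qed.

(** The empty word is excluded because [dihedral [::]] is empty while its class is not. *)
Lemma loop_classE l x : l != [::] -> loop_class l x <-> x \in dihedral l.
Proof.
move=> l0; have r0 : revpath l != [::] by
  rewrite -size_eq0 size_revpath size_eq0.
rewrite mem_cat; split=> [[k [->|->]]|/orP[/mem_rotations|/mem_rotations]].
- by apply/orP; left; apply/mem_rotations => //; exists k.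
- by apply/orP; right; apply/mem_rotations => //; exists k.
- by case=> // k ->; exists k; left.
- by case=> // k ->; exists k; right.
Qed.

Lemma loop_class_refl l : loop_class l l.
Proof. by exists 0%N; left; rewrite rot0. Qed.

Lemma loop_class_dihedral l x : loop_class l x ->
  perm_eq (dihedral x) (dihedral l).
Proof.
move=> [k [->|->]]; first exact: dihedral_rot.
exact: perm_trans (dihedral_rot _ _) (dihedral_revpath _).
Qed.

Lemma size_loop_class l x : loop_class l x -> size x = size l.
Proof. by case=> k [->|->]; rewrite size_rot ?size_revpath. Qed.

Lemma loop_class_eq l x : loop_class l x -> loop_class x = loop_class l.
Proof.
have [-> [k]|l0 lx] := eqVneq l [::].
  by rewrite /revpath /= /rot drop_oversize //= => -[] ->.
have x0 : x != [::] by rewrite -size_eq0 (size_loop_class lx) size_eq0.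
apply/boolp.funext => y; apply/boolp.propext.
by rewrite !loop_classE // (perm_mem (loop_class_dihedral lx)).
Qed.

Lemma loop_class_eqP l x : loop_class x = loop_class l <-> loop_class l x.
Proof. by split=> [<-|/loop_class_eq//]; exact: loop_class_refl. Qed.

(* The order of the stabilizer of l in the dihedral group acting on positions. *)
Definition symmetries l := count_mem l (dihedral l).

(** Rotations and reversal are injective and permute the list [dihedral l], so all members of the
    class occur in it equally often. *)
Lemma count_dihedral l x : loop_class l x ->
  count_mem x (dihedral l) = symmetries l.
Proof.
have map_dih f (finj : injective f) y : perm_eq (map f (dihedral l)) (dihedral
  l) ->
    count_mem (f y) (dihedral l) = count_mem y (dihedral l).
  move=> /permP/(_ (pred1 (f y))) <-; rewrite count_map; apply: eq_count =>
    z /=.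
  by rewrite (inj_eq finj).
have drot k : perm_eq (map (rot k) (dihedral l)) (dihedral l).
  by rewrite map_cat perm_cat ?map_rot_rotations.
have drev : perm_eq (map (@revpath Gam) (dihedral l)) (dihedral l).
  rewrite map_cat perm_sym perm_catC perm_sym perm_cat ?rotations_revpath //.
  by rewrite -{2}(revpathK l) rotations_revpath.
case=> k [->|->]; rewrite map_dih //; try exact: rot_inj.
by rewrite map_dih //; exact: inv_inj revpathK.
Qed.

Lemma symmetries_eq l x : loop_class l x -> symmetries x = symmetries l.
Proof.
move=> lx; rewrite -(count_dihedral lx).
by rewrite /symmetries (permP (loop_class_dihedral lx)).
Qed.

Lemma symmetries_gt0 l : l != [::] -> (0 < symmetries l)%N.
Proof.
move=> l0; rewrite -has_count has_pred1; apply/loop_classE => //.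
exact: loop_class_refl.
Qed.

(** Orbit-stabilizer for the dihedral action on rooted representatives. *)
Lemma size_loop_class_symmetries l : l != [::] ->
  (size (undup (dihedral l)) * symmetries l = (size l).*2)%N.
Proof.
move=> l0; rewrite -size_dihedral -[RHS](sum1_size) -big_undup_iterop_count /=.
rewrite (eq_big_seq (fun=> symmetries l)) => [|x].
  by rewrite big_const_seq count_predT iter_addn_0 mulnC.
rewrite mem_undup => /loop_classE-/(_ l0) xl.
by rewrite count_dihedral // Monoid.iteropE iter_addn_0 mul1n.
Qed.

Lemma walk_cat p w w' q :
  walk p (w ++ w') q <-> exists2 z, walk p w z & walk z w' q.
Proof.
elim: w p => [|e w IH] p /=.
  by split=> [|[z /eqP ->//]]; exists p.
split=> [/andP[-> /IH[z]]|[z /andP[-> wz] w'q]]; first by exists z.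
by apply/IH; exists z.
Qed.

Lemma walk_rev p w q : walk p w q -> walk q (revpath w) p.
Proof.
elim: w p => [|e w IH] p /= => [/eqP -> //|/andP[/eqP <- /IH wq]].
rewrite /revpath map_cons rev_cons -cats1; apply/walk_cat; exists (tgt e) =>
  //=.
by rewrite /tgt drevK !eqxx.
Qed.

Lemma walk_det p w q q' : walk p w q -> walk p w q' -> q = q'.
Proof.
elim: w p => [|e w IH] p /= => [/eqP <- /eqP //|/andP[_ wq] /andP[_]].
exact: IH wq.
Qed.

Lemma walk_last p e w q : walk p (e :: w) q -> tgt (last e w) = q.
Proof.
elim: w p e => [|f w IH] p e /= /andP[_]; first by move/eqP.
exact: IH.
Qed.

Lemma walk_take_drop k p w q : walk p w q ->
  exists2 z, walk p (take k w) z & walk z (drop k w) q.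
Proof. by rewrite -{1}(cat_take_drop k w) => /walk_cat. Qed.

Lemma walk_rot k p l : walk p l p -> exists q, walk q (rot k l) q.
Proof.
move=> /(walk_take_drop k)[z wz zw]; exists z; apply/walk_cat; by exists p.
Qed.

End Words.

(** * Excursions at the start of a loop *)

Section ExcursionPrefixes.
Variables (Gam : graph) (F1 F2 : {fset vertex Gam}).
Implicit Types (l x w : seq (dart Gam)) (p q : vertex Gam).
Local Notation excursion := (excursion F1 F2).
Local Notation excursions_of := (excursions_of F1 F2).

Lemma walk_tgts p e w q : walk p (e :: w) q ->
  map (@tgt Gam) (e :: w) = rcons (map (@src Gam) w) q.
Proof.
elim: w p e => [|f w IH] p e /= /andP[_]; first by move=> /eqP ->.
move=> we; rewrite -(IH (tgt e) f we) /=; congr cons.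
by case/andP: we => /eqP ->.
Qed.

Lemma excursionE p e w q : walk p (e :: w) q -> excursion (e :: w) =
  [&& p \in F2, q \in F2, all (fun y => y \notin F2) (map (@src Gam) w) &
      has (fun y => y \in F1) (p :: rcons (map (@src Gam) w) q)].
Proof.
move=> ew; rewrite -(walk_tgts ew) /= all_map (walk_last ew).
by case/andP: ew => /eqP ->.
Qed.

Lemma excursion_revpath p w q : walk p w q -> excursion w ->
  excursion (revpath w).
Proof.
case: w => [//|e w] ew; rewrite (excursionE ew) => /and4P[pF qF wF hF].
have re := walk_rev ew; have:= size_revpath (e :: w).
have tr : map (@src Gam) (revpath (e :: w)) = q :: rev (map (@src Gam) w).
  rewrite /revpath map_rev -map_comp -[map (_ \o _) _]/(map (@tgt Gam) _).
  by rewrite (walk_tgts ew) rev_rcons.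
case: (revpath _) tr re => [//|f v] [_ vE] re _; rewrite (excursionE re) vE.
rewrite qF pF all_rev wF; move: hF; rewrite /= !has_rcons has_rev.
by case: (p \in F1); case: (q \in F1); rewrite ?orbT.
Qed.

(** The shorter excursion ends in F2, at a vertex that is interior to the longer word. *)
Lemma excursion_prefix_free p w e w' q :
  excursion w -> walk p (w ++ e :: w') q -> ~~ excursion (w ++ e :: w').
Proof.
case: w => [//|f w] ew /walk_cat[z wz zw].
have:= walk_last wz; case/andP: zw => /eqP <- _ le.
case/and4P: ew => _ + _ _; rewrite le => eF /=.
by rewrite all_cat /= eF !andbF.
Qed.

Definition exprefixes x :=
  [seq w <- [seq take k x | k <- iota 1 (size x)] | excursion w].

Lemma exprefixesP x w :
  reflect (excursion w /\ exists r, x = w ++ r) (w \in exprefixes x).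
Proof.
rewrite mem_filter; apply: (iffP andP) => -[ew].
  by case/mapP=> k _ wE; split=> //; exists (drop k x);
    rewrite wE cat_take_drop.
case=> r ->; split=> //; apply/mapP; exists (size w); last by
  rewrite take_size_cat.
rewrite mem_iota size_cat; case: w ew => [|e w] // _; rewrite /=; lia.
Qed.

Lemma excursion_prefix_uniq p w w' r r' q : walk p (w ++ r) q ->
  w ++ r = w' ++ r' -> excursion w -> excursion w' -> w = w' /\ r = r'.
Proof.
wlog sww : w w' r r' / size w <= size w' => [H|] wr wrE ew ew'.
  have [s|/ltnW s] := leqP (size w) (size w'); first exact: H s _ _ _ _.
  have wr' := wr; rewrite wrE in wr'.
  by case: (H _ _ _ _ s wr' (esym wrE) ew' ew) => -> ->.
have w'E : w' = w ++ drop (size w) w'.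
  rewrite -{1}(cat_take_drop (size w) w'); congr (_ ++ _).
  by rewrite -[RHS](take_size_cat r (erefl (size w))) wrE takel_cat.
case: (drop _ w') w'E => [|e v] w'E.
  rewrite cats0 in w'E; split; first by [].
  by move/eqP: wrE; rewrite w'E eqseq_cat // eqxx => /eqP.
move: wr; rewrite wrE w'E => /walk_cat[z /(excursion_prefix_free ew)].
by rewrite -w'E ew'.
Qed.

Lemma exprefixesE p w r q : walk p (w ++ r) q -> excursion w ->
  exprefixes (w ++ r) = [:: w].
Proof.
move=> wr ew.
have w_in : w \in exprefixes (w ++ r) by apply/exprefixesP; split=> //;
  exists r.
have all_w v : v \in exprefixes (w ++ r) -> v = w.
  by move/exprefixesP=> [ev [s /esym vE]];
    case: (excursion_prefix_uniq wr (esym vE) ew ev).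
have: uniq (exprefixes (w ++ r)).
  apply: filter_uniq; rewrite map_inj_in_uniq ?iota_uniq // => i j.
  rewrite !mem_iota !add1n !ltnS => /andP[_ i_le] /andP[_ j_le] /(congr1 size).
  by rewrite !size_takel.
case: (exprefixes _) w_in all_w => [//|a [|b s]] w_in all_w.
  by rewrite (all_w a) ?mem_head.
by rewrite /= (all_w a) ?mem_head // (all_w b) ?inE ?eqxx ?orbT.
Qed.

Definition estart x := has excursion [seq take k x | k <- iota 1 (size x)].

Lemma estartE x : estart x = (exprefixes x != [::]).
Proof. by rewrite /estart has_filter. Qed.

Lemma estartP x :
  reflect (exists w r, x = w ++ r /\ excursion w) (estart x).
Proof.
apply: (iffP hasP) => [[w xw ew]|[w [r [xE ew]]]]; last first.
  have : w \in exprefixes x by apply/exprefixesP; split=> //; exists r.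
  by rewrite mem_filter => /andP[_ xw]; exists w.
have : w \in exprefixes x by rewrite mem_filter ew.
by case/exprefixesP=> _ [r ->]; exists w, r.
Qed.

Lemma excursions_ofE l : excursions_of l = flatten (map exprefixes (rotations
  l)).
Proof.
rewrite /excursions_of filter_flatten /rotations -!map_comp; congr flatten.
by apply: eq_map => i /=; rewrite /exprefixes size_rot.
Qed.

Lemma count_excursions_of a l :
  count a (excursions_of l) = \sum_(x <- rotations l) count a (exprefixes x).
Proof. by rewrite excursions_ofE count_flatten sumnE !big_map. Qed.

Lemma count_excursions_of_rot a k l :
  count a (excursions_of (rot k l)) = count a (excursions_of l).
Proof. by rewrite !count_excursions_of; apply: perm_big;
  exact: rotations_rot. Qed.

(** Reversal moves the starting point of an excursion but keeps its length, so the comparison with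
    the reversed loop is made length by length. *)
Lemma count_excursions_of_by_length a l : count a (excursions_of l) =
  \sum_(1 <= k < (size l).+1)
     \sum_(x <- rotations l) (a (take k x) && excursion (take k x)).
Proof.
rewrite exchange_big count_excursions_of /=; apply: eq_big_seq => x.
case/mapP=> j _ xE; rewrite count_filter -sum1_count big_map big_mkcond /=.
by rewrite xE size_rot /index_iota subSS subn0; apply: eq_bigr => i _;
  case: (a _ && _).
Qed.

(* Reversal sends the excursion of length k at the start of x to the one at the *)
(* start of the reversal of rot k x. *)
Lemma count_excursions_of_revpath p (a : pred (seq (dart Gam))) l :
  (forall w, a (revpath w) = a w) -> walk p l p ->
  count a (excursions_of (revpath l)) = count a (excursions_of l).
Proof.
move=> arev lp; rewrite !count_excursions_of_by_length size_revpath.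
apply: eq_big_nat => k /andP[_ k_le].
rewrite -(perm_big _ (rotations_revpath l)) /= big_map.
rewrite -(perm_big _ (map_rot_rotations k l)) /= big_map.
apply: eq_big_seq => x /mapP[j _ xE]; congr nat_of_bool.
have [q xq] : exists q, walk q x q by rewrite xE; exact: walk_rot lp.
have sx : size x = size l by rewrite xE size_rot.
have -> : take k (revpath (rot k x)) = revpath (take k x).
  rewrite revpath_rot revpath_take sx /rotr /rot size_revpath sx take_cat.
  by rewrite size_drop size_revpath sx subKn // ltnn subnn take0 cats0.
rewrite arev; congr andb; case: (walk_take_drop k xq) => z xz _.
apply/idP/idP => [|]; last exact: excursion_revpath xz.
by move/(excursion_revpath (walk_rev xz)); rewrite revpathK.
Qed.

Lemma count_excursions_of_class p (a : pred (seq (dart Gam))) l x :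
  (forall w, a (revpath w) = a w) -> walk p l p -> loop_class l x ->
  count a (excursions_of x) = count a (excursions_of l).
Proof.
move=> arev lp [k [->|->]]; rewrite count_excursions_of_rot //.
exact: count_excursions_of_revpath lp.
Qed.

(* Each excursion of a loop starts one of its rotations, and its reversal starts *)
(* one of the rotations of the reversed loop. *)
Lemma double_count_excursions_of p (a : pred (seq (dart Gam))) l :
  (forall w, a (revpath w) = a w) -> walk p l p ->
  (count a (excursions_of l)).*2 = \sum_(x <- dihedral l) count a (exprefixes
    x).
Proof.
move=> arev lp; rewrite big_cat /= -!count_excursions_of.
by rewrite (count_excursions_of_revpath arev lp) addnn.
Qed.

End ExcursionPrefixes.

(** * Components under two involutions, and maps between them *)

(** * Isomorphisms of sets with two involutions *)

Section TwoInvolutions.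
Variables (T : finType) (o s : T -> T).
Hypotheses (oK : involutive o) (sK : involutive s).

(** The disjuncts have the same order as in [label_rel], so that [concatenation] and [concat_mult]
    choose the same roots by conversion. *)
Definition step : rel T := fun i j => (j == s i) || (j == o i).

Lemma step_sym : symmetric step.
Proof.
by move=> i j; rewrite /step; congr orb; apply/eqP/eqP => ->; rewrite ?oK ?sK.
Qed.

Lemma step_connect_sym : connect_sym step.
Proof. exact/sym_connect_sym/step_sym. Qed.

Definition component t : {set T} := [set j | connect step t j].

Lemma component_refl t : t \in component t.
Proof. by rewrite inE connect0. Qed.

Definition stable (S : {set T}) := forall t, t \in S -> o t \in S /\ s t \in S.

Lemma stable_mem (S : {set T}) t : stable S ->
  ((o t \in S) = (t \in S)) * ((s t \in S) = (t \in S)).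
Proof.
move=> St; split; apply/idP/idP => /St[]; by rewrite ?oK ?sK.
Qed.

Lemma stable_component t : stable (component t).
Proof.
move=> j; rewrite !inE => tj; split; apply: connect_trans tj (connect1 _);
  by rewrite /step eqxx ?orbT.
Qed.

Lemma stableD (S S' : {set T}) : stable S -> stable S' -> stable (S :\: S').
Proof. by move=> St St' t; rewrite !inE !(stable_mem _ St') =>
  /andP[-> /St[-> ->]]. Qed.

(** Induction along a path from [t]. Closure of [S] is asked only inside the component, the only
    place where a partial isomorphism is controlled. *)
Lemma component_ind (S : {set T}) t :
  t \in S -> (forall j, j \in component t -> j \in S ->
    o j \in S /\ s j \in S) ->
  component t \subset S.
Proof.
move=> tS clS; apply/subsetP => j; rewrite inE => /connectP[p].
elim/last_ind: p j => [|p k IH] j /=; first by move=> _ ->.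
rewrite rcons_path last_rcons => /andP[tp lk] ->.
have lS := IH _ tp erefl; have lK : last t p \in component t.
  by rewrite inE; apply/connectP; exists p.
by case: (clS _ lK lS) => ? ?; case/orP: lk => /eqP ->.
Qed.

Lemma component_sub (S : {set T}) t : stable S -> t \in S ->
  component t \subset S.
Proof. by move=> St tS; apply: component_ind => // j _; apply: St. Qed.

Lemma component_eq t j : j \in component t -> component j = component t.
Proof.
rewrite inE => tj; apply/setP => k; rewrite !inE.
by rewrite -(same_connect step_connect_sym tj).
Qed.

Lemma card_roots_component (a : pred T) t :
  (forall j, j \in component t -> a j = a t) ->
  #|[set j in component t | roots step j && a j]| = a t.
Proof.
move=> aE; rewrite -[RHS]mul1n -(n_comp_connect step_connect_sym t).
rewrite /n_comp_mem; case at_ : (a t); rewrite ?muln1 ?muln0.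
  apply: eq_card => j; rewrite !inE; case tj : (connect step t j);
    rewrite ?andbF //=.
  by rewrite aE ?inE // at_ andbC.
apply: eq_card0 => j; rewrite !inE; case tj : (connect step t j); rewrite //=.
by rewrite aE ?inE // at_ andbF.
Qed.

End TwoInvolutions.

(** * Counting isomorphisms one component at a time *)

Section PartialIsos.
Variables (T T' : finType) (o s : T -> T) (o' s' : T' -> T').
Variables (Lab : eqType) (lam : T -> Lab) (lam' : T' -> Lab) (d : T -> T').
Hypotheses (oK : involutive o) (sK : involutive s).
Hypotheses (oK' : involutive o') (sK' : involutive s').
Local Notation K := (component o s).
Local Notation K' := (component o' s').
Implicit Types (f g : {ffun T -> T'}).

Definition is_local_iso f t :=
  [&& f (o t) == o' (f t), f (s t) == s' (f t) & lam' (f t) == lam t].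

(* Setting f = d outside of S makes f determined by its restriction to S. *)
Definition isos (S : {set T}) (S' : {set T'}) : {set {ffun T -> T'}} :=
  [set f : {ffun T -> T'} |
    [&& [forall t, if t \in S then (f t \in S') && is_local_iso f t else f t ==
      d t]
      & dinjectiveb f (mem S)]].

Lemma isosP (S : {set T}) (S' : {set T'}) f :
  reflect [/\ forall t, t \notin S -> f t = d t,
              forall t, t \in S -> [/\ f t \in S', f (o t) = o' (f t),
                 f (s t) = s' (f t) & lam' (f t) = lam t] &
              {in S &, injective f}]
          (f \in isos S S').
Proof.
rewrite inE; apply: (iffP andP) =>
  [[/forallP fS /dinjectiveP finj]|[fd fS finj]].
  split=> // t tS; first by have:= fS t; rewrite (negbTE tS) => /eqP.
  by have:= fS t; rewrite tS => /and4P[-> /eqP -> /eqP -> /eqP ->].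
split; last exact/dinjectiveP.
apply/forallP => t; case: ifPn => [/fS[-> e1 e2 e3]|/fd -> //].
by rewrite /is_local_iso e1 e2 e3 !eqxx.
Qed.

(** Isomorphism of pointed components; by [isos_uniq] there is at most one such map. *)
Definition similar t t' := [exists f in isos (K t) (K' t'), f t == t'].

Lemma isos_restrict (S : {set T}) (S' : {set T'}) f r : f \in isos S S' ->
  stable o s S -> r \in S ->
  [ffun t => if t \in K r then f t else d t] \in isos (K r) (K' (f r)).
Proof.
case/isosP=> fd fS finj St rS; have KS := component_sub St rS.
have KSr t : t \in K r -> t \in S by apply/subsetP.
have fK : K r \subset [set t | f t \in K' (f r)].
  apply: component_ind; first by rewrite inE component_refl.
  move=> j /KSr /fS [_ fo fs _]; rewrite in_set => /stable_component[oj sj].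
  by split; rewrite in_set ?fo ?fs.
apply/isosP; split=> [t tK|t tK|t1 t2 t1K t2K].
- by rewrite ffunE (negbTE tK).
- rewrite !ffunE !(stable_mem oK sK _ (@stable_component _ _ _ _)) ?tK //.
  case: (fS _ (KSr _ tK)) => _ -> -> ->; split=> //.
  by have:= subsetP fK _ tK; rewrite inE.
- by rewrite !ffunE t1K t2K; apply: finj; exact: KSr.
Qed.

(** The image is stable under both involutions and contains [t'], hence fills its component. *)
Lemma isos_image r t' f : f \in isos (K r) (K' t') -> f r = t' ->
  f @: K r = K' t'.
Proof.
case/isosP=> _ fS _ fr; apply/eqP; rewrite eqEsubset; apply/andP; split.
  by apply/subsetP => _ /imsetP[t /fS[tK _ _ _] ->].
apply: component_sub => [_ /imsetP[t tK ->]|].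
  case: (fS _ tK) => _ <- <- _; case: (stable_component tK) => oK1 sK1.
  by split; apply: imset_f.
by rewrite -fr imset_f // component_refl.
Qed.

Lemma isos_uniq r f g S1 S2 :
  f \in isos (K r) S1 -> g \in isos (K r) S2 -> f r = g r -> f = g.
Proof.
case/isosP=> fd fS _ /isosP[gd gS _] fgr; apply/ffunP => t.
have [tK|tK] := boolP (t \in K r); last by rewrite fd ?gd.
suff /subsetP/(_ t tK) : K r \subset [set t | f t == g t] by rewrite inE =>
  /eqP.
apply: component_ind; first by rewrite inE fgr.
move=> j jK; rewrite !inE => /eqP fgj.
case: (fS _ jK) => _ -> -> _; case: (gS _ jK) => _ -> -> _.
by rewrite fgj !eqxx.
Qed.

(** Once [r] is sent to [t'], the map is forced on the component of [r] and, being injective, sends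
    the rest of [S] outside the component of [t']. Forgetting the component is therefore a
    bijection. *)
Lemma card_isos_fiber (S : {set T}) (S' : {set T'}) r t' : stable o s S ->
  stable o' s' S' ->
  r \in S -> t' \in S' -> similar r t' ->
  #|[set f in isos S S' | f r == t']| = #|isos (S :\: K r) (S' :\: K' t')|.
Proof.
move=> St St' rS t'S' /existsP[h /andP[hI /eqP hr]].
have KS t : t \in K r -> t \in S by apply/subsetP; exact: component_sub.
have KS' t : t \in K' t' -> t \in S' by apply/subsetP; exact: component_sub.
have himg := isos_image hI hr.
pose res f := [ffun t => if t \in K r then d t else f t].
have rK := component_refl o s r.
have fE f : f \in [set f in isos S S' | f r == t'] -> {in K r, f =1 h}.
  rewrite inE => /andP[fI /eqP fr] t tK.
  have := isos_restrict fI St rS; rewrite fr => fI'.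
  have <- : [ffun t => if t \in K r then f t else d t] = h.
    by apply: (isos_uniq fI' hI); rewrite ffunE rK fr hr.
  by rewrite ffunE tK.
have Kst t : ((o t \in K r) = (t \in K r)) * ((s t \in K r) = (t \in K r)).
  exact: (stable_mem oK sK _ (@stable_component _ _ _ _)).
rewrite -(@card_in_imset _ _ res) => [|f g fI gI]; last first.
  move/ffunP=> fg; apply/ffunP => t; have:= fg t; rewrite !ffunE.
  by case: ifP => // tK _; rewrite (fE f) ?(fE g).
apply: eq_card; apply/subset_eqP/andP; split; apply/subsetP => g.
  case/imsetP=> f fI ->{g}; have fh := fE _ fI; move: fI.
  rewrite inE => /andP[/isosP[fd fS finj] /eqP fr].
  apply/isosP; split=> [t|t|t1 t2].
  - rewrite in_setD negb_and negbK ffunE; case: ifP => //= _; exact: fd.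
  - rewrite in_setD => /andP[tK tS]; rewrite !ffunE !Kst (negbTE tK).
    case: (fS _ tS) => fS' -> -> ->; split=> //; rewrite in_setD fS' andbT.
    rewrite -himg; apply/imsetP => -[j jK]; rewrite -fh // => fjE.
    by rewrite (finj _ _ tS (KS _ jK) fjE) jK in tK.
  - rewrite !in_setD => /andP[t1K t1S] /andP[t2K t2S].
    by rewrite !ffunE (negbTE t1K) (negbTE t2K); exact: finj.
case/isosP=> gd gS ginj; case/isosP: (hI) => hd hS hinj.
(* Inverse construction: the forced map [h] on the component, the given map [g] elsewhere. *)
pose f := [ffun t => if t \in K r then h t else g t].
have gS' t : t \in S -> t \notin K r ->
    [/\ g t \in S' :\: K' t', g (o t) = o' (g t), g (s t) = s' (g t)
      & lam' (g t) = lam t].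
  by move=> tS tK; apply: gS; rewrite in_setD tK.
apply/imsetP; exists f; last first.
  apply/ffunP => t; rewrite ffunE; case: ifP => tK; last by rewrite ffunE tK.
  by rewrite gd // in_setD tK.
rewrite in_set; apply/andP; split; last by rewrite ffunE rK hr.
apply/isosP; split=> [t tS|t tS|t1 t2 t1S t2S].
- have tK : t \notin K r by apply: contra tS; exact: KS.
  by rewrite ffunE (negbTE tK) gd // in_setD (negbTE tS) andbF.
- rewrite !ffunE !Kst; case: ifPn => tK.
    by case: (hS _ tK) => hK -> -> ->; split=> //; exact: KS'.
  by case: (gS' _ tS tK); rewrite in_setD => /andP[_ ->] -> -> ->.
- have KgF t j : t \in S -> t \notin K r -> j \in K r -> g t <> h j.
    move=> tS tK jK gh; case: (gS' _ tS tK); rewrite in_setD gh =>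
      /andP[/negP[]].
    by case: (hS _ jK).
  rewrite !ffunE; case: ifPn => t1K; case: ifPn => t2K.
  + exact: hinj.
  + by move/esym/KgF; case.
  + by move/KgF; case.
  + by apply: ginj; rewrite in_setD ?t1K ?t2K.
Qed.

Lemma card_isos_rec (S : {set T}) (S' : {set T'}) r : stable o s S ->
  stable o' s' S' -> r \in S ->
  #|isos S S'| = \sum_(t' in S' | similar r t') #|isos (S :\: K r) (S' :\: K'
    t')|.
Proof.
move=> St St' rS; rewrite -sum1_card.
rewrite (partition_big (fun f : {ffun T -> T'} => f r)
  (fun t' => (t' \in S') && similar r t')) /=.
  apply: eq_bigr => t' /andP[t'S' sim]; rewrite -card_isos_fiber // -sum1_card.
  by apply: eq_bigl => f; rewrite inE.
move=> f fI; have := isos_restrict fI St rS.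
set h := [ffun _ => _] => hI.
case/isosP: fI => _ /(_ _ rS)[-> _ _ _] _ /=.
by apply/existsP; exists h; rewrite hI ffunE component_refl eqxx.
Qed.

Variables (Om : eqType) (w : T -> Om) (w' : T' -> Om).
Hypothesis similarP : forall t t', similar t t' = (w t == w' t').

Lemma card_isos_rec_eq (S : {set T}) (S' : {set T'}) r n : stable o s S ->
  stable o' s' S' -> r \in S ->
  (forall t', t' \in S' -> w r = w' t' ->
     #|isos (S :\: K r) (S' :\: K' t')| = n) ->
  #|isos S S'| = (#|[set t' in S' | w' t' == w r]| * n)%N.
Proof.
move=> St St' rS nE; rewrite (card_isos_rec St St' rS).
rewrite (eq_bigr (fun=> n)) => [|t' /andP[t'S']]; last first.
  by rewrite similarP => /eqP; exact: nE.
rewrite sum_nat_const; congr (_ * _)%N; apply: eq_card => t'.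
by rewrite in_set -[w' t' == _]eq_sym -similarP.
Qed.

Definition same_occurrences (S : {set T}) (S' : {set T'}) :=
  forall l, #|[set t in S | w t == l]| = #|[set t' in S' | w' t' == l]|.

(** The isomorphism between the two components matches the occurrences inside them, which can then
    be cancelled. *)
Lemma same_occurrencesD (S : {set T}) (S' : {set T'}) r t' : stable o s S ->
  stable o' s' S' ->
  r \in S -> t' \in S' -> w r = w' t' -> same_occurrences S S' ->
  same_occurrences (S :\: K r) (S' :\: K' t').
Proof.
move=> St St' rS t'S' wE occ l.
have: similar r t' by rewrite similarP wE.
case/existsP=> h /andP[hI /eqP hr]; have himg := isos_image hI hr.
(* The same map [h], pointed at [t] instead of [r], shows that [t] and [h t] are similar. *)
have wh t : t \in K r -> w' (h t) = w t.
  move=> tK; apply/esym/eqP; rewrite -similarP; apply/existsP; exists h.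
  have htK : h t \in K' t' by rewrite -himg imset_f.
  by rewrite (component_eq oK sK tK) (component_eq oK' sK' htK) hI eqxx.
have dec (U : finType) (A B : {set U}) (v : U -> Om) : B \subset A ->
    #|[set t in A | v t == l]| =
    (#|[set t in A :\: B | v t == l]| + #|[set t in B | v t == l]|)%N.
  move=> BA; rewrite -(cardsID B) addnC; congr addn; apply: eq_card => t.
    by rewrite !inE; case: (t \in B).
  rewrite !inE andbC; case tB: (t \in B) => //=.
  by rewrite (subsetP BA).
have:= occ l; rewrite (dec _ _ _ _ (component_sub St rS)).
rewrite (dec _ _ _ _ (component_sub St' t'S')).
suff -> : #|[set u in K' t' | w' u == l]| = #|[set t in K r | w t == l]|.
  by move/addIn.
case/isosP: hI => _ _ hinj.
rewrite -(@card_in_imset _ _ h) => [|t1 t2]; last first.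
  by rewrite !inE -!(rwP andP) => -[t1K _] [t2K _]; apply: hinj; rewrite inE.
apply: eq_card => u; rewrite inE -himg; apply/andP/imsetP.
  by case=> /imsetP[t tK ->]; rewrite wh // => wt; exists t; rewrite // inE tK.
case=> t; rewrite inE => /andP[tK wt] ->; split; first exact: imset_f.
by rewrite wh.
Qed.

(** Greedy construction: the invariant of any point of [S] also occurs in [S'], so its component can
    be matched with one of [S'], and removing both preserves the hypotheses. *)
Lemma isos_gt0 (S : {set T}) (S' : {set T'}) : stable o s S ->
  stable o' s' S' -> same_occurrences S S' ->
  (0 < #|isos S S'|)%N.
Proof.
move: {2}#|S| (leqnn #|S|) => n; elim: n S S' => [|n IH] S S' Sn St St' occ.
  move: Sn; rewrite leqn0 cards_eq0 => /eqP ->; apply/card_gt0P.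
  exists [ffun t => d t]; apply/isosP.
  by split=> [t _|t|t1 t2]; rewrite ?ffunE ?inE.
have [->|[r rS]] := set_0Vmem S.
  apply/card_gt0P; exists [ffun t => d t]; apply/isosP.
  by split=> [t _|t|t1 t2]; rewrite ?ffunE ?inE.
have: (0 < #|[set t' in S' | w' t' == w r]|)%N.
  by rewrite -occ; apply/card_gt0P; exists r; rewrite inE rS eqxx.
case/card_gt0P=> t'; rewrite inE => /andP[t'S' /eqP/esym wE].
rewrite (card_isos_rec St St' rS) (bigD1 t') /=; last by
  rewrite t'S' similarP wE eqxx.
rewrite ltn_addr // IH //.
- rewrite -ltnS; apply: leq_trans Sn; apply: proper_card.
  rewrite properE subsetDl /=; apply/subsetPn; exists r => //.
  by rewrite inE component_refl.
- exact: (stableD oK sK St (@stable_component _ _ _ _)).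
- exact: (stableD oK' sK' St' (@stable_component _ _ _ _)).
- exact: same_occurrencesD.
Qed.

Variables (C : eqType) (cl : Om -> C) (alpha : C -> nat) (cs : seq C).
Hypothesis cs_uniq : uniq cs.
Hypothesis cl_cs : forall t, cl (w t) \in cs.
Hypothesis cl_component : forall r t, t \in K r -> cl (w t) = cl (w r).
Hypothesis component_occ : forall r t,
  #|[set j in K r | w j == w t]| = ((cl (w r) == cl (w t)) * alpha (cl (w
    t)))%N.

Definition class_mult (S : {set T}) c :=
  #|[set r in S | roots (step o s) r && (cl (w r) == c)]|.

Lemma card_occ (S : {set T}) t : stable o s S ->
  #|[set j in S | w j == w t]| = (class_mult S (cl (w t)) * alpha (cl (w t)))%N.
Proof.
move=> St; have csym := step_connect_sym oK sK.
rewrite -sum1_card (partition_big (root (step o s)) (fun r => (r \in S) &&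
   roots (step o s) r)) /=; last first.
  move=> j; rewrite inE => /andP[jS _]; rewrite roots_root // andbT.
  by apply: (subsetP (component_sub St jS)); rewrite inE connect_root.
transitivity (\sum_(r in S | roots (step o s) r)
   ((cl (w r) == cl (w t)) * alpha (cl (w t))))%N.
  apply: eq_bigr => r /andP[rS /eqP rr]; rewrite -component_occ -sum1_card.
  apply: eq_bigl => j; rewrite !inE -{1}rr (root_connect csym) andbC andbA.
  congr (_ && _); rewrite (csym r); case jr: (connect _ j r) => //=.
  by apply: (subsetP (component_sub St rS)); rewrite inE csym.
rewrite -big_distrl /=; congr (_ * _)%N; rewrite /class_mult -sum1_card.
by rewrite big_mkcond [RHS]big_mkcond; apply: eq_bigr => r _;
   rewrite inE; do 3?case: (_ \in _); case: (roots _ _) => //=; case: (_ == _).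
Qed.

Lemma class_multD (S : {set T}) r c : stable o s S -> r \in S ->
  class_mult S c = (class_mult (S :\: K r) c + (cl (w r) == c))%N.
Proof.
move=> St rS; have KS := component_sub St rS.
rewrite -(@card_roots_component _ _ _ oK sK (fun j => cl (w j) == c) r);
  last first.
  by move=> j /cl_component ->.
rewrite /class_mult -(cardsID (K r)) addnC; congr addn; apply: eq_card => j.
  by rewrite !inE; case: (connect _ r j).
rewrite !inE andbC; case jr : (connect _ r j) => //=.
by rewrite (subsetP KS) // inE.
Qed.

(* An isomorphism is built one component at a time: a component whose words have *)
(* class c is sent to one of the class_mult S c components left in this class, in *)
(* alpha c ways. *)
Theorem card_isos (S : {set T}) (S' : {set T'}) :
  stable o s S -> stable o' s' S' -> same_occurrences S S' ->
  #|isos S S'| =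
  (\prod_(c <- cs) ((class_mult S c)`! * alpha c ^ class_mult S c))%N.
Proof.
move: {2}#|S| (leqnn #|S|) => n; elim: n S S' => [|n IH] S S' Sn St St' occ.
  move: Sn; rewrite leqn0 cards_eq0 => /eqP ->.
  rewrite big1 => [|c _].
    rewrite -(cards1 [ffun t => d t]); apply: eq_card => f; rewrite [RHS]inE.
    apply/isosP/eqP => [[fd _ _]|->]; first by apply/ffunP => t;
      rewrite ffunE fd ?inE.
    by split=> [t _|t|t1 t2]; rewrite ?ffunE ?inE.
  rewrite (_ : class_mult _ c = 0%N) //; apply: eq_card0 => t.
  by rewrite !inE.
have [S0|[r rS]] := set_0Vmem S; first by apply: IH => //; rewrite S0 cards0.
have SDn : #|S :\: K r| <= n.
  rewrite -ltnS; apply: leq_trans Sn; apply: proper_card.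
  rewrite properE subsetDl /=; apply/subsetPn; exists r => //.
  by rewrite inE component_refl.
set c0 := cl (w r).
pose m := \prod_(c <- cs)
  ((class_mult (S :\: K r) c)`! * alpha c ^ class_mult (S :\: K r) c).
rewrite (@card_isos_rec_eq S S' r m St St' rS) => [|t' t'S' wE]; last first.
  apply: (IH _ _ SDn).
  - exact: (stableD oK sK St (@stable_component _ _ _ _)).
  - exact: (stableD oK' sK' St' (@stable_component _ _ _ _)).
  - exact: same_occurrencesD.
(* If m components of [S] have the class of [r], there are m * alpha images for [r]; this turns
   (m-1)! alpha^(m-1) into m! alpha^m. *)
rewrite -occ (card_occ _ St) -/c0 (class_multD _ St rS) eqxx addn1.
rewrite /m [in LHS](bigD1_seq c0) ?cl_cs //= [in RHS](bigD1_seq c0) ?cl_cs //=.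
rewrite (class_multD _ St rS) eqxx addn1 factS expnS.
rewrite [in RHS](eq_bigr (fun c =>
  ((class_mult (S :\: K r) c)`! * alpha c ^ class_mult (S :\: K r) c)%N)).
  lia.
by move=> c; rewrite (class_multD _ St rS) -/c0 eq_sym => /negbTE ->;
  rewrite addn0.
Qed.

End PartialIsos.

(** * Gluings of excursions and bridges *)

Section Gluings.
Variables (Gam : graph) (D : subgraph Gam) (F1 F2 : {fset vertex Gam}).
Local Notation D1 := (remove_vertices D F1).
Local Notation excursion := (excursion F1 F2).
Local Notation exprefixes := (exprefixes F1 F2).
Local Notation estart := (estart F1 F2).

(* The extremities of a family of excursions are labelled by a finite type T. At *)
(* the label t, which sits at the vertex zpt t, start the excursion exc t, ending *)
(* at the label oth t, and the bridge brg t, ending at the label prt t. *)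
Record gluing (T : finType) := Gluing {
  oth : T -> T;
  prt : T -> T;
  exc : T -> seq (dart Gam);
  brg : T -> seq (dart Gam);
  zpt : T -> vertex Gam;
  othK : involutive oth;
  oth_neq : forall t, oth t != t;
  prtK : involutive prt;
  prt_neq : forall t, prt t != t;
  exc_oth : forall t, exc (oth t) = revpath (exc t);
  brg_prt : forall t, brg (prt t) = revpath (brg t);
  exc_walk : forall t, walk (zpt t) (exc t) (zpt (oth t));
  exc_excursion : forall t, excursion (exc t);
  exc_dset : forall t e, e \in exc t -> dset D e;
  brg_bridge : forall t, bridge D1 (zpt t) (zpt (prt t)) (brg t) }.

(** * The words read in a gluing *)

Section OneGluing.
Variables (T : finType) (G : gluing T).
Local Notation oth := (oth G).
Local Notation prt := (prt G).
Local Notation exc := (exc G).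
Local Notation brg := (brg G).
Local Notation zpt := (zpt G).
Local Notation K := (component oth prt).
Implicit Types (t i j : T).

Definition nxt t := prt (oth t).
Definition pce t := exc t ++ brg (oth t).
(* The loop read from t by following alternately excursions and bridges. *)
Definition word t := flatten [seq pce j | j <- orbit nxt t].
Local Notation fc := (fconnect nxt).

Lemma nxt_inj : injective nxt.
Proof. exact: inj_comp (inv_inj (prtK G)) (inv_inj (othK G)). Qed.

(** [oth] conjugates [nxt] to its inverse: it reverses the direction of travel. *)
Lemma nxt_oth_nxt t : nxt (oth (nxt t)) = oth t.
Proof. by rewrite /nxt othK prtK. Qed.

(** A loop never runs into its own reversal. Reaching [oth t] in k+2 steps means reaching
    [oth (nxt t)] from [nxt t] in k steps; the cases of 0 and 1 steps are the absence of fixed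
    points of the two involutions. *)
Lemma iter_nxt_neq k t : iter k nxt t != oth t.
Proof.
elim/ltn_ind: k t => -[|[|k]] IH t /=.
- by rewrite eq_sym oth_neq.
- exact: prt_neq.
- by rewrite -iterS iterSr -(nxt_oth_nxt t) (inj_eq nxt_inj) IH.
Qed.

Lemma fc_sym : connect_sym (frel nxt).
Proof. exact: fconnect_sym nxt_inj. Qed.

Lemma fc_oth i j : fc i j -> fc (oth i) (oth j).
Proof.
move=> /iter_findex <-; elim: (findex _ _ _) => [|k IH] //=.
apply: connect_trans IH _; rewrite fc_sym.
by rewrite -(nxt_oth_nxt (iter k nxt i)) fconnect1.
Qed.

Lemma fc_othN t : ~~ fc t (oth t).
Proof. by apply/negP => /iter_findex/eqP;
  rewrite (negbTE (iter_nxt_neq _ _)). Qed.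

(** The two orbits are the two orientations of the same loop. *)
Lemma component_orbit t j : (j \in K t) = fc t j || fc (oth t) j.
Proof.
apply/idP/idP => [|/orP[]/iter_findex <-]; last 2 first.
- elim: (findex _ _ _) => [|k IH]; first exact: component_refl.
  by case: (stable_component IH) => /stable_component[].
- elim: (findex _ _ _) => [|k IH] /=.
    by case: (stable_component (component_refl oth prt t)).
  by case: (stable_component IH) => /stable_component[].
pose S := [set j | fc t j || fc (oth t) j].
suff /subsetP/(_ j) KS : K t \subset S by move/KS; rewrite inE.
apply: component_ind => [|k _]; first by rewrite inE connect0.
rewrite !inE => kS; suff okS : fc t (oth k) || fc (oth t) (oth k).
  split=> //; have ->: prt k = nxt (oth k) by rewrite /nxt othK.
  by case/orP: okS => kk; rewrite (connect_trans kk (fconnect1 _ _)) ?orbT.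
by case/orP: kS => /fc_oth; rewrite ?othK => ->; rewrite ?orbT.
Qed.

Lemma enum_component t :
  perm_eq (enum (K t)) (orbit nxt t ++ orbit nxt (oth t)).
Proof.
apply: uniq_perm; rewrite ?enum_uniq //.
  rewrite cat_uniq !orbit_uniq andbT /=; apply/hasPn => j.
  rewrite -!fconnect_orbit fc_sym => jo; apply: contra (fc_othN t) => tj.
  exact: connect_trans tj jo.
by move=> j; rewrite mem_enum component_orbit mem_cat !fconnect_orbit.
Qed.

Lemma orbit_nxt t : orbit nxt (nxt t) = rot 1 (orbit nxt t).
Proof.
have oE : order nxt (nxt t) = order nxt t.
  by apply: eq_card => j; rewrite !inE -same_fconnect1 //; exact: nxt_inj.
rewrite /orbit oE -(orderSpred nxt t) [in RHS]trajectS rot1_cons.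
by rewrite trajectSr -iterSr orderSpred (iter_order nxt_inj).
Qed.

Lemma flatten_rot1 (A : Type) (s : seq A) (ss : seq (seq A)) :
  flatten (rot 1 (s :: ss)) = rot (size s) (flatten (s :: ss)).
Proof. by rewrite rot1_cons flatten_rcons rot_size_cat. Qed.

Lemma orbitS t : orbit nxt t = t :: behead (orbit nxt t).
Proof. by rewrite /orbit -orderSpred. Qed.

Lemma word_nxt t : word (nxt t) = rot (size (pce t)) (word t).
Proof. by rewrite /word orbit_nxt map_rot orbitS /= flatten_rot1. Qed.

Lemma brg_walk t : walk (zpt t) (brg t) (zpt (prt t)).
Proof. by case: (brg_bridge G t). Qed.

Lemma pce_walk t : walk (zpt t) (pce t) (zpt (nxt t)).
Proof.
by apply/walk_cat; exists (zpt (oth t)); [exact: exc_walk | exact: brg_walk].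
Qed.

Lemma traject_walk n t :
  walk (zpt t) (flatten [seq pce j | j <- traject nxt t n]) (zpt (iter n nxt
    t)).
Proof.
elim: n t => [|n IH] t; first by rewrite /=.
by apply/walk_cat; exists (zpt (nxt t)); [exact: pce_walk | rewrite iterSr;
  exact: IH].
Qed.

Lemma word_walk t : walk (zpt t) (word t) (zpt t).
Proof. by have:= traject_walk (order nxt t) t;
  rewrite (iter_order nxt_inj). Qed.

Lemma zpt_F2 t : zpt t \in F2.
Proof.
have := exc_excursion G t; have := exc_walk G t.
by case: (exc t) => // e w ew; rewrite (excursionE _ _ ew) => /andP[].
Qed.

Lemma exc_neq0 t : exc t != [::].
Proof. by have := exc_excursion G t; case: (exc t). Qed.

Lemma wordE t : word t = exc t ++ brg (oth t) ++
  flatten [seq pce j | j <- behead (orbit nxt t)].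
Proof. by rewrite /word orbitS /= -catA. Qed.

Lemma word_neq0 t : word t != [::].
Proof. by rewrite wordE; case: (exc t) (exc_neq0 t). Qed.

Lemma estart_word t : estart (word t).
Proof.
apply/estartP; exists (exc t); rewrite wordE; eexists; split; first by [].
exact: exc_excursion.
Qed.

Lemma exprefixes_word t : exprefixes (word t) = [:: exc t].
Proof.
have := word_walk t; rewrite wordE => wt.
exact: exprefixesE wt (exc_excursion G t).
Qed.

(* An excursion cannot start inside an excursion, whose interior avoids F2; if it *)
(* starts inside a bridge, it must reach F1 after the end of this bridge, which *)
(* lies in F2. *)
Lemma estart_rot_word r t : 0 < r < size (pce t) -> ~~ estart (rot r (word t)).
Proof.
move=> /andP[r_gt0 r_lt]; apply/estartP => -[w [v [wvE ew]]].
set R := flatten [seq pce j | j <- behead (orbit nxt t)].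
have rotE : rot r (word t) = drop r (pce t) ++ R ++ take r (pce t).
  rewrite /word orbitS /= -/R /rot drop_cat take_cat r_lt.
  by rewrite catA.
have [r_ex|r_ex] := ltnP r (size (exc t)).
  case: w ew wvE => // e w /and4P[eF _ _ _] /=.
  rewrite rotE drop_cat r_ex; case dE : (drop r (exc t)) => [|f u].
    by move/(congr1 size): dE; rewrite size_drop /=; lia.
  move=> -[fe _]; have: f \in behead (exc t).
    have: f \in drop r.-1 (behead (exc t)).
      by rewrite -drop1 drop_drop addn1 prednK // dE mem_head.
    exact: mem_drop.
  have := exc_excursion G t; case: (exc t) =>
    // e' u' /and4P[_ _ /allP H _] /= /H.
  by rewrite fe eF.
have [z' rw] := walk_rot r (word_walk t).
move: rotE; rewrite drop_cat ltnNge r_ex /=.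
set k := r - size (exc t); set q := drop k (brg (oth t)).
have k_lt : k < size (brg (oth t)) by move: r_lt; rewrite size_cat /k; lia.
have [z _ qw] := walk_take_drop k (brg_walk (oth t)); rewrite -/q in qw.
have qD e : e \in q -> (src e \notin F1) && (tgt e \notin F1).
  move=> /mem_drop eb; case: (brg_bridge G (oth t)) => _ _ _ /(_ _ eb).
  by case=> _ -> ->.
have q0 : q != [::] by rewrite -size_eq0 -lt0n size_drop subn_gt0.
set R' := R ++ _ => qE; rewrite qE in rw.
have [wq|wq] := leqP (size w) (size q).
  have wE : w = take (size w) q.
    by rewrite -[LHS](take_size_cat v erefl) -wvE qE takel_cat.
  have wD e : e \in w -> (src e \notin F1) && (tgt e \notin F1).
    by rewrite wE => /mem_take; exact: qD.
  case: w ew wD {wvE wq wE} => // e w /and4P[_ _ _] /= /or3P[eF|eF|].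
  - by move=> /(_ e (mem_head _ _)); rewrite eF.
  - by move=> /(_ e (mem_head _ _)); rewrite eF andbF.
  rewrite has_map => /hasP[f fw /= fF] /(_ f).
  by rewrite fF andbF inE fw orbT => /(_ isT).
have wE : w = q ++ drop (size q) w.
  rewrite -{1}(cat_take_drop (size q) w); congr (_ ++ _).
  by rewrite -(takel_cat v (ltnW wq)) -wvE qE take_size_cat.
case dE : (drop (size q) w) wE => [|e u] wE.
  by move/(congr1 size): dE; rewrite size_drop /=; lia.
have R'E : R' = e :: u ++ v.
  by move/eqP: qE; rewrite wvE wE -catA eqseq_cat // eqxx => /eqP.
case/walk_cat: rw => y qy Ry.
have yE : y = zpt (nxt t).
  case: (q) q0 qw qy => //= f q' _ /andP[_ q'w] /andP[_ q'y].
  exact: walk_det q'y q'w.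
have eF : src e \in F2.
  by move: Ry; rewrite R'E /= yE => /andP[/eqP -> _]; exact: zpt_F2.
move: ew; rewrite wE; case: (q) q0 => //= f q' _ /and4P[_ _ + _].
by rewrite all_cat /= eF andbF.
Qed.

(** The word is a concatenation of pieces, and by [estart_rot_word] an excursion can start only at
    the beginning of a piece. The order of the orbit is kept, and with it all multiplicities. *)
Lemma rotations_word t :
  [seq x <- rotations (word t) | estart x] = [seq word j | j <- orbit nxt t].
Proof.
(* Induction on the number k of pieces already passed; rotating by their total length n lands on the
   k-th label. *)
suff H k : k <= order nxt t ->
    let n := size (flatten [seq pce j | j <- traject nxt t k]) in
    rot n (word t) = word (iter k nxt t) /\
    [seq x <- [seq rot r (word t) | r <- iota 0 n] | estart x] =
    [seq word j | j <- traject nxt t k].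
  by case: (H _ (leqnn _)).
elim: k => [|k IH] k_lt; first by rewrite /= rot0.
have [IH1 IH2] := IH (ltnW k_lt); set j := iter k nxt t.
set n := size _ in IH1 IH2 *.
rewrite trajectSr map_rcons flatten_rcons size_cat -/n -/j.
have n_le : n + size (pce j) <= size (word t).
  have -> : word t = flatten [seq pce i | i <- traject nxt t k.+1 ++
      traject nxt (iter k.+1 nxt t) (order nxt t - k.+1)].
    by rewrite -trajectD subnKC.
  by rewrite trajectSr map_cat flatten_cat map_rcons flatten_rcons !size_cat -/n
    -/j leq_addr.
split; first by rewrite addnC rotD ?(addnC _ n) // IH1 -word_nxt.
rewrite iotaD map_cat filter_cat IH2 map_rcons -cats1; congr (_ ++ _).
rewrite add0n -[n in iota n _]addn0 iotaDl -map_comp.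
have -> : [seq (rot^~ (word t) \o addn n) r | r <- iota 0 (size (pce j))] =
          [seq rot r (word j) | r <- iota 0 (size (pce j))].
  apply/eq_in_map => i; rewrite mem_iota /= add0n => i_lt.
  by rewrite /= addnC rotD ?IH1 //; lia.
have pce_gt0 : 0 < size (pce j).
  by rewrite size_cat; case: (exc j) (exc_neq0 j).
rewrite -(prednK pce_gt0) /= rot0 estart_word; congr cons.
apply/eqP; rewrite -[_ == _]negbK -has_filter; apply/negP => /hasP[x].
case/mapP=> i; rewrite mem_iota => i_lt ->; apply/negP.
by apply: estart_rot_word; lia.
Qed.

Lemma fc_rotations t j : fc t j ->
  perm_eq (rotations (word j)) (rotations (word t)).
Proof.
move/iter_findex <-; elim: (findex _ _ _) => [|k IH] //.
by rewrite iterS word_nxt (perm_trans (rotations_rot _ _)).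
Qed.

Lemma order_oth t : order nxt (oth t) = order nxt t.
Proof.
rewrite /order -(card_image (inv_inj (othK G)) (fconnect nxt (oth t))).
apply: eq_card => j; rewrite -[j](othK G) mem_image;
  last exact: inv_inj (othK G).
by apply/idP/idP => /fc_oth; rewrite !(othK G).
Qed.

Lemma traject_oth n t : traject nxt (oth (iter n nxt t)) n.+1 =
  rev (map oth (traject nxt t n.+1)).
Proof.
elim: n t => [|n IH] t //.
by rewrite trajectS iterS nxt_oth_nxt IH [in RHS]trajectSr map_rcons rev_rcons.
Qed.

(* The reversed word reads the bridge before each excursion instead of after it. *)
Lemma flatten_slide n t :
  flatten [seq brg (prt j) ++ exc j | j <- traject nxt t n] ++
    brg (prt (iter n nxt t)) =
  brg (prt t) ++ flatten [seq pce j | j <- traject nxt t n].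
Proof.
elim: n t => [|n IH] t; first by rewrite /= cats0.
have pn : prt (nxt t) = oth t by rewrite /nxt prtK.
by rewrite iterSr /= -!catA IH pn.
Qed.

(** Reversing the orbit reverses the word, except that each bridge is then read before its
    excursion. By [flatten_slide] this only moves the bridge arriving at [t] from one end of the
    word to the other, which is a rotation. *)
Lemma rotations_word_oth t :
  perm_eq (rotations (word (oth t))) (rotations (revpath (word t))).
Proof.
(* The predecessor of [t]: the orbit of [oth s] is exactly the orbit of [t] read backwards. *)
set s := iter (order nxt t).-1 nxt t.
have tt : iter (order nxt t) nxt t = t by rewrite (iter_order nxt_inj).
have osE : orbit nxt (oth s) = rev (map oth (orbit nxt t)).
  rewrite /orbit order_oth.
  have -> : order nxt s = order nxt t.
    apply: eq_card => j; apply/esym/(same_connect fc_sym); exact: fconnect_iter.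
  by rewrite -(orderSpred nxt t) traject_oth.
have ts : fc t s by exact: fconnect_iter.
apply: (@perm_trans _ (rotations (word (oth s)))).
  by apply: fc_rotations; apply: fc_oth; rewrite fc_sym.
rewrite -[word (oth s)]revpathK.
suff [k ->] : exists k, revpath (word (oth s)) = rot k (word t).
  by rewrite revpath_rot /rotr rotations_rot.
have -> : revpath (word (oth s)) =
    flatten [seq brg (prt j) ++ exc j | j <- orbit nxt t].
  rewrite /word osE; elim: (orbit nxt t) => //= j u IH.
  rewrite rev_cons map_rcons flatten_rcons revpath_cat IH; congr (_ ++ _).
  by rewrite revpath_cat othK -brg_prt exc_oth revpathK.
have := flatten_slide (order nxt t) t; rewrite tt -/(orbit nxt t) -/(word t).
set u := flatten _; have -> : u = brg (prt t) ++ drop (size (brg (prt t))) u.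
  by rewrite /u orbitS /= -catA drop_size_cat.
set v := drop _ _; rewrite -catA => /eqP; rewrite eqseq_cat // =>
  /andP[_ /eqP <-].
by exists (size v); rewrite rot_size_cat.
Qed.

(** The orbit of [t] reads the rotations of the word that start with an excursion, the orbit of
    [oth t] those of the reversed word. As multiplicities agree, symmetries of the loop can be
    counted on labels. *)
Lemma dihedral_component t :
  perm_eq [seq word j | j <- enum (K t)] [seq x <- dihedral (word t) | estart
    x].
Proof.
apply: perm_trans (perm_map _ (enum_component t)) _.
rewrite map_cat filter_cat -!rotations_word perm_cat2l; apply: perm_filter.
exact: rotations_word_oth.
Qed.

Lemma component_loop_class t j : j \in K t -> loop_class (word t) (word j).
Proof.
move=> jt; apply/loop_classE; first exact: word_neq0.
have : word j \in [seq word j | j <- enum (K t)] by rewrite map_f // mem_enum.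
by rewrite (perm_mem (dihedral_component t)) mem_filter => /andP[].
Qed.

Lemma component_word t l : estart l -> loop_class (word t) l ->
  exists2 j, j \in K t & word j = l.
Proof.
move=> le /(loop_classE _ (word_neq0 t)) lt.
have : l \in [seq x <- dihedral (word t) | estart x] by rewrite mem_filter le.
by rewrite -(perm_mem (dihedral_component t)) => /mapP[j]; rewrite mem_enum;
  exists j.
Qed.

Lemma card_component_word t l : estart l ->
  #|[set j in K t | word j == l]| = (`[< loop_class (word t) l >] * symmetries
    l)%N.
Proof.
move=> le; transitivity (count_mem l [seq word j | j <- enum (K t)]).
  rewrite count_map -size_filter cardE /enum_mem -filter_predI; congr size.
  by apply: eq_filter => j /=; rewrite !inE andbC.
rewrite (permP (dihedral_component t)) count_filter.
rewrite (eq_count (a2 := pred1 l)) => [|x /=]; last first.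
  by case: eqP => // ->.
case: asboolP => [tl|ntl]; first by
  rewrite count_dihedral // (symmetries_eq tl) mul1n.
apply/eqP; rewrite mul0n -leqn0 leqNgt -has_count has_pred1.
by apply/negP => /loop_classE-/(_ (word_neq0 t)).
Qed.

Definition concat_mult (c : uloop Gam) : nat :=
  #|[pred i : T | roots (step oth prt) i && `[< loop_class (word i) = c >]]|.

End OneGluing.

Definition class_symmetries (c : uloop Gam) :=
  symmetries (classical_sets.xget [::] c).

Lemma xget_loop_class (l : seq (dart Gam)) :
  loop_class l (classical_sets.xget [::] (loop_class l)).
Proof. by apply: classical_sets.xgetPex; exists l; exact: loop_class_refl. Qed.

Lemma class_symmetriesE (l : seq (dart Gam)) :
  class_symmetries (loop_class l) = symmetries l.
Proof. exact: symmetries_eq (xget_loop_class l). Qed.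

(** * Label counts and multiplicities of loops *)

Section Occurrences.
Variables (T : finType) (G : gluing T).
Local Notation K := (component (oth G) (prt G)).

Lemma component_occ r t : #|[set j in K r | word G j == word G t]| =
  ((loop_class (word G r) == loop_class (word G t) :> uloop Gam) *
     class_symmetries (loop_class (word G t)))%N.
Proof.
rewrite card_component_word ?estart_word // class_symmetriesE;
  congr (nat_of_bool _ * _)%N.
apply/asboolP/eqP => [/loop_class_eq//|rt]; apply/loop_class_eqP; exact: esym.
Qed.

Lemma cl_component r t : t \in K r ->
  loop_class (word G t) = loop_class (word G r) :> uloop Gam.
Proof. by move/component_loop_class/loop_class_eq. Qed.

Lemma class_mult_concat c :
  class_mult (oth G) (prt G) (word G) (fun l =>
    loop_class l : uloop Gam) setT c =
  concat_mult G c.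
Proof.
by apply: eq_card => r; rewrite !inE.
Qed.

Lemma stableT : stable (oth G) (prt G) setT.
Proof. by []. Qed.

Lemma card_word (l : seq (dart Gam)) : estart l ->
  #|[set t | word G t == l]| = (concat_mult G (loop_class l) * symmetries l)%N.
Proof.
move=> le; have [/existsP[t /eqP tl]|no] := boolP [exists t, word G t == l].
  have := card_occ (othK G) (prtK G) (@component_occ) t stableT.
  rewrite class_mult_concat tl class_symmetriesE => <-.
  by apply: eq_card => j; rewrite !inE.
have occ0 : #|[set t | word G t == l]| = 0.
  by apply: eq_card0 => t; rewrite !inE; apply: contraNF no => tl;
    apply/existsP; exists t.
rewrite occ0 (_ : concat_mult _ _ = 0) //; apply: eq_card0 => r; rewrite !inE.
apply/negP => /andP[_ /asboolP/esym/loop_class_eqP rl].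
have [j _ jl] := component_word le rl.
by move/negP: no; apply; apply/existsP; exists j; rewrite jl.
Qed.

Lemma concat_mult_word c : concat_mult G c != 0 -> exists t,
  c = loop_class (word G t).
Proof.
by rewrite -lt0n => /card_gt0P[t]; rewrite !inE => /andP[_ /asboolP <-];
  exists t.
Qed.

End Occurrences.

(** * A word determines its pointed component *)

Section TwoGluings.

(* The word at t determines where its first bridge ends: this is the first place *)
(* after its start where an excursion begins. *)
Lemma size_pce_le (T T' : finType) (G : gluing T) (G' : gluing T') t t' :
  word G t = word G' t' -> size (pce G' t') <= size (pce G t).
Proof.
move=> wE; rewrite leqNgt; apply/negP => lt_s.
have := @estart_rot_word _ G' (size (pce G t)) t';
  rewrite lt_s andbT -wE -word_nxt.
rewrite estart_word /pce size_cat; case: (exc G t) (exc_neq0 G t) => // e u _.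
by move=> /(_ isT).
Qed.

(** The first excursion is the only prefix of the word that is an excursion, and the first bridge
    extends up to the next place where an excursion starts, so both are visible in the word. *)
Lemma word_eq (T T' : finType) (G : gluing T) (G' : gluing T') t t' :
  word G t = word G' t' ->
  [/\ exc G t = exc G' t', brg G (oth G t) = brg G' (oth G' t') &
      word G (nxt G t) = word G' (nxt G' t')].
Proof.
move=> wE; have sE : size (pce G t) = size (pce G' t').
  by apply/eqP; rewrite eqn_leq !size_pce_le.
have eE : exc G t = exc G' t'.
  by have := exprefixes_word G' t'; rewrite -wE exprefixes_word => -[].
split; rewrite ?word_nxt ?wE ?sE //.
have pE : pce G t = pce G' t'.
  rewrite -(take_size_cat (flatten [seq pce G j | j <- behead (orbit (nxt G)
    t)]) (erefl (size (pce G t)))).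
  rewrite -(take_size_cat (flatten [seq pce G' j | j <- behead (orbit (nxt G')
    t')]) (erefl (size (pce G' t')))).
  by rewrite /pce -!catA -!wordE -/(pce _ _) -/(pce _ _) sE wE.
by move/eqP: pE; rewrite /pce eE eqseq_cat // eqxx => /eqP.
Qed.

Variables (T T' : finType) (G : gluing T) (G' : gluing T') (d : T -> T').
Definition label_data (U : finType) (H : gluing U) u := (exc H u, brg H u).
Local Notation K := (component (oth G) (prt G)).
Local Notation K' := (component (oth G') (prt G')).

Lemma word_eq_iter k t t' : word G t = word G' t' ->
  word G (iter k (nxt G) t) = word G' (iter k (nxt G') t').
Proof. by move=> wE; elim: k => //= k /word_eq[]. Qed.

Lemma word_eq_order t t' : word G t = word G' t' ->
  order (nxt G) t = order (nxt G') t'.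
Proof.
move=> wE; have := congr1 size (rotations_word G t).
by rewrite wE rotations_word !size_map !size_orbit.
Qed.

Lemma similar_word t t' :
  similar (oth G) (prt G) (oth G') (prt G') (label_data G) (label_data G') d t
    t' ->
  word G t = word G' t'.
Proof.
case/existsP=> f /andP[/isosP[_ fK finj] /eqP ft].
have fo j : j \in K t -> f (oth G j) = oth G' (f j) by case/fK.
have oK j : j \in K t -> oth G j \in K t by case/stable_component.
have fn j : j \in K t -> f (nxt G j) = nxt G' (f j).
  by move=> jK; rewrite /nxt; case: (fK _ (oK _ jK)) => _ _ -> _; rewrite fo.
have iK k : iter k (nxt G) t \in K t.
  by rewrite component_orbit fconnect_iter.
have fi k : f (iter k (nxt G) t) = iter k (nxt G') t'.
  by elim: k => //= k IH; rewrite fn // IH.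
have ft_orb : map f (orbit (nxt G) t) = traject (nxt G') t' (order (nxt G) t).
  apply: (@eq_from_nth _ t') => [|k]; rewrite size_map ?size_traject // => k_lt.
  by rewrite (nth_map t) ?size_traject // !nth_traject.
have oE : order (nxt G') t' = order (nxt G) t.
  have n0 := orderSpred (nxt G) t; set n := (order _ _).-1 in n0.
  rewrite -[RHS](size_traject (nxt G') t') -n0; apply: order_cycle.
  - rewrite trajectS /= rcons_path fpath_traject last_traject /=.
    by rewrite -iterS n0 -fi (iter_order (@nxt_inj _ G)) ft.
  - rewrite n0 -ft_orb map_inj_in_uniq ?orbit_uniq // => i j.
    by rewrite -!fconnect_orbit => ti tj; apply: finj;
      rewrite component_orbit ?ti ?tj.
  - by rewrite trajectS mem_head.
rewrite /word /orbit oE -ft_orb -map_comp; congr flatten; apply/eq_in_map => j.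
rewrite -fconnect_orbit => tj; have jK : j \in K t by
  rewrite component_orbit tj.
case: (fK _ jK) => _ _ _ [eE _]; case: (fK _ (oK _ jK)) => _ _ _ [_ bE].
by rewrite /= /pce eE -bE fo.
Qed.

(** By [word_eq], the excursions and bridges agree at every step, so that sending the k-th iterate
    of [t] to that of [t'] preserves labels; the map is extended to the opposite orientation by
    commutation with [oth]. *)
Lemma word_similar t t' : word G t = word G' t' ->
  similar (oth G) (prt G) (oth G') (prt G') (label_data G) (label_data G') d t
    t'.
Proof.
move=> wE; have oE := word_eq_order wE.
have [ninj ninj'] := (@nxt_inj _ G, @nxt_inj _ G').
pose h j := iter (findex (nxt G) t j) (nxt G') t'.
pose f := [ffun j => if fconnect (nxt G) t j then h j
   else if fconnect (nxt G) (oth G t) j then oth G' (h (oth G j)) else d j].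
have fE j : fconnect (nxt G) t j -> f j = h j by move=> tj; rewrite ffunE tj.
have foE j : fconnect (nxt G) t j -> f (oth G j) = oth G' (h j).
  move=> tj; rewrite ffunE othK (fc_oth tj); case: ifP => // toj.
  have := fc_othN G t; rewrite (connect_trans toj) //.
  by rewrite (fc_sym G) (fc_oth tj).
have KE j : j \in K t -> exists2 i, fconnect (nxt G) t i & j = i \/ j = oth G i.
  rewrite component_orbit => /orP[tj|/fc_oth]; first by exists j => //; left.
  by rewrite othK => toj; exists (oth G j) => //; right; rewrite othK.
(* At the last label of the orbit both sides wrap around, since the two orbits have the same
   order. *)
have hn j : fconnect (nxt G) t j -> h (nxt G j) = nxt G' (h j).
  move=> tj; rewrite /h; have tn := connect_trans tj (fconnect1 _ _).
  set k := findex _ t j; have kE : iter k (nxt G) t = j by exact: iter_findex.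
  have k_lt : k < order (nxt G) t by exact: findex_max.
  have [k1|k1] := ltnP k.+1 (order (nxt G) t).
    by rewrite -{1}kE -iterS findex_iter.
  have kE1 : k.+1 = order (nxt G) t by apply/eqP; rewrite eqn_leq k_lt.
  rewrite -{1}kE -!iterS kE1 (iter_order ninj) findex0 oE.
  by rewrite (iter_order ninj').
have nK j : fconnect (nxt G) t j -> exists2 i,
  fconnect (nxt G) t i & nxt G i = j.
  move=> tj; exists (finv (nxt G) j); last exact: f_finv.
  by rewrite (same_fconnect1_r ninj) f_finv.
have hlab i : fconnect (nxt G) t i ->
    exc G' (h i) = exc G i /\ brg G' (oth G' (h i)) = brg G (oth G i).
  move=> /iter_findex ti; have := word_eq_iter (findex (nxt G) t i) wE.
  by rewrite ti => /word_eq[-> -> _].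
have K't k : iter k (nxt G') t' \in K' t' by
  rewrite component_orbit fconnect_iter.
have hK i : h i \in K' t' by exact: K't.
have hinj i j : fconnect (nxt G) t i -> fconnect (nxt G) t j -> h i = h j ->
  i = j.
  move=> ti tj /(congr1 (findex (nxt G') t')).
  rewrite !findex_iter -?oE ?findex_max // => ij.
  by rewrite -(iter_findex ti) ij iter_findex.
(* The images of the two orientations are disjoint, as a loop does not meet its reversal. *)
have hoh i j : h i <> oth G' (h j).
  have : fconnect (nxt G') (h j) (h i).
    apply: (@connect_trans _ _ t'); last exact: fconnect_iter.
    by rewrite (fc_sym G'); exact: fconnect_iter.
  by move=> /iter_findex <-; apply/eqP; exact: iter_nxt_neq.
apply/existsP; exists f; rewrite (fE t) ?connect0 // /h findex0 eqxx andbT.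
apply/isosP; split=> [j|j /KE[i ti [->|->]]|j1 j2 /KE[i1 ti1 j1E] /KE[i2 ti2
  j2E]].
- by rewrite component_orbit ffunE negb_or => /andP[/negbTE -> /negbTE ->].
- rewrite fE // foE //; split=> //; last first.
    have [eE _] := hlab _ ti; rewrite /label_data eE; congr pair;
      case: (nK _ ti) => i0 ti0 <-.
    by rewrite hn // !brg_prt (hlab _ ti0).2.
  case: (nK _ ti) => i0 ti0 <-; rewrite {1}/nxt prtK foE // hn //.
  by rewrite /nxt prtK.
- rewrite foE // !othK (fE i) // -/(nxt G i) fE ?hn //; last first.
    by rewrite -(same_fconnect1_r ninj).
  split=> //; first by case: (stable_component (hK i)).
  by rewrite /label_data !exc_oth (hlab _ ti).1 (hlab _ ti).2.
- case: j1E => ->; case: j2E => ->; rewrite ?foE ?(fE i1) ?(fE i2) //.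
  + exact: hinj.
  + by move=> e; case: (hoh i1 i2).
  + by move=> /esym e; case: (hoh i2 i1).
  + by move=> /(inv_inj (othK G')) /hinj ->.
Qed.

Lemma similar_wordE t t' :
  similar (oth G) (prt G) (oth G') (prt G') (label_data G) (label_data G') d t
    t' =
  (word G t == word G' t').
Proof. by apply/idP/eqP; [exact: similar_word | exact: word_similar]. Qed.

End TwoGluings.
End Gluings.

(** * Isomorphisms, lengths and excursions of glued loops *)

Section GluingCounts.
Variables (Gam : graph) (D : subgraph Gam) (F1 F2 : {fset vertex Gam}).
Hypothesis F12 : forall x, x \in F1 -> x \notin F2.
Local Notation gluing := (gluing D F1 F2).
Local Notation estart := (estart F1 F2).
Implicit Types (T : finType).

Lemma concat_mult_gt0 T (G : gluing T) t : 0 < concat_mult G (loop_class (word G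
  t)).
Proof.
have : 0 < #|[set j | word G j == word G t]|.
  by apply/card_gt0P; exists t; rewrite inE.
by rewrite card_word ?estart_word // muln_gt0 => /andP[].
Qed.

Lemma same_occurrences_concat T T' (G : gluing T) (G' : gluing T') :
  concat_mult G =1 concat_mult G' ->
  same_occurrences (word G) (word G') setT setT.
Proof.
move=> GG' l.
have H (U : finType) (B : gluing U) :
    #|[set t in setT | word B t == l]| = #|[set t | word B t == l]|.
  by apply: eq_card => t; rewrite !inE.
rewrite !H; have [le|nle] := boolP (estart l); first by
  rewrite !card_word // GG'.
have H0 (U : finType) (B : gluing U) : #|[set t | word B t == l]| = 0.
  apply: eq_card0 => t; rewrite !inE; apply: contraNF nle => /eqP <-.
  exact: estart_word.
by rewrite !H0.
Qed.

(** The right-hand side is |Aut L| for the common multiset [L] of loops. Taking [G' = G], it counts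
    the automorphisms that fix a gluing. *)
Theorem card_gluing_isos T (G G' : gluing T) (cs : seq (uloop Gam)) :
  uniq cs -> (forall c, concat_mult G c != 0 -> c \in cs) ->
  concat_mult G =1 concat_mult G' ->
  #|isos (oth G) (prt G) (oth G') (prt G') (label_data G) (label_data G') id
    setT setT|
  = \prod_(c <- cs) ((concat_mult G c)`! * class_symmetries c ^ concat_mult G
    c).
Proof.
move=> cs_uniq csG GG'.
rewrite (@card_isos _ _ _ _ _ _ _ _ _ id (othK G) (prtK G) (othK G') (prtK G')
  _ (word G) (word G') (@similar_wordE _ _ _ _ _ _ G G' id) _
  (fun l => loop_class l : uloop Gam) (@class_symmetries Gam) cs).
- by apply: eq_bigr => c _; rewrite class_mult_concat.
- exact: cs_uniq.
- by move=> t; apply: csG; rewrite -lt0n concat_mult_gt0.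
- exact: cl_component.
- exact: component_occ.
- exact: stableT.
- exact: stableT.
- exact: same_occurrences_concat.
Qed.

Lemma sum_components T (G : gluing T) (f : T -> nat) :
  \sum_t f t = \sum_(r | roots (step (oth G) (prt G)) r)
                 \sum_(j in component (oth G) (prt G) r) f j.
Proof.
have csym := step_connect_sym (othK G) (prtK G).
rewrite (partition_big (fingraph.root (step (oth G) (prt G)))
           (roots (step (oth G) (prt G)))) /=.
  apply: eq_bigr => r /eqP rr; apply: eq_bigl => j.
  by rewrite inE -{1}rr (root_connect csym) csym.
by move=> j _; apply: roots_root.
Qed.

Lemma sum_concat_mult T (G : gluing T) (f : uloop Gam ->
  nat) (cs : seq (uloop Gam)) :
  uniq cs -> (forall c, concat_mult G c != 0 -> c \in cs) ->
  \sum_(c <- cs) concat_mult G c * f c =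
  \sum_(r | roots (step (oth G) (prt G)) r) f (loop_class (word G r)).
Proof.
move=> cs_uniq csG.
have cs_word t : (loop_class (word G t) : uloop Gam) \in cs.
  by apply: csG; rewrite -lt0n concat_mult_gt0.
rewrite [RHS](eq_bigr (fun r => \sum_(c <- cs)
    (loop_class (word G r) == c :> uloop Gam) * f c)); last first.
  move=> r _; rewrite (bigD1_seq (loop_class (word G r) : uloop Gam)) //= eqxx
    mul1n.
  by rewrite big1 ?addn0 // => c; rewrite eq_sym => /negbTE ->.
rewrite exchange_big /=; apply: eq_bigr => c _; rewrite -big_distrl /=;
  congr (_ * _).
rewrite /concat_mult -sum1_card big_mkcondr /=; apply: eq_bigr => r _.
by case: asboolP => [->|/eqP/negbTE ->]; rewrite ?eqxx.
Qed.

Lemma path_class_revpath (w : seq (dart Gam)) : path_class (revpath w) =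
  path_class w.
Proof.
rewrite /path_class revpathK; apply/funext => x; apply/propext.
by split=> -[]; [right|left|right|left].
Qed.

Lemma sum_component_pce T (G : gluing T) r :
  \sum_(j in component (oth G) (prt G) r) size (pce G j) = (size (word G r)).*2.
Proof.
rewrite -big_enum /= (perm_big _ (enum_component G r)) big_cat /=.
have H t : \sum_(j <- orbit (nxt G) t) size (pce G j) = size (word G t).
  by rewrite /word sumn_flatten_size big_map.
rewrite !H -addnn; congr addn.
have /perm_size := rotations_word_oth G r.
by rewrite !size_rotations size_revpath.
Qed.

(** A component reads its loop once in each orientation, whence the doubling. *)
Lemma double_size_concat T (G : gluing T) (cs : seq (uloop Gam)) :
  uniq cs -> (forall c, concat_mult G c != 0 -> c \in cs) ->
  (\sum_(c <- cs) concat_mult G c * size (classical_sets.xget [::] c)).*2 =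
  \sum_t size (exc G t) + \sum_t size (brg G t).
Proof.
move=> cs_uniq csG; rewrite sum_concat_mult // -mul2n big_distrr /=.
transitivity (\sum_t size (pce G t)).
  rewrite [RHS](sum_components G); apply: eq_bigr => r _.
  by rewrite sum_component_pce (size_loop_class (xget_loop_class (word G r)))
    mul2n.
rewrite (eq_bigr (fun t => size (exc G t) + size (brg G (oth G t)))) => [|t _].
  rewrite big_split /=; congr addn.
  by rewrite [RHS](reindex_inj (inv_inj (othK G))).
exact: size_cat.
Qed.

(** Each excursion of a loop is read from two labels, its two ends; reversal does not change its
    unoriented class. *)
Lemma double_excursions_concat T (G : gluing T) (cs : seq (uloop Gam)) u :
  uniq cs -> (forall c, concat_mult G c != 0 -> c \in cs) ->
  (\sum_(c <- cs) concat_mult G c * count (fun w => `[< path_class w = u >])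
     (excursions_of F1 F2 (classical_sets.xget [::] c))).*2 =
  #|[set t | `[< path_class (exc G t) = u >]]|.
Proof.
move=> cs_uniq csG; pose a (w : seq (dart Gam)) := `[< path_class w = u >].
rewrite -/a; have arev w : a (revpath w) = a w by rewrite /a path_class_revpath.
rewrite sum_concat_mult // -mul2n big_distrr /= -sum1dep_card [RHS]big_mkcond
  /=.
rewrite [RHS](sum_components G); apply: eq_bigr => r _; rewrite mul2n.
rewrite (count_excursions_of_class F1 F2 arev (word_walk G r) (xget_loop_class
  _)).
rewrite (double_count_excursions_of F1 F2 arev (word_walk G r)).
rewrite (bigID estart) /= [X in _ + X]big1 => [|x]; last first.
  by rewrite estartE negbK => /eqP ->.
rewrite addn0 -big_filter -(perm_big _ (dihedral_component G r)) /= big_map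
  big_enum /=.
by apply: eq_bigr => j _; rewrite exprefixes_word /= addn0 /a; case: asboolP.
Qed.

Lemma word_dset T (G : gluing T) t e : e \in word G t -> dset D e.
Proof.
move/flattenP=> [w /mapP[j _ ->]]; rewrite mem_cat => /orP[/exc_dset //|].
by case: (brg_bridge G (oth G j)) => _ _ _ H /H[].
Qed.

Lemma word_rooted_loop T (G : gluing T) t : rooted_loop D (word G t).
Proof.
split; first exact: word_neq0.
have zv : vset D (zpt G t) by case: (brg_bridge G t) => -[].
by exists (zpt G t); split=> // [|e]; [exact: word_walk | exact: word_dset].
Qed.

Lemma word_meets_F2 T (G : gluing T) t : uloop_meets F2 (loop_class (word G t)).
Proof.
apply/asboolP; exists (word G t); first exact: loop_class_refl.
rewrite wordE has_cat; apply/orP; left.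
by have := exc_excursion G t; case: (exc G t) => //= e w /andP[->].
Qed.

(** The ends of the excursion are in F2, hence not in F1, so F1 is reached at an interior vertex,
    which is the source of a dart. *)
Lemma word_meets_F1 T (G : gluing T) t : uloop_meets F1 (loop_class (word G t)).
Proof.
apply/asboolP; exists (word G t); first exact: loop_class_refl.
rewrite wordE has_cat; apply/orP; left.
have := exc_excursion G t; have := exc_walk G t.
case: (exc G t) => // e w ew; rewrite (excursionE _ _ ew) => /and4P[pF qF _].
rewrite /= has_rcons; case/or3P=> [/F12|/F12|]; rewrite ?pF ?qF //.
by rewrite has_map => ->; rewrite orbT.
Qed.

End GluingCounts.

(** * Isomorphic gluings have the same loops *)

Section Transport.
Variables (Gam : graph) (D : subgraph Gam) (F1 F2 : {fset vertex Gam}).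
Local Notation gluing := (gluing D F1 F2).
Implicit Types (T : finType).

(** Multiplicities are recovered from label counts through [card_word], dividing by the positive
    number of symmetries; this avoids comparing the roots of the two structures. *)
Lemma concat_mult_eq T T' (G : gluing T) (G' : gluing T') :
  (forall l, #|[set t | word G t == l]| = #|[set t | word G' t == l]|) ->
  concat_mult G =1 concat_mult G'.
Proof.
move=> occ c.
have H (l : seq (dart Gam)) : loop_class l = c -> estart F1 F2 l ->
  concat_mult G c = concat_mult G' c.
  move=> <- le; apply/eqP; rewrite -(eqn_pmul2r (symmetries_gt0 (l := l) _)).
    by rewrite -!card_word // occ.
  by case/estartP: le => -[|e w] [r [->]].
have [G0|] := eqVneq (concat_mult G c) 0; last first.
  by case/concat_mult_word=> t tc; apply: (H (word G t)) => //;
    exact: estart_word.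
have [G'0|] := eqVneq (concat_mult G' c) 0; first by rewrite G0 G'0.
by case/concat_mult_word=> t tc; apply: (H (word G' t)) => //;
  exact: estart_word.
Qed.

Lemma word_isos T T' (G : gluing T) (G' : gluing T') d f t :
  f \in isos (oth G) (prt G) (oth G') (prt G') (label_data G) (label_data G') d
    setT setT ->
  word G' (f t) = word G t.
Proof.
move=> fI; apply/esym; apply: (@similar_word _ _ _ _ _ _ G G' d).
have := isos_restrict (othK G) (prtK G) fI (@stableT _ _ _ _ _ G) (in_setT t).
set f' := (X in X \in _) => fI'; apply/existsP; exists f'.
by rewrite fI' /f' ffunE component_refl eqxx.
Qed.

Lemma concat_mult_isos T T' (G : gluing T) (G' : gluing T') d f :
  f \in isos (oth G) (prt G) (oth G') (prt G') (label_data G) (label_data G') d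
    setT setT ->
  #|T| = #|T'| -> concat_mult G =1 concat_mult G'.
Proof.
move=> fI TT'; apply: concat_mult_eq => l.
have finj : injective f.
  by case/isosP: (fI) => _ _ finj t1 t2 /finj; apply; rewrite in_setT.
have fonto t' : exists t, f t = t'.
  have /codomP[t ->] : t' \in codom f by rewrite (inj_card_onto finj) ?TT'.
  by exists t.
rewrite -(card_imset _ finj); apply: eq_card => t'; apply/imsetP/idP.
  by case=> t; rewrite !inE => /eqP <- ->; rewrite (word_isos _ fI).
case: (fonto t') => t <-; rewrite inE (word_isos _ fI) => tl.
by exists t; rewrite ?inE.
Qed.

End Transport.

(** * Matching two labelled fixed-point-free involutions *)

Section Matching.
Variables (T T' : finType) (o : T -> T) (o' : T' -> T').
Variables (Lab : eqType) (lam : T -> Lab) (lam' : T' -> Lab) (rv : Lab -> Lab).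
Hypotheses (oK : involutive o) (oK' : involutive o').
Hypotheses (oN : forall t, o t != t) (oN' : forall t, o' t != t).
Hypotheses (lamo : forall t, lam (o t) = rv (lam t)).
Hypotheses (lamo' : forall t, lam' (o' t) = rv (lam' t)).

Lemma component1 (U : finType) (p : U -> U) u : involutive p ->
  component p p u =i [set u; p u].
Proof.
move=> pK j; apply/idP/idP.
  have /subsetP/(_ j) : component p p u \subset [set u; p u]; last exact.
  apply: component_ind => [|k _]; first by rewrite !inE eqxx.
  by rewrite !inE => /orP[]/eqP ->; rewrite ?pK !eqxx ?orbT.
have := stable_component (component_refl p p u) => -[pu _].
by rewrite in_set2 => /orP[]/eqP ->; rewrite ?component_refl.
Qed.

(** When both involutions are [o], a component is the pair of [t] and [o t], and the label of [o t]
    is determined by that of [t]. *)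
Lemma similar1E d t t' : similar o o o' o' lam lam' d t t' = (lam t == lam' t').
Proof.
apply/existsP/eqP => [[f /andP[/isosP[_ fK _] /eqP ft]]|lE].
  by case: (fK t) => [|_ _ _ <-]; rewrite ?component_refl ?ft.
exists [ffun j => if j == t then t' else if j == o t then o' t' else d j].
rewrite ffunE !eqxx andbT; apply/isosP; split=> [j|j|j1 j2].
- rewrite component1 // !in_set2 negb_or ffunE => /andP[/negbTE ->
  /negbTE ->] //.
- rewrite component1 // !in_set2 !ffunE => /orP[]/eqP ->.
    rewrite !eqxx (negbTE (oN t)); split=> //;
      rewrite component1 // !in_set2 eqxx //.
  rewrite oK (negbTE (oN t)) !eqxx oK'; split=> //.
    by rewrite component1 // !in_set2 eqxx orbT.
  by rewrite lamo lamo' lE.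
- rewrite !component1 // !in_set2 !ffunE => /orP[]/eqP-> /orP[]/eqP-> //;
    rewrite !eqxx (negbTE (oN t)) => e.
  + by case/eqP: (oN' t').
  + by case/eqP: (oN' t').
Qed.

(** The greedy lemma [isos_gt0], with both involutions taken equal. *)
Lemma matching : #|T| = #|T'| ->
  (forall l, #|[set t | lam t == l]| = #|[set t' | lam' t' == l]|) ->
  exists f : T -> T', [/\ bijective f, forall t, f (o t) = o' (f t)
    & forall t, lam' (f t) = lam t].
Proof.
move=> TT' occ; case: (pickP T) => [t0 _|T0].
  have [t0' _] : exists t', t' \in [set t' | lam' t' == lam t0].
    by apply/card_gt0P; rewrite -occ; apply/card_gt0P; exists t0; rewrite inE.
  have st (U : finType) (p : U -> U) : stable p p setT by [].
  have occ' : same_occurrences lam lam' setT setT.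
    move=> l; have E (U : finType) (v : U -> Lab) :
        [set u in setT | v u == l] = [set u | v u == l].
      by apply/setP => u; rewrite !inE.
    by rewrite !E.
  have := isos_gt0 oK oK oK' oK' (similar1E (fun=> t0')) (st _ _) (st _ _) occ'.
  case/card_gt0P=> f /isosP[_ fT finj]; exists f; split.
  - apply: inj_card_bij; last by rewrite TT'.
    by move=> t1 t2 /finj; apply; rewrite in_setT.
  - by move=> t; case: (fT t (in_setT t)).
  - by move=> t; case: (fT t (in_setT t)).
have f0 (t : T) : T' by have := T0 t.
exists f0; split; try by move=> t; have := T0 t.
apply: inj_card_bij; last by rewrite TT'.
by move=> t; have := T0 t.
Qed.

End Matching.

(** * The gluing of a list of excursions by a Z-bridge *)

Section LabelsOfList.
Variables (Gam : graph) (D : subgraph Gam) (F1 F2 : {fset vertex Gam}).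
Local Notation gluing := (gluing D F1 F2).
Local Notation D1 := (remove_vertices D F1).
Implicit Types (w : seq (dart Gam)) (h : seq (seq (dart Gam))).

Definition walk_excursion w :=
  [/\ excursion F1 F2 w, exists p q, walk p w q & forall e, e \in w ->
    dset D e].

Variable h : seq (seq (dart Gam)).
Hypothesis hP : forall w, w \in h -> walk_excursion w.
Local Notation M := (size (extremities h)).

Lemma size_extremities : M = (size h).*2.
Proof.
rewrite /extremities; elim: h hP => //= w h' IH h'P.
rewrite size_cat IH => [|w' w'h]; last by apply: h'P; rewrite inE w'h orbT.
by have [] := h'P w (mem_head _ _); case: w {h'P} => //= e w _ _ _;
  rewrite doubleS.
Qed.

Lemma val_other_end (i : 'I_M) : other_end i = (if odd i then i.-1 else i.+1) :>
  nat.
Proof.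
rewrite val_insubd; case: ifP => // /negbT; rewrite -leqNgt.
have := ltn_ord i; have := size_extremities; have := odd_double_half i.
by case: (odd i) => /=; lia.
Qed.

Lemma odd_other_end (i : 'I_M) : odd (other_end i) = ~~ odd i.
Proof.
rewrite val_other_end; case: ifP => io; last by rewrite /= io.
by case: (nat_of_ord i) io => //= n /negbTE.
Qed.

Lemma other_end_half (i : 'I_M) : (other_end i)./2 = i./2.
Proof.
rewrite val_other_end; have := odd_double_half i; case: ifP => io iE; lia.
Qed.

Lemma other_endK : involutive (@other_end M).
Proof.
move=> i; apply: val_inj => /=;
  rewrite val_other_end odd_other_end val_other_end.
by case io : (odd i) => //=; case: (nat_of_ord i) io.
Qed.

Lemma other_end_neq (i : 'I_M) : other_end i != i.
Proof. by apply/eqP => /(congr1 (fun j : 'I_M => odd j)); rewrite odd_other_end;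
  case: odd. Qed.

Lemma half_lt (i : 'I_M) : i./2 < size h.
Proof. by rewrite ltn_half_double -size_extremities. Qed.

Lemma nth_walk_excursion (i : 'I_M) : walk_excursion (nth [::] h i./2).
Proof. by apply/hP/mem_nth/half_lt. Qed.

Lemma excursion_from_other (i : 'I_M) :
  excursion_from h (other_end i) = revpath (excursion_from h i).
Proof.
by rewrite /excursion_from odd_other_end other_end_half; case: (odd i);
  rewrite ?revpathK.
Qed.

Lemma walk_excursion_revpath w : walk_excursion w -> walk_excursion (revpath w).
Proof.
case=> ew [p [q wk]] wD; split; first exact: excursion_revpath wk ew.
  by exists q, p; exact: walk_rev.
by move=> e; rewrite mem_revpath => /wD/dset_drev; rewrite drevK.
Qed.

Lemma excursion_from_walk_excursion (i : 'I_M) : walk_excursion (excursion_from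
  h i).
Proof.
rewrite /excursion_from; case: ifP => _; last exact: nth_walk_excursion.
exact/walk_excursion_revpath/nth_walk_excursion.
Qed.

Lemma zpoint_nth (i : 'I_M) e w : nth [::] h i./2 = e :: w ->
  zpoint i = if odd i then tgt (last e w) else src e.
Proof.
rewrite /zpoint (tnth_nth (src e)) /= /extremities => hE.
have : i < (size h).*2 by rewrite -size_extremities.
move: (nat_of_ord i) hE => k; elim: h hP k => [|w' h' IH] h'P k //=.
have [ew' _ _] := h'P w' (mem_head _ _); case: w' ew' h'P => // e' w' _ h'P.
case: k => [|[|k]] /=; try by case=> e1 w1; rewrite ?e1 ?w1.
rewrite negbK doubleS !ltnS => kE k_lt; apply: IH => // w'' w''h.
by apply: h'P; rewrite inE w''h orbT.
Qed.

Lemma excursion_from_walk (i : 'I_M) :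
  walk (zpoint i) (excursion_from h i) (zpoint (other_end i)).
Proof.
have [] := nth_walk_excursion i; case nE : (nth _ _ _) =>
  [//|e w] _ [p [q wk]] _.
have wk' : walk (src e) (e :: w) (tgt (last e w)).
  by rewrite (walk_last wk) /= eqxx; case/andP: wk.
rewrite (zpoint_nth nE) (@zpoint_nth (other_end i) e w) ?other_end_half //.
rewrite odd_other_end /excursion_from nE; case: ifP => _ //=.
exact: walk_rev.
Qed.

Section ZBridge.
Variable b : zpaths Gam M.
Hypothesis bP : zbridge D1 (@zpoint Gam h) b.

Lemma partnerK : involutive (partner b).
Proof. by move=> i; case: bP => /forallP/(_ i)/andP[_ /eqP]. Qed.

Lemma partner_neq i : partner b i != i.
Proof. by case: bP => /forallP/(_ i)/andP[]. Qed.

Definition zbridge_gluing : gluing 'I_M := @Gluing Gam D F1 F2 'I_M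
  (@other_end M) (partner b) (@excursion_from Gam h M) (fun i =>
    (b i).2) (@zpoint Gam h)
  other_endK other_end_neq partnerK partner_neq excursion_from_other
  (fun i => proj2 (proj2 bP i)) excursion_from_walk
  (fun i => let: And3 ei _ _ := excursion_from_walk_excursion i in ei)
  (fun i => let: And3 _ _ di := excursion_from_walk_excursion i in di)
  (fun i => proj1 (proj2 bP i)).

Lemma concatenationE : concatenation h b = concat_mult zbridge_gluing.
Proof. by []. Qed.

End ZBridge.

(** Labels 2j and 2j+1 carry the j-th excursion and its reversal. *)
Lemma count_excursion_from u :
  #|[set i : 'I_M | `[< path_class (excursion_from h i) = u >]]| =
  (count (fun w => `[< path_class w = u >]) h).*2.
Proof.
pose a (w : seq (dart Gam)) := `[< path_class w = u >].
have aE (i : 'I_M) : a (excursion_from h i) = a (nth [::] h i./2).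
  by rewrite /a /excursion_from; case: ifP; rewrite ?path_class_revpath.
rewrite -sum1dep_card big_mkcond /=.
rewrite (eq_bigr (fun i : 'I_M => a (nth [::] h i./2) : nat)) => [|i _];
  last first.
  by rewrite -aE /a; case: asboolP.
rewrite -(big_mkord xpredT (fun k =>
  a (nth [::] h k./2) : nat)) size_extremities.
have dbl n (f : nat -> nat) :
    \sum_(0 <= k < n.*2) f k./2 = (\sum_(0 <= k < n) f k).*2.
  elim: n => [|n IH]; first by rewrite !big_nil.
  rewrite doubleS !big_nat_recr //= IH uphalf_double half_double; lia.
rewrite (dbl _ (fun k => a (nth [::] h k) : nat)) -(big_nth [::] xpredT (fun w
  => a w : nat)).
by rewrite -/a -sum1_count [in RHS]big_mkcond /=; congr _.*2; apply: eq_bigr =>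
  w _; case: (a w).
Qed.

End LabelsOfList.

(** * Decomposition of the crossing loops *)

Section LoopDecomposition.
Variables (Gam : graph) (D : subgraph Gam) (F1 F2 : {fset vertex Gam}).
Hypothesis F2D : forall x, x \in F2 -> vset D x.
Hypothesis F12 : forall x, x \in F1 -> x \notin F2.
Local Notation gluing := (gluing D F1 F2).
Local Notation D1 := (remove_vertices D F1).
Local Notation walk_excursion := (walk_excursion D F1 F2).
Local Notation letter := (seq (dart Gam) * seq (dart Gam))%type.
Implicit Types (w l q r : seq (dart Gam)) (x y z : vertex Gam) (ls : seq
  letter).

Lemma F2_D1 x : x \in F2 -> vset D1 x.
Proof. by move=> xF; split; [exact: F2D | apply: contraL xF; exact: F12]. Qed.

Lemma bridge_nil x : x \in F2 -> bridge D1 x x [::].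
Proof. by move=> /F2_D1 xD; split; rewrite /= ?eqxx. Qed.

Lemma first_return x e l y : walk x (e :: l) y -> y \in F2 ->
  exists w r z, [/\ e :: l = (e :: w) ++ r, walk x (e :: w) z, z \in F2,
    all (fun p => p \notin F2) (map (@src Gam) w) & walk z r y].
Proof.
elim: l x e => [|f l IH] x e /=.
  by move=> /andP[/eqP <- /eqP ty] yF; exists [::], [::], y; split;
    rewrite //= ?ty ?eqxx.
move=> /andP[/eqP <- fl] yF; have [tF|tF] := boolP (tgt e \in F2).
  by exists [::], (f :: l), (tgt e); split; rewrite //= ?eqxx.
have [w [r [z [-> wz zF wF rz]]]] := IH (tgt e) f fl yF.
exists (f :: w), r, z; split=> //=; first by rewrite eqxx.
by case/andP: wz => /eqP -> _; rewrite tF.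
Qed.

(** A letter is an excursion together with the bridge avoiding F1 that follows it; a loop will be a
    cyclic sequence of letters. *)
Fixpoint chained x ls y : Prop :=
  if ls is (e, q) :: ls' then
    exists z z', [/\ walk x e z, walk_excursion e,
      bridge D1 z z' q & chained z' ls' y]
  else x = y.

Definition letters_word ls := flatten [seq p.1 ++ p.2 | p <- ls].

Lemma bridge_cat x y z w w' : bridge D1 x y w -> bridge D1 y z w' ->
  bridge D1 x z (w ++ w').
Proof.
case=> Dx Dy wxy wD [_ Dz wyz w'D]; split=> // [|e].
  by apply/walk_cat; exists y.
by rewrite mem_cat => /orP[/wD|/w'D].
Qed.

(** The path is cut at its successive visits to F2. A portion between two visits starts a new letter
    if it meets F1, and otherwise avoids F1 and is absorbed into the bridge that follows. *)
Lemma excursion_decomposition x l y : x \in F2 -> y \in F2 -> walk x l y ->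
  (forall e, e \in l -> dset D e) ->
  exists q ls z, [/\ l = q ++ letters_word ls,
    bridge D1 x z q & chained z ls y].
Proof.
move: {2}(size l) (leqnn (size l)) => n.
elim: n x l => [|n IH] x l.
  rewrite leqn0 size_eq0 => /eqP -> xF yF /= /eqP xy _.
  exists [::], [::], x; split=> //; exact: bridge_nil.
case: l => [|e l] ln xF yF.
  by move=> xy lD; apply: IH.
move=> el lD; have [w [r [z [elE wz zF wF rz]]]] := first_return el yF.
have rn : size r <= n.
  by move/(congr1 size): elE; rewrite /= size_cat; move: ln => /=; lia.
rewrite elE in lD.
have [] := IH z r rn zF yF rz; first by move=> f fr; apply: lD;
  rewrite mem_cat fr orbT.
move=> q [ls [z' [rE qb lsb]]].
have [ew|nw] := boolP (excursion F1 F2 (e :: w)).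
  exists [::], ((e :: w, q) :: ls), x; split.
  - by rewrite elE rE /letters_word /= catA.
  - exact: bridge_nil.
  - exists z, z'; split=> //; split=> //; first by exists x, z.
    by move=> f fw; apply: lD; rewrite mem_cat fw.
exists ((e :: w) ++ q), ls, z'; split=> //; first by rewrite elE rE catA.
apply: bridge_cat qb; split; try exact: F2_D1; first by [].
move: nw; rewrite (excursionE _ _ wz) xF zF wF /= -(walk_tgts wz) => nw f fw.
have fD : dset D f by apply: lD; rewrite mem_cat fw.
split=> //; last first.
  apply: contra nw => fF; apply/orP; right; apply/hasP.
  by exists (tgt f) => //; apply: map_f.
apply: contra nw => fF; move: fw; rewrite inE => /orP[/eqP fe|fw].
  by rewrite -fe; case/andP: wz => /eqP <- _; rewrite -fe fF.
apply/orP; right; rewrite (walk_tgts wz) has_rcons; apply/orP; right.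
by apply/hasP; exists (src f) => //; apply: map_f.
Qed.

Lemma chained_close x ls y q : ls != [::] -> chained x ls y ->
  bridge D1 y x q ->
  exists2 ls', ls' != [::] /\ chained x ls' x & letters_word ls' = letters_word
    ls ++ q.
Proof.
move=> + + qb; suff H z : ls != [::] -> chained z ls y ->
    exists2 ls', ls' != [::] /\ chained z ls' x & letters_word ls' =
      letters_word ls ++ q.
  exact: H.
elim: ls z => [//|[e p] ls IH] z _ [z1 [z2 [ez we pb lsc]]].
have [ls0|ls0] := eqVneq ls [::].
  move: lsc; rewrite ls0 /= => z2y; subst z2.
  exists [:: (e, p ++ q)]; last by rewrite /letters_word /= !cats0 catA.
  by split=> //; exists z1, x; split=> //; apply: bridge_cat pb qb.
have [ls' [ls'0 c'] lE] := IH z2 ls0 lsc.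
exists ((e, p) :: ls'); last by
  rewrite /letters_word /= -/(letters_word ls') lE !catA.
by split=> //; exists z1, z2.
Qed.

(** The loop is rerooted at a visit to F2 and decomposed; its initial bridge is then rotated to the
    end, where it prolongs the last letter. *)
Lemma crossing_loop_letters c : uloops D c -> uloop_meets F1 c ->
  uloop_meets F2 c ->
  exists ls x, [/\ ls != [::],
    chained x ls x & c = loop_class (letters_word ls)].
Proof.
case=> l [l0 [x0 [_ _ lw lD]]] <-{c} /asboolP[l1 ll1 hl1] /asboolP[l2 ll2 hl2].
have mem_class k f : loop_class l k -> f \in k -> f \in l \/ drev f \in l.
  by case=> i [->|->]; rewrite mem_rot ?mem_revpath; [left|right].
have class_dset k : loop_class l k -> forall f, f \in k -> dset D f.
  move=> lk f /(mem_class _ _ lk)[/lD//|/lD /dset_drev]; by rewrite drevK.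
have class_walk k : loop_class l k -> exists y, walk y k y.
  case=> i [->|->]; first exact: walk_rot lw.
  exact: walk_rot (walk_rev lw).
case/hasP: hl2 => f fl2 fF; have [i m l2E] := rot_to fl2.
have lk : loop_class l (f :: m).
  rewrite -(loop_class_eq ll2) -l2E; exists i; by left.
have [y ym] := class_walk _ lk.
have yF : y \in F2 by case/andP: ym => /eqP <-.
have [q [ls [z [mE qb lsc]]]] :=
  excursion_decomposition yF yF ym (class_dset _ lk).
(* With no letter, the whole loop would be a bridge avoiding F1. *)
have ls0 : ls != [::].
  apply/eqP => ls0; move: mE; rewrite ls0 /letters_word /= cats0 => mE.
  have mD k : k \in f :: m -> src k \notin F1 /\ tgt k \notin F1.
    by rewrite mE; case: qb => _ _ _ H /H[].
  have l1m : loop_class (f :: m) l1 by rewrite (loop_class_eq lk).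
  case/hasP: hl1 => k kl1 kF.
  case: l1m => j [l1E|l1E]; move: kl1; rewrite l1E mem_rot.
    by move=> /mD[]; rewrite kF.
  by rewrite mem_revpath => /mD[_]; rewrite /tgt drevK kF.
have [ls' [ls'0 lsc'] lsE] := chained_close ls0 lsc qb.
exists ls', z; split=> //; rewrite lsE -(loop_class_eq lk) mE.
by apply/esym/loop_class_eq; exists (size q); left; rewrite rot_size_cat.
Qed.

(** * The gluing of a single loop *)

Section CyclicGluing.
Variables (e0 : dart Gam) (ls : seq letter) (x0 : vertex Gam).
Hypotheses (ls0 : ls != [::]) (lsP : chained x0 ls x0).
Local Notation n := (size ls).
Local Notation ltr := (nth ([::], [::]) ls).

Lemma chained_head x ls' y : ls' != [::] -> chained x ls' y ->
  x = src (head e0 (nth ([::], [::]) ls' 0).1).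
Proof.
case: ls' => // -[e q] ls' _ [z [z' [ez [ee _ _] _ _]]].
by case: e ez ee => //= e w /andP[/eqP <-].
Qed.

Lemma chained_letters x ls' y : chained x ls' y -> forall p, p < size ls' ->
  let a k := nth ([::], [::]) ls' k in
  walk_excursion (a p).1 /\
  bridge D1 (tgt (last e0 (a p).1))
    (if p.+1 < size ls' then src (head e0 (a p.+1).1) else y) (a p).2.
Proof.
elim: ls' x => // -[e q] ls' IH x [z [z' [ez we qb lsc]]] [|p] p_lt /=;
  last first.
  have [] := IH _ lsc p p_lt; by [].
split=> //; have -> : tgt (last e0 e) = z.
  by case: we ez => {p_lt qb} + _ _; case: e => // f w _ /walk_last.
have {}lsc : chained z' ls' y by [].
case: ls' lsc p_lt {IH} => [|a ls'] lsc _; first by move: lsc => /= <-.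
by have /= <- := chained_head _ lsc.
Qed.

(** The labels [(true, p)] and [(false, p)] are the start and the end of the p-th excursion; the
    p-th bridge joins [(false, p)] to [(true, p+1)], with p+1 taken modulo n. *)
Let T := (bool * 'I_n)%type.
Let c_oth (t : T) : T := (~~ t.1, t.2).
Let c_prt (t : T) : T := if t.1 then (false, ord_pred t.2) else (true,
  ordS t.2).
Let c_exc (t : T) := if t.1 then (ltr t.2).1 else revpath (ltr t.2).1.
Let c_brg (t : T) := if t.1 then revpath (ltr (ord_pred t.2)).2 else (ltr
  t.2).2.
Let c_zpt (t : T) :=
  if t.1 then src (head e0 (ltr t.2).1) else tgt (last e0 (ltr t.2).1).

Let c_othK : involutive c_oth. Proof. by case=> a p;
  rewrite /c_oth /= negbK. Qed.
Let c_oth_neq t : c_oth t != t.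
Proof. by case: t => a p; rewrite xpair_eqE /=; case: a. Qed.
Let c_prtK : involutive c_prt.
Proof. by case=> -[] p; rewrite /c_prt /= ?ord_predK ?ordSK. Qed.
Let c_prt_neq t : c_prt t != t.
Proof. by case: t => -[] p. Qed.
Let c_exc_oth t : c_exc (c_oth t) = revpath (c_exc t).
Proof. by case: t => -[] p; rewrite /c_exc /= ?revpathK. Qed.
Let c_brg_prt t : c_brg (c_prt t) = revpath (c_brg t).
Proof.
case: t => -[] p; first by rewrite revpathK.
exact: (congr1 (fun i : 'I_n => revpath (ltr i).2) (ordSK p)).
Qed.

Let c_letter (p : 'I_n) : walk_excursion (ltr p).1.
Proof. by case: (chained_letters lsP (ltn_ord p)). Qed.

Let c_exc_walk t : walk (c_zpt t) (c_exc t) (c_zpt (c_oth t)).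
Proof.
suff H p : walk (c_zpt (true, p)) (c_exc (true, p)) (c_zpt (false, p)).
  by case: t => -[] p; rewrite /c_oth /=; [exact: H | exact: walk_rev (H p)].
rewrite /c_zpt /c_exc /=; have [] := c_letter p; case: (ltr p).1 =>
  // e w _ [a [b ab]] _.
by rewrite (walk_last ab) /= eqxx; case/andP: ab.
Qed.

Let c_walk_excursion t : walk_excursion (c_exc t).
Proof.
by case: t => -[] p; rewrite /c_exc /=; [|apply: walk_excursion_revpath];
  exact: c_letter.
Qed.

Lemma bridge_rev x y w : bridge D1 x y w -> bridge D1 y x (revpath w).
Proof.
case=> Dx Dy wxy wD; split=> // [|e]; first exact: walk_rev.
by rewrite mem_revpath => /wD/dset_drev; rewrite drevK.
Qed.

Let c_brg_bridge t : bridge D1 (c_zpt t) (c_zpt (c_prt t)) (c_brg t).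
Proof.
suff H p : bridge D1 (c_zpt (false, p)) (c_zpt (true, ordS p)) (c_brg (false,
  p)).
  case: t => -[] p; rewrite /c_prt /=; last exact: H.
  by have /bridge_rev := H (ord_pred p); rewrite ord_predK.
rewrite /c_zpt /c_brg /=; case: (chained_letters lsP (ltn_ord p)) => _ /=.
case: ifP => p_lt; first by rewrite modn_small.
have -> : p.+1 = n by have := ltn_ord p; lia.
by rewrite modnn -(chained_head ls0 lsP).
Qed.

Definition cyclic_gluing : gluing T := @Gluing Gam D F1 F2 T
  c_oth c_prt c_exc c_brg c_zpt c_othK c_oth_neq c_prtK c_prt_neq c_exc_oth
  c_brg_prt c_exc_walk
  (fun t => let: And3 et _ _ := c_walk_excursion t in et)
  (fun t => let: And3 _ _ dt := c_walk_excursion t in dt)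
  c_brg_bridge.

Lemma letters_gt0 : 0 < n. Proof. by rewrite lt0n size_eq0. Qed.

Let t0 : T := (true, Ordinal letters_gt0).

Lemma iter_cyclic_nxt k : k < n ->
  (iter k (nxt cyclic_gluing) t0).1 = true /\
  (iter k (nxt cyclic_gluing) t0).2 = k :> nat.
Proof.
elim: k => [//|k IH] k_lt; rewrite iterS.
have [] := IH (ltnW k_lt); case: (iter _ _ _) => a p /= -> pk.
by split=> //=; rewrite pk modn_small.
Qed.

Lemma word_cyclic_gluing : word cyclic_gluing t0 = letters_word ls.
Proof.
set nx := nxt cyclic_gluing.
have vE : [seq val j.2 | j <- traject nx t0 n] = iota 0 n.
  apply: (@eq_from_nth _ 0) => [|k];
    rewrite size_map size_traject ?size_iota // => k_lt.
  rewrite (nth_map t0) ?size_traject // nth_traject // nth_iota //.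
  by case: (iter_cyclic_nxt k_lt).
have mE : n.-1.+1 = n := prednK letters_gt0.
have tn : iter n nx t0 = t0.
  rewrite -[X in iter X]mE iterS.
  have [] := @iter_cyclic_nxt n.-1; first by rewrite ltn_predL letters_gt0.
  rewrite -/nx; case: (iter _ _ _) => a p /= -> pk.
  by congr pair; apply: val_inj; rewrite /= pk mE modnn.
have trE : traject nx t0 n = t0 :: traject nx (nx t0) n.-1.
  by rewrite -[X in traject _ _ X]mE.
have oE : order nx t0 = n.
  rewrite -[RHS](size_traject nx t0); apply: order_cycle.
  - rewrite trE /= rcons_path fpath_traject last_traject /=.
    by rewrite -iterS mE tn.
  - by apply: (@map_uniq _ _ (fun j : T => val j.2)); rewrite vE iota_uniq.
  - by rewrite trE mem_head.
rewrite /word /orbit -/nx oE /letters_word; congr flatten.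
rewrite -[in RHS](mkseq_nth ([::], [::]) ls) /mkseq -vE -!map_comp.
apply/eq_in_map => j /trajectP[k k_lt ->] /=.
case: (iter_cyclic_nxt k_lt) => + _; rewrite -/nx; case: (iter _ _ _) =>
  a p /= ->.
by [].
Qed.

Lemma concat_mult_cyclic c :
  concat_mult cyclic_gluing c = (c == loop_class (letters_word ls) :> uloop
    Gam).
Proof.
have KT : component (oth cyclic_gluing) (prt cyclic_gluing) t0 = setT.
  apply/setP => -[a p]; rewrite component_orbit in_setT.
  have fp : fconnect (nxt cyclic_gluing) t0 (true, p).
    suff -> : (true, p) = iter p (nxt cyclic_gluing) t0 by exact: fconnect_iter.
    case: (iter_cyclic_nxt (ltn_ord p)); case: (iter _ _ _) => a' p' /= -> pp'.
    by congr pair; apply: val_inj.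
  case: a; first by rewrite fp.
  by apply/orP; right; have := fc_oth fp.
have tK j : j \in component (oth cyclic_gluing) (prt cyclic_gluing) t0.
  by rewrite KT in_setT.
have cE j : loop_class (word cyclic_gluing j) = loop_class (letters_word ls).
  by rewrite -word_cyclic_gluing; apply: cl_component.
rewrite eq_sym -word_cyclic_gluing.
rewrite -(@card_roots_component _ _ _ (othK cyclic_gluing) (prtK cyclic_gluing)
  (fun j => loop_class (word cyclic_gluing j) == c :> uloop Gam)) => [|j _].
  by apply: eq_card => j; rewrite [RHS]in_set tK.
by rewrite !cE.
Qed.

End CyclicGluing.

(** * Disjoint unions of gluings *)

Section SumGluing.
Variables (T1 T2 : finType) (G1 : gluing T1) (G2 : gluing T2).
Local Notation T := (T1 + T2)%type.

Definition sum_map (f1 : T1 -> T1) (f2 : T2 -> T2) (t : T) : T :=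
  match t with inl a => inl (f1 a) | inr a => inr (f2 a) end.
Definition sum_case (A : Type) (f1 : T1 -> A) (f2 : T2 -> A) (t : T) : A :=
  match t with inl a => f1 a | inr a => f2 a end.

Lemma sum_mapK f1 f2 : involutive f1 -> involutive f2 ->
  involutive (sum_map f1 f2).
Proof. by move=> f1K f2K [a|a] /=; rewrite ?f1K ?f2K. Qed.

Lemma sum_map_neq f1 f2 : (forall a, f1 a != a) -> (forall a, f2 a != a) ->
  forall t, sum_map f1 f2 t != t.
Proof.
by move=> H1 H2 [a|a] /=; apply/eqP => -[] /eqP; apply/negP; rewrite ?H1 ?H2.
Qed.

Definition sum_gluing : gluing T.
Proof.
refine (@Gluing Gam D F1 F2 T (sum_map (oth G1) (oth G2)) (sum_map (prt G1) (prt
  G2))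
  (sum_case (exc G1) (exc G2)) (sum_case (brg G1) (brg G2))
  (sum_case (zpt G1) (zpt G2)) (sum_mapK (othK G1) (othK G2))
  (sum_map_neq (oth_neq G1) (oth_neq G2)) (sum_mapK (prtK G1) (prtK G2))
  (sum_map_neq (prt_neq G1) (prt_neq G2)) _ _ _ _ _ _).
- by case=> a /=; rewrite exc_oth.
- by case=> a /=; rewrite brg_prt.
- by case=> a /=; exact: exc_walk.
- by case=> a /=; exact: exc_excursion.
- by case=> a /=; exact: exc_dset.
- by case=> a /=; exact: brg_bridge.
Defined.

Lemma word_sum_inl a : word sum_gluing (inl a) = word G1 a.
Proof.
have <- : [ffun t => inl t] a = inl a :> T by rewrite ffunE.
apply: (@word_isos _ _ _ _ _ _ _ _ inl); apply/isosP.
by split=> [t|t _|t1 t2 _ _]; rewrite ?in_setT ?ffunE // => -[].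
Qed.

Lemma word_sum_inr a : word sum_gluing (inr a) = word G2 a.
Proof.
have <- : [ffun t => inr t] a = inr a :> T by rewrite ffunE.
apply: (@word_isos _ _ _ _ _ _ _ _ inr); apply/isosP.
by split=> [t|t _|t1 t2 _ _]; rewrite ?in_setT ?ffunE // => -[].
Qed.

(** Label counts of words add up over the two summands, and [card_word] converts them into
    multiplicities. *)
Lemma concat_mult_sum c :
  concat_mult sum_gluing c = concat_mult G1 c + concat_mult G2 c.
Proof.
have occ (l : seq (dart Gam)) : #|[set t | word sum_gluing t == l]| =
    #|[set t | word G1 t == l]| + #|[set t | word G2 t == l]|.
  rewrite -!sum1dep_card big_sumType /=.
  by congr addn; apply: eq_bigl => a; rewrite ?word_sum_inl ?word_sum_inr.
have H (l : seq (dart Gam)) : c = loop_class l -> estart F1 F2 l ->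
    concat_mult sum_gluing c = concat_mult G1 c + concat_mult G2 c.
  move=> -> le; apply/eqP; rewrite -(eqn_pmul2r (symmetries_gt0 (l := l) _)).
    by rewrite mulnDl -!card_word // occ.
  by case/estartP: le => -[|e w] [r [->]].
have [G10|/concat_mult_word[t tc]] := eqVneq (concat_mult G1 c) 0; last first.
  by apply: H tc _; exact: estart_word.
have [G20|/concat_mult_word[t tc]] := eqVneq (concat_mult G2 c) 0; last first.
  by apply: H tc _; exact: estart_word.
have [G0|/concat_mult_word[t tc]] := eqVneq (concat_mult sum_gluing c) 0;
  last first.
  by apply: H tc _; exact: estart_word.
by rewrite G10 G20 G0.
Qed.

End SumGluing.

Definition empty_gluing : gluing void.
Proof. by exists (fun t : void => t) (fun t : void =>
  t) (fun=> [::]) (fun=> [::])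
  (fun t : void => match t with end) => -[]. Defined.

Definition crossing_class (c : uloop Gam) :=
  [/\ uloops D c, uloop_meets F1 c & uloop_meets F2 c].

Lemma gluing_exists (cs : seq (uloop Gam)) : (forall c, c \in cs ->
  crossing_class c) ->
  exists (T : finType) (G : gluing T), forall c,
    concat_mult G c = count_mem c cs.
Proof.
elim: cs => [|c cs IH] csP.
  exists (void : finType), empty_gluing => c; apply: eq_card0 => -[].
have [T [G GE]] := IH (fun c' H => csP c' (mem_behead (s := c :: cs) H)).
have [cD c1 c2] := csP c (mem_head _ _).
have [ls [x [ls0 lsc ->]]] := crossing_loop_letters cD c1 c2.
have [e0 _] : exists e0 : dart Gam, e0 = e0.
  case: ls ls0 lsc => // -[[|e w] q] ls _ [z [z' [_ [+ _ _] _ _]]] => // _.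
  by exists e.
exists _, (sum_gluing (cyclic_gluing e0 ls0 lsc) G) => c'.
by rewrite concat_mult_sum concat_mult_cyclic GE /= eq_sym.
Qed.

End LoopDecomposition.

(** * Completions of a list of excursions *)

Section Completions.
Variables (Gam : graph) (D : subgraph Gam) (F1 F2 : {fset vertex Gam}).
Hypothesis F2D : forall x, x \in F2 -> vset D x.
Hypothesis F12 : forall x, x \in F1 -> x \notin F2.
Local Notation gluing := (gluing D F1 F2).
Local Notation D1 := (remove_vertices D F1).
Local Notation walk_excursion := (walk_excursion D F1 F2).
Local Notation crossing_class := (crossing_class D F1 F2).
Implicit Types (w : seq (dart Gam)) (L : uloop Gam ->
  nat) (cs : seq (uloop Gam)).

Lemma path_class_eq w w' : path_class w = path_class w' ->
  w = w' \/ w = revpath w'.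
Proof.
move=> wE; have : path_class w w by left.
by rewrite wE => -[|] /= e; [left|right].
Qed.

(** Labels come in pairs reading a word and its reversal. The count of an unoriented class thus
    determines the oriented ones: all of it for a word equal to its reversal, half of it
    otherwise. *)
Lemma card_exc (T : finType) (o : T -> T) (ex : T -> seq (dart Gam)) w :
  involutive o -> (forall t, ex (o t) = revpath (ex t)) ->
  #|[set t | ex t == w]| =
  if revpath w == w then #|[set t | `[< path_class (ex t) = path_class w >]]|
  else #|[set t | `[< path_class (ex t) = path_class w >]]|./2.
Proof.
move=> oK exo.
have rvE : #|[set t | ex t == revpath w]| = #|[set t | ex t == w]|.
  rewrite -[LHS](card_imset _ (inv_inj oK)); apply: eq_card => t.
  rewrite inE; apply/imsetP/eqP => [[j]|tw].
    by rewrite inE => /eqP jw ->; rewrite exo jw revpathK.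
  by exists (o t); rewrite ?oK // inE exo tw.
have H : [set t | `[< path_class (ex t) = path_class w >]] =
    [set t | ex t == w] :|: [set t | ex t == revpath w].
  apply/setP => t; rewrite !inE; apply/asboolP/orP => [/path_class_eq[]->|].
  - by left.
  - by right.
  - by case=> /eqP ->; rewrite ?path_class_revpath.
rewrite H; case: eqP => [->|/eqP ne]; first by rewrite setUid.
rewrite cardsU rvE (_ : _ :&: _ = set0) ?cards0 ?subn0 ?addnn ?doubleK //.
by apply/setP => t; rewrite !inE; apply/negP => /andP[/eqP -> /eqP e];
  rewrite -e eqxx in ne.
Qed.

Definition class_excursions L cs u := \sum_(c <- cs) L c *
  count (fun w => `[< path_class w = u >]) (excursions_of F1 F2
    (classical_sets.xget [::] c)).

Lemma gluing_of_mult L cs : uniq cs -> (forall c, L c != 0 -> c \in cs) ->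
  (forall c, L c != 0 -> crossing_class c) ->
  exists (T : finType) (G : gluing T), concat_mult G =1 L.
Proof.
move=> cs_uniq csL csP.
pose s := flatten [seq nseq (L c) c | c <- cs].
have sP c : c \in s -> crossing_class c.
  case/flattenP=> _ /mapP[c' _ ->]; rewrite mem_nseq => /andP[L0 /eqP ->].
  by apply: csP; rewrite -lt0n.
have [T [G GE]] := gluing_exists F2D F12 sP; exists T, G => c; rewrite GE.
have [cc|nc] := boolP (c \in cs); last first.
  have /eqP -> : L c == 0 by apply: contraNT nc; exact: csL.
  apply/eqP; rewrite -leqn0 leqNgt -has_count has_pred1; apply: contra nc.
  by case/flattenP=> _ /mapP[c' c'cs ->]; rewrite mem_nseq => /andP[_ /eqP ->].
rewrite count_flatten sumnE !big_map (bigD1_seq c) //= count_nseq /= eqxx mul1n.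
rewrite big1 ?addn0 // => c' /negbTE ne.
by rewrite count_nseq /= ne mul0n.
Qed.

Section OneList.
Variable h : seq (seq (dart Gam)).
Local Notation M := (size (extremities h)).
Local Notation zb := (zbridge D1 (@zpoint Gam h)).

(** The list is known only through its counts of unoriented classes; each member is compared, up to
    reversal, with an excursion of an abstract gluing of [L]. *)
Lemma walk_excursion_list L cs : uniq cs -> (forall c, L c != 0 -> c \in cs) ->
  (forall c, L c != 0 -> crossing_class c) ->
  (forall u, count (fun w =>
    `[< path_class w = u >]) h = class_excursions L cs u) ->
  forall w, w \in h -> walk_excursion w.
Proof.
move=> cs_uniq csL csP hL w wh.
have [T [G GE]] := gluing_of_mult cs_uniq csL csP.
have csG c : concat_mult G c != 0 -> c \in cs by rewrite GE; exact: csL.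
have /card_gt0P[t] : 0 < #|[set t | `[< path_class (exc G t) = path_class w
  >]]|.
  rewrite -(double_excursions_concat _ cs_uniq csG) double_gt0.
  rewrite (eq_bigr (fun c => L c * count (fun w0 =>
    `[< path_class w0 = path_class w >])
    (excursions_of F1 F2 (classical_sets.xget [::] c)))) => [|c _]; last by
      rewrite GE.
  rewrite -/(class_excursions _ _ _) -hL -has_count; apply/hasP; exists w => //.
  exact/asboolP.
have Gt : walk_excursion (exc G t).
  split; [exact: exc_excursion | | exact: exc_dset].
  by exists (zpt G t), (zpt G (oth G t)); exact: exc_walk.
rewrite inE => /asboolP/esym/path_class_eq[->//|->].
exact: walk_excursion_revpath.
Qed.

Hypothesis hP : forall w, w \in h -> walk_excursion w.

Section TransportToLabels.
Variables (T : finType) (G : gluing T) (f : T -> 'I_M) (f' : 'I_M -> T).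
Hypotheses (fK : cancel f f') (f'K : cancel f' f).
Hypotheses (fo : forall t, f (oth G t) = other_end (f t)).
Hypotheses (fe : forall t, excursion_from h (f t) = exc G t).

Definition transport : zpaths Gam M :=
  [ffun i => (f (prt G (f' i)), brg G (f' i))].

Lemma zpoint_transport t : zpoint (f t) = zpt G t.
Proof.
have := excursion_from_walk hP (f t); have := exc_walk G t; have :=
  exc_neq0 G t.
rewrite fe; case: (exc G t) => //= e w _.
by move=> /andP[/eqP <- _] /andP[/eqP <- _].
Qed.

Lemma transport_partner t : partner transport (f t) = f (prt G t).
Proof. by rewrite !ffunE /= fK. Qed.

Lemma transport_zbridge : zb transport.
Proof.
split=> [|i].
  apply/forallP => i; rewrite -(f'K i) !transport_partner prtK eqxx andbT.
  by rewrite (inj_eq (can_inj fK)) prt_neq.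
rewrite -(f'K i) transport_partner !zpoint_transport !ffunE /= !fK.
split; [exact: brg_bridge | exact: brg_prt].
Qed.

Lemma transport_isos d :
  [ffun t => f t] \in isos (oth G) (prt G) (oth (zbridge_gluing hP
    transport_zbridge))
    (prt (zbridge_gluing hP transport_zbridge)) (label_data G)
    (label_data (zbridge_gluing hP transport_zbridge)) d setT setT.
Proof.
apply/isosP; split=> [t|t _|t1 t2 _ _]; rewrite ?in_setT // !ffunE;
  last exact: (can_inj fK).
split=> //.
  by rewrite /= transport_partner.
by rewrite /label_data /= fe ffunE /= fK.
Qed.

Lemma transport_concatenation : concatenation h transport = concat_mult G.
Proof.
apply/funext => c; rewrite (concatenationE hP transport_zbridge); apply/esym.
apply: (concat_mult_isos (transport_isos f)).
exact: bij_eq_card (Bijective fK f'K).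
Qed.

End TransportToLabels.

(** An abstract gluing of [L] has as many labels reading each oriented excursion as the list has, so
    [matching] identifies the two sets of labels and its bridges are carried over. *)
Lemma completion_exists L cs : uniq cs -> (forall c, L c != 0 -> c \in cs) ->
  (forall c, L c != 0 -> crossing_class c) ->
  (forall u, count (fun w =>
    `[< path_class w = u >]) h = class_excursions L cs u) ->
  exists2 b, zb b & concatenation h b = L.
Proof.
move=> cs_uniq csL csP hL.
have [T [G GE]] := gluing_of_mult cs_uniq csL csP.
have csG c : concat_mult G c != 0 -> c \in cs by rewrite GE; exact: csL.
have cntE u : #|[set t | `[< path_class (exc G t) = u >]]| =
    #|[set i : 'I_M | `[< path_class (excursion_from h i) = u >]]|.
  rewrite (count_excursion_from hP) hL -(double_excursions_concat _ cs_uniq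
    csG).
  by congr _.*2; apply: eq_bigr => c _; rewrite GE.
have cnt w : #|[set t | exc G t == w]| = #|[set i : 'I_M | excursion_from h i ==
  w]|.
  rewrite (card_exc w (othK G) (exc_oth G)) cntE.
  by rewrite (card_exc w (other_endK hP) (excursion_from_other hP)).
have TM : #|T| = #|'I_M|.
  have E (U : finType) (ex : U -> seq (dart Gam)) w :
      count_mem w [seq ex t | t <- enum U] = #|[set t | ex t == w]|.
    rewrite count_map -size_filter cardE /enum_mem -filter_predI; congr size.
    by apply: eq_filter => j /=; rewrite !inE andbT.
  rewrite !cardE -(size_map (exc G)) -(size_map (@excursion_from Gam h M)).
  by apply/perm_size/allP => w _; rewrite /= !E cnt.
have [f [[f' fK f'K] fo fe]] := matching (othK G) (other_endK hP) (oth_neq G)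
  (other_end_neq hP) (exc_oth G) (excursion_from_other hP) TM cnt.
exists (transport G f f'); first exact: transport_zbridge.
by rewrite transport_concatenation //; apply/funext.
Qed.

Section OneBridge.
Variable b : zpaths Gam M.
Hypothesis bP : zb b.
Local Notation L := (concatenation h b).

Lemma concatenation_crossing c : L c != 0 -> crossing_class c.
Proof.
rewrite (concatenationE hP bP) => /concat_mult_word[t ->]; split.
- exists (word (zbridge_gluing hP bP) t) => //; exact: word_rooted_loop.
- exact: word_meets_F1.
- exact: word_meets_F2.
Qed.

Lemma concatenation_support : exists2 cs, uniq cs & forall c, L c != 0 ->
  c \in cs.
Proof.
exists (undup [seq (loop_class (word (zbridge_gluing hP bP) t) : uloop Gam) |
  t <- enum 'I_M]); first exact: undup_uniq.
move=> c; rewrite (concatenationE hP bP) => /concat_mult_word[t ->].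
by rewrite mem_undup; apply/mapP; exists t; rewrite ?mem_enum.
Qed.

Lemma concatenation_excursions cs u : uniq cs -> (forall c, L c != 0 ->
  c \in cs) ->
  class_excursions L cs u = count (fun w => `[< path_class w = u >]) h.
Proof.
move=> cs_uniq csL; apply: double_inj.
rewrite -(count_excursion_from hP).
rewrite -(double_excursions_concat (G := zbridge_gluing hP bP) _ cs_uniq) //.
Qed.

Lemma double_size_concatenation cs : uniq cs -> (forall c, L c != 0 ->
  c \in cs) ->
  (\sum_(c <- cs) L c * size (classical_sets.xget [::] c)).*2 =
  \sum_(i < M) size (excursion_from h i) + \sum_(i < M) size (b i).2.
Proof.
move=> cs_uniq csL.
exact: (double_size_concat (G := zbridge_gluing hP bP) cs_uniq csL).
Qed.

End OneBridge.

(** Both involutions are [other_end], so that only the excursions have to be preserved; this is Aut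
    h. *)
Definition relabellings : {set {ffun 'I_M -> 'I_M}} :=
  isos (@other_end M) (@other_end M) (@other_end M) (@other_end M)
    (@excursion_from Gam h M) (@excursion_from Gam h M) id setT setT.

Lemma relabellingsP (f : {ffun 'I_M -> 'I_M}) :
  reflect [/\ injective f, forall t, f (other_end t) = other_end (f t) &
              forall t, excursion_from h (f t) = excursion_from h t]
          (f \in relabellings).
Proof.
apply: (iffP (isosP _ _ _ _ _ _ _ _ _ _)) => [[_ fK finj]|[finj fo fe]]; split.
- by move=> t1 t2 /finj; apply; rewrite in_setT.
- by move=> t; case: (fK t (in_setT t)).
- by move=> t; case: (fK t (in_setT t)).
- by move=> t; rewrite in_setT.
- by move=> t _; rewrite in_setT.
- by move=> t1 t2 _ _; exact: finj.
Qed.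

Definition ffun_inv (f : {ffun 'I_M -> 'I_M}) i := odflt i [pick j | f j == i].

Lemma ffun_invK (f : {ffun 'I_M -> 'I_M}) : injective f ->
  cancel f (ffun_inv f).
Proof.
move=> finj t; rewrite /ffun_inv; case: pickP => [j /eqP/finj //|].
by move=> /(_ t); rewrite eqxx.
Qed.

Lemma ffun_invKV (f : {ffun 'I_M -> 'I_M}) : injective f ->
  cancel (ffun_inv f) f.
Proof.
move=> finj i; have /codomP[t ->] : i \in codom f by
  rewrite (inj_card_onto finj).
by rewrite ffun_invK.
Qed.

(* The relabellings act transitively on the completions of the same loops, and *)
(* those fixing a completion are the automorphisms of the loops. *)
Theorem card_completions b0 (b0P : zb b0) cs : uniq cs ->
  (forall c, concatenation h b0 c != 0 -> c \in cs) ->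
  exists2 bs : seq (zpaths Gam M),
    uniq bs /\ (forall b, b \in bs <-> zb b /\ concatenation h b = concatenation
      h b0) &
    (size bs * \prod_(c <- cs) ((concatenation h b0 c)`! *
       class_symmetries c ^ concatenation h b0 c) = #|relabellings|)%N.
Proof.
move=> cs_uniq csL; pose G0 := zbridge_gluing hP b0P.
(* The action of a relabelling on the bridge [b0]. *)
pose tr (f : {ffun 'I_M -> 'I_M}) := transport G0 f (ffun_inv f).
have trP f : f \in relabellings -> exists trb : zb (tr f),
    concatenation h (tr f) = concatenation h b0 /\
    f \in isos (oth G0) (prt G0) (oth (zbridge_gluing hP trb))
      (prt (zbridge_gluing hP trb)) (label_data G0)
      (label_data (zbridge_gluing hP trb)) id setT setT.
  case/relabellingsP=> finj fo fe.
  have [fK f'K] := (ffun_invK finj, ffun_invKV finj).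
  exists (@transport_zbridge _ G0 _ _ fK f'K fe); split.
    by rewrite /tr (@transport_concatenation _ G0 _ _ fK f'K fo fe).
  have ff : [ffun t => f t] = f by apply/ffunP => t; rewrite ffunE.
  by have := @transport_isos _ G0 _ _ fK f'K fo fe id; rewrite ff.
(* Isomorphisms from the gluing of [b0] to that of [b] are exactly the relabellings carrying [b0] to
   [b]; their number is given by [card_gluing_isos]. *)
have isos_tr b (bP : zb b) f : f \in isos (oth G0) (prt G0)
    (oth (zbridge_gluing hP bP)) (prt (zbridge_gluing hP bP)) (label_data G0)
    (label_data (zbridge_gluing hP bP)) id setT setT ->
      f \in relabellings /\ tr f = b.
  case/isosP=> _ fK finj'.
  have finj : injective f by move=> t1 t2 /finj'; apply; rewrite in_setT.
  split.
    apply/relabellingsP; split=> // t; first by case: (fK t (in_setT t)).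
    by case: (fK t (in_setT t)) => _ _ _ [].
  apply/ffunP => i; rewrite -(ffun_invKV finj i); set t := ffun_inv f i.
  rewrite ffunE (ffun_invK finj); case: (fK t (in_setT t)) => _ _ -> [_ be].
  by rewrite /= -be ffunE; case: (b _).
have csG c : concat_mult G0 c != 0 -> c \in cs by exact: csL.
pose bs := undup [seq tr f | f <- enum relabellings].
have bsP b : b \in bs <-> zb b /\ concatenation h b = concatenation h b0.
  rewrite mem_undup; split=> [/mapP[f + ->]|[bP bL]].
    by rewrite mem_enum => /trP[trb [-> _]].
  have GG : concat_mult G0 =1 concat_mult (zbridge_gluing hP bP).
    by move=> c; rewrite -!concatenationE bL.
  have : 0 < #|isos (oth G0) (prt G0) (oth (zbridge_gluing hP bP))
     (prt (zbridge_gluing hP bP)) (label_data G0)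
     (label_data (zbridge_gluing hP bP)) id setT setT|.
    rewrite (@card_gluing_isos _ D F1 F2 _ G0 (zbridge_gluing hP bP) cs cs_uniq
      csG GG).
    rewrite prodn_gt0 // => c.
    rewrite muln_gt0 fact_gt0 expn_gt0 /=.
    have [_|c0] := eqVneq (concat_mult G0 c) 0; first by rewrite orbT.
    rewrite orbF; case/concat_mult_word: c0 => t ->.
    by rewrite class_symmetriesE symmetries_gt0 // word_neq0.
  case/card_gt0P=> f /isos_tr[fA <-]; apply: map_f; by rewrite mem_enum.
exists bs; first by split; [exact: undup_uniq | exact: bsP].
(* The relabellings are counted by their image of [b0]: all fibres have |Aut L| elements. *)
transitivity (\sum_(b <- bs) count_mem b [seq tr f | f <- enum relabellings]).
  rewrite (eq_big_seq (fun=> \prod_(c <- cs) ((concatenation h b0 c)`! *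
       class_symmetries c ^ concatenation h b0 c))) => [|b /bsP[bP bL]].
    by rewrite big_const_seq count_predT iter_addn_0 mulnC.
  have GG : concat_mult G0 =1 concat_mult (zbridge_gluing hP bP).
    by move=> c; rewrite -!concatenationE bL.
  rewrite (concatenationE hP b0P).
  rewrite -(@card_gluing_isos _ D F1 F2 _ G0 (zbridge_gluing hP bP) cs cs_uniq
    csG GG).
  rewrite count_map -size_filter cardE /enum_mem -filter_predI; congr size.
  apply: eq_filter => f /=; apply/andP/idP => [[/eqP trf fA]|fI]; last first.
    by have [? /eqP] := isos_tr _ _ _ fI.
  move: (trP _ fA) => [trb [_]]; by subst b.
rewrite [RHS]cardE -(size_map tr) -[RHS]sum1_size -[RHS]big_undup_iterop_count
  /=.
apply: eq_bigr => b _.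
by rewrite Monoid.iteropE iter_addn_0 mul1n.
Qed.

End OneList.
End Completions.

From mathcomp Require Import all_boot all_order all_algebra finmap ring.
From mathcomp Require Import all_classical all_reals all_analysis.
Import Order.TTheory GRing.Theory Num.Theory.
Local Open Scope classical_set_scope.
Local Open Scope ring_scope.

(** * Sums of nonnegative terms and countable unions *)

Section SumsOfNonnegativeTerms.
Context {R : realType}.
Local Open Scope ereal_scope.

Lemma esumZl (T : choiceType) (S : set T) (c : R) (a : T -> \bar R) :
  (0 <= c)%R -> (forall i, 0 <= a i) ->
  \esum_(i in S) (c%:E * a i) = c%:E * \esum_(i in S) a i.
Proof.
move=> c0 a0; rewrite /esum -ereal_supZl //; last first.
  by apply/set0P; exists (\sum_(x \in set0) a x), set0 => //; exact: fsets_set0.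
congr ereal_sup; apply/seteqP; split=> x /=.
  case=> A [finA AS] <-; exists (\sum_(i \in A) a i); first by exists A.
  by rewrite ge0_mule_fsumr.
by case=> _ [A [finA AS] <-] <-; exists A => //; rewrite ge0_mule_fsumr.
Qed.

Lemma esum_subset (T : choiceType) (A B : set T) (a : T -> \bar R) :
  A `<=` B -> \esum_(i in A) a i <= \esum_(i in B) a i.
Proof.
move=> AB; apply: le_ereal_sup => _ [X [finX XA] <-]; exists X => //.
by split=> // x /XA/AB.
Qed.

Lemma esum_finite_large (T : choiceType) (S : set T) (a : T -> \bar R) (e : R) :
  (0 < e)%R -> \esum_(i in S) a i < +oo ->
  (forall i, S i -> 0 <= a i) -> finite_set [set i | S i /\ e%:E <= a i].
Proof.
move=> e0 Soo a0; apply: contrapT => inf.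
set A := [set i | _] in inf.
suff : \esum_(i in S) a i = +oo by move=> S1; rewrite S1 in Soo.
have AS : A `<=` S by move=> i [].
apply/eqP; rewrite -leye_eq; apply: le_trans (esum_subset a AS).
apply: (@le_trans _ _ (\esum_(i in A) (e%:E * 1))); last first.
  by apply: le_esum => i [_]; rewrite mule1.
rewrite esumZl ?(ltW e0) //.
have -> : \esum_(i in A) 1 = +oo :> \bar R.
  apply/eqyP => r r0; have [B BA Bn] := infinite_set_fset (Num.truncn r).+1 inf.
  apply: esum_ge; exists [set` B]; first by split=> //; exact: finite_fset.
  rewrite fsbig_finite //= set_fsetK (eq_bigr (fun=> 1%R%:E)) // sumEFin
    lee_fin.
  rewrite big_const_seq count_predT iter_addr_0.
  by apply: le_trans (ltW (truncnS_gt r)) _; rewrite ler_nat.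
by rewrite gt0_muley ?lte_fin.
Qed.

(** Only finitely many terms exceed 1/(n+1), for each n. *)
Lemma esum_countable (T : choiceType) (S : set T) (a : T -> R) :
  (forall i, S i -> 0 < a i)%R -> \esum_(i in S) (a i)%:E < +oo -> countable S.
Proof.
move=> a0 Soo.
have -> : S = \bigcup_n [set i | S i /\ ((n.+1%:R^-1)%R : R)%:E <= (a i)%:E].
  apply/seteqP; split=> [i Si|i [n _ []//]].
  exists (Num.truncn (a i)^-1) => //; split=> //; rewrite lee_fin.
  by rewrite invf_ple ?posrE ?a0 ?ltr0n // ltW // truncnS_gt.
apply: bigcup_countable => // n _; apply: finite_set_countable.
by apply: (esum_finite_large _ Soo) => [|i /a0/ltW //]; rewrite invr_gt0 ltr0n.
Qed.

End SumsOfNonnegativeTerms.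

Lemma countable_enumeration (T : choiceType) (K : set T) x0 : countable K ->
  K x0 ->
  exists (B : set nat) (e : nat -> T), set_bij B K e /\ e @` B = K.
Proof.
move=> /countable_bijP[B /card_set_bijP[f [fKB finj fsurj]]] Kx0.
exists B, (fun n => xget x0 [set k | K k /\ f k = n]).
have eP n : B n -> K (xget x0 [set k | K k /\ f k = n]) /\
    f (xget x0 [set k | K k /\ f k = n]) = n.
  by move=> /fsurj[k Kk <-];
    apply: (@xgetPex _ x0 [set k' | K k' /\ f k' = f k]); exists k.
suff H : set_bij B K (fun n => xget x0 [set k | K k /\ f k = n]).
  split=> //; apply/seteqP; split;
    [exact: set_bij_sub H | exact: set_bij_surj H].
split=> [n /eP[]//|n m /set_mem/eP[_ e1] /set_mem/eP[_ e2] e12|k Kk].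
  by rewrite -e1 -e2 e12.
exists (f k); first exact: fKB.
have [] := eP _ (fKB _ Kk); set k' := xget _ _ => Kk' fkk'.
by apply: finj => //; exact/mem_set.
Qed.

(** * Measures and integrals over countable families *)

Section CountableUnions.
Context {R : realType} {d : measure_display} {Om : measurableType d}.
Variable P : probability Om R.
Local Open Scope ereal_scope.

Lemma measurable_countable_bigcup (T : choiceType) (K : set T) (E : T ->
  set Om) :
  countable K -> (forall k, K k -> measurable (E k)) ->
  measurable (\bigcup_(k in K) E k).
Proof.
move=> Kc mE; have [->|/set0P[x0 Kx0]] := eqVneq K set0.
  by rewrite bigcup_set0.
have [B [e [eB eKE]]] := countable_enumeration Kc Kx0.
have -> : \bigcup_(k in K) E k = \bigcup_(n in B) E (e n).
  by rewrite -eKE bigcup_image.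
by apply: bigcup_measurable => n Bn; apply: mE; case: eB => H _ _; exact: H.
Qed.

Lemma measure_countable_bigcup (T : choiceType) (K : set T) (E : T -> set Om) :
  countable K -> (forall k, K k -> measurable (E k)) -> trivIset K E ->
  P (\bigcup_(k in K) E k) = \esum_(k in K) P (E k).
Proof.
move=> Kc mE tE; have [->|/set0P[x0 Kx0]] := eqVneq K set0.
  by rewrite bigcup_set0 esum_set0 measure0.
have [B [e [eB eKE]]] := countable_enumeration Kc Kx0; have [eK einj _] := eB.
have -> : \bigcup_(k in K) E k = \bigcup_(n in B) E (e n).
  by rewrite -eKE bigcup_image.
rewrite measure_bigcup => [|n Bn|n m Bn Bm nm]; last 2 first.
- exact/mE/eK.
- by apply: einj; rewrite ?mem_set //; apply: tE => //; exact: eK.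
rewrite (reindex_esum _ _ _ _ eB) nneseries_esum //.
by congr esum; apply/seteqP; split=> n /=; rewrite inE.
Qed.

Lemma probability_bigcup0 (T : choiceType) (K : set T) (E : T -> set Om) :
  countable K -> (forall k, K k -> measurable (E k)) ->
  (forall k, K k -> P (E k) = 0) -> P (\bigcup_(k in K) E k) = 0.
Proof.
move=> Kc mE E0; have [->|/set0P[x0 Kx0]] := eqVneq K set0.
  by rewrite bigcup_set0 measure0.
have [B [e [eB eKE]]] := countable_enumeration Kc Kx0; have [eK einj _] := eB.
have -> : \bigcup_(k in K) E k = \bigcup_n (if n \in B then E (e n) else set0).
  rewrite -eKE bigcup_image; apply/seteqP; split=> w [n Bn Ew].
    by exists n => //; rewrite mem_set.
  by exists n; move: Ew; case: ifPn => // /set_mem.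
apply/negligibleP; last first.
  apply: negligible_bigcup => n; case: ifPn => [/set_mem Bn|_];
    last exact: negligible_set0.
  by apply/negligibleP; [exact/mE/eK | exact/E0/eK].
by apply: bigcup_measurable => n _; case: ifPn => // /set_mem Bn; exact/mE/eK.
Qed.

(** The level sets of [X] split the integral, and the integrand is constant on each. *)
Lemma integral_countable (TX : choiceType) (X : Om -> TX) (K : set TX)
    (f : TX -> \bar R) (E : set TX) :
  countable K -> (forall w, K (X w)) -> (forall A, measurable (X @^-1` A)) ->
  (forall h, 0 <= f h) ->
  \int[P]_(w in X @^-1` E) f (X w) =
  \esum_(h in K `&` E) (f h * P (X @^-1` [set h])).
Proof.
move=> Kc KX mX f0; have [K0|/set0P[x0 Kx0]] := eqVneq (K `&` E) set0.
  rewrite K0 esum_set0 (_ : _ @^-1` _ = set0) ?integral_set0 //.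
  by rewrite -subset0 => w EX; have : (K `&` E) (X w) by []; rewrite K0.
have KEc : countable (K `&` E) by apply: sub_countable Kc;
  apply: subset_card_le; exact: subIsetl.
have [B [e [eB eKE]]] := countable_enumeration KEc Kx0; have [eK einj _] := eB.
pose F n := if n \in B then X @^-1` [set e n] else set0.
have mF n : measurable (F n) by rewrite /F; case: ifP.
have XE : X @^-1` E = \bigcup_n F n.
  apply/seteqP; split=> [w Ew|w [n _]]; rewrite /F.
    have : (K `&` E) (X w) by [].
    by rewrite -eKE => -[n Bn en]; exists n; rewrite ?mem_set.
  by case: ifPn => // /set_mem /eK[_ Een] Xw; rewrite /preimage /= Xw.
rewrite XE ge0_integral_bigcup //; last 2 first.
- move=> _ A mA; rewrite -XE; apply: measurableI; first exact: mX.
  exact: (mX (f @^-1` A)).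
- move=> n m _ _ [w []]; rewrite /F; case: ifPn => // Bn; case: ifPn => // Bm.
  by move=> /= -> /einj; apply.
rewrite (reindex_esum _ _ _ _ eB) [RHS]esum_mkcond nneseries_esumT => [|n];
  last first.
  by apply: integral_ge0.
apply: eq_esum => n _; rewrite /F; case: ifPn => Bn; last by
  rewrite integral_set0.
rewrite (eq_integral (cst (f (e n)))) => [|w /set_mem /= -> //].
by rewrite integral_cst //; exact: mX.
Qed.

End CountableUnions.

(** * The total weight of Z-bridges *)

Section SumsOverFunctions.
Context {R : realType} {I : finType} {X : choiceType}.
Variables (x0 : X) (A : I -> set X) (f : I -> X -> R) (s : I -> R).
Hypothesis f0 : forall i x, 0 <= f i x.
Hypothesis fs : forall i, (\esum_(x in A i) (f i x)%:E = (s i)%:E)%E.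
Local Open Scope ereal_scope.

(** The default value off [J] makes a function determined by its restriction to [J]. *)
Definition functions_on (J : seq I) : set {ffun I -> X} :=
  [set v | (forall i, i \in J -> A i (v i)) /\ (forall i, i \notin J ->
    v i = x0)].

(** Distributivity of products over sums, peeling off one coordinate at a time by Tonelli. *)
Lemma esum_prod_functions (J : seq I) : uniq J ->
  \esum_(v in functions_on J) ((\prod_(i <- J) f i (v i))%R)%:E =
  ((\prod_(i <- J) s i)%R)%:E.
Proof.
elim: J => [_|i J IH /= /andP[iJ uJ]].
  have -> : functions_on [::] = [set [ffun => x0]].
    apply/seteqP; split=> [v [_ vx]|v ->]; first by apply/ffunP => j;
      rewrite ffunE vx.
    by split=> // j _; rewrite ffunE.
  by rewrite esum_set1 ?big_nil // lee_fin.
pose e (p : X * {ffun I -> X}) : {ffun I -> X} :=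
  [ffun j => if j == i then p.1 else p.2 j].
have ei p : e p i = p.1 by rewrite ffunE eqxx.
have eJ p j : j \in J -> e p j = p.2 j.
  by move=> jJ; rewrite ffunE; case: eqP => // ji; rewrite -ji jJ in iJ.
have eN p j : j != i -> e p j = p.2 j by move=> /negbTE ji; rewrite ffunE ji.
rewrite (reindex_esum (A i `*`` (fun=> functions_on J)) _ e); last first.
  split=> [[x v] [/= Ax [vA vx]]|[x v] [y u] /set_mem[/= _ [_ vx]] /set_mem[/= _
    [_ ux]] xvyu|v [vA vx]].
  - split=> j; rewrite inE; first by case/orP=> [/eqP ->|jJ];
    rewrite ?ei ?eJ //=; exact: vA.
    by rewrite negb_or => /andP[ji jJ]; rewrite eN //= vx.
  - have xy : x = y by rewrite -[x](ei (x, v)) xvyu ei.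
    congr pair => //; apply/ffunP => j; have [->|ji] := eqVneq j i; first by
      rewrite vx ?ux.
    by rewrite -[v j](eN (x, v)) // xvyu eN.
  - exists (v i, [ffun j => if j == i then x0 else v j]); last first.
      by apply/ffunP => j; rewrite !ffunE; case: eqP => [->|].
    split=> /=; first by apply: vA; rewrite mem_head.
    split=> j; rewrite ffunE; case: eqP => [->|/eqP ji] //.
    - by rewrite (negbTE iJ).
    - by move=> jJ; apply: vA; rewrite inE jJ orbT.
    - by move=> jJ; apply: vx; rewrite inE negb_or ji.
rewrite (eq_esum (b := fun p : (X * {ffun I -> X})%type =>
  (f i p.1)%:E * (\prod_(j <- J) f j (p.2 j))%R%:E));
  last first.
  move=> p _; rewrite big_cons ei EFinM; congr (_ * _%:E).
  by apply: eq_big_seq => j jJ; rewrite eJ.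
have p0 (v : {ffun I -> X}) : 0 <= (\prod_(j <- J) f j (v j))%R%:E.
  by rewrite lee_fin prodr_ge0.
rewrite -(esum_esum (a := fun x (v : {ffun I -> X}) =>
  (f i x)%:E * (\prod_(j <- J) f j (v j))%R%:E)); last first.
  by move=> x v _ _; apply: mule_ge0; [rewrite lee_fin; exact: f0 | exact: p0].
rewrite (eq_esum (b := fun x => (\prod_(j <- J) s j)%R%:E * (f i x)%:E)) =>
  [|x _].
  rewrite esumZl ?fs ?big_cons ?EFinM 1?muleC // => [|x]; last by
    rewrite lee_fin.
  apply: prodr_ge0 => j _; rewrite -lee_fin -fs; apply: esum_ge0 => x _.
  by rewrite lee_fin.
by rewrite esumZl // IH // muleC.
Qed.

End SumsOverFunctions.

(** * The partition function of Z-bridges *)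

Section PairingSum.
Context {R : realType} (g : nat) (Gam : graph) (D : subgraph Gam).
Hypothesis Gam_regular : regular g Gam.
Local Open Scope ereal_scope.

Lemma regular_gt0 (e : dart Gam) : (0 < g)%N.
Proof.
rewrite lt0n; apply/eqP => g0; have := Gam_regular (src e).
by rewrite g0 II0 card_eq0 => /eqP/seteqP[/(_ e erefl)].
Qed.

(** A dart forces g > 0, and the empty word has weight 1 whatever g. *)
Lemma path_weight_gt0 (w : seq (dart Gam)) : (0 < path_weight R g w)%R.
Proof.
case: w => [|e w]; first by rewrite /path_weight expr0.
by rewrite exprn_gt0 // invr_gt0 ltr0n (regular_gt0 e).
Qed.

Lemma path_weight_ge0 (w : seq (dart Gam)) : (0 <= path_weight R g w)%R.
Proof. exact/ltW/path_weight_gt0. Qed.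

Hypothesis D_green : forall x y, green R g D x y < +oo.

Definition zbridge_weight M (b : zpaths Gam M) : R :=
  (\prod_(i < M | (i < partner b i)%N) path_weight R g (b i).2)%R.

Lemma zbridge_weight_gt0 M (b : zpaths Gam M) : (0 < zbridge_weight b)%R.
Proof. by apply: prodr_gt0 => i _; exact: path_weight_gt0. Qed.

Variables (M : nat) (z : 'I_M -> vertex Gam).

Lemma green_fin x y : (fine (green R g D x y))%:E = green R g D x y.
Proof.
rewrite fineK // ge0_fin_numE //; apply: esum_ge0 => w _.
by rewrite lee_fin path_weight_ge0.
Qed.

(** Given the pairing, a Z-bridge is a free choice of one bridge at the smaller label of each pair,
    the other label carrying its reversal. The sum therefore factors into Green's functions. *)
Lemma esum_zbridge_pairing (s : {ffun 'I_M -> 'I_M}) : pairing s ->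
  \esum_(b in [set b | zbridge D z b /\ partner b = s]) (zbridge_weight b)%:E =
  (pairing_weight R g D z s)%:E.
Proof.
move=> /forallP sP; have sK i : s (s i) = i by case/andP: (sP i) => _ /eqP.
have sN i : s i != i by case/andP: (sP i).
pose J := [seq i : 'I_M <- enum 'I_M | (i < s i)%N].
have JE (i : 'I_M) : (i \in J) = (i < s i)%N by
  rewrite mem_filter mem_enum andbT.
have JsE (i : 'I_M) : (s i \in J) = ~~ (i < s i)%N.
  by rewrite JE sK -leqNgt ltn_neqAle (inj_eq val_inj) sN.
pose e (v : {ffun 'I_M -> seq (dart Gam)}) : zpaths Gam M :=
  [ffun i => (s i, if (i < s i)%N then v i else revpath (v (s i)))].
have pe v : partner (e v) = s by apply/ffunP => i; rewrite !ffunE.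
have e2 v i : (e v i).2 = if (i < s i)%N then v i else revpath (v (s i)) by
  rewrite ffunE.
rewrite (reindex_esum
  (functions_on [::] (fun i : 'I_M => bridge D (z i) (z (s i))) J) _ e);
    last first.
  split=> [v [vA vx]|v u /set_mem[_ vx] /set_mem[_ ux] vu|b [[pb zb] bs]].
  - split; last exact: pe.
    split; first by rewrite pe; apply/forallP.
    move=> i; rewrite pe !e2 sK.
    have [si|si] := boolP (i < s i)%N.
      have := JsE i; rewrite JE sK si => /= ->; split=> //; apply: vA;
        by rewrite JE.
    have := JsE i; rewrite JE sK si => /= ->; rewrite revpathK; split=> //.
    have : s i \in J by rewrite JsE.
    move=> /vA; rewrite sK => -[Ds Di w wD]; split=> //; first exact: walk_rev.
    by move=> f; rewrite mem_revpath => /wD/dset_drev; rewrite drevK.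
  - apply/ffunP => i; have := congr1 (fun b : zpaths Gam M => (b i).2) vu.
    rewrite !e2; case: ifP => // si _.
    by rewrite vx ?ux // JE si.
  - exists [ffun i : 'I_M => if (i < s i)%N then (b i).2 else [::]].
      split=> i; rewrite JE ffunE; last by move=> /negbTE ->.
      by move=> si; rewrite si; case: (zb i); rewrite bs.
    apply/ffunP => i; rewrite !ffunE; have bi : (b i).1 = s i by
      rewrite -bs ffunE.
    rewrite sK [RHS]surjective_pairing bi; congr pair; case: ifP => si; first by
      rewrite si.
    have -> : (s i < i)%N by have := JsE i; rewrite JE sK si => ->.
    by case: (zb i) => _; rewrite bs => ->; rewrite revpathK.
have fs i : \esum_(w in bridge D (z i) (z (s i))) (path_weight R g w)%:E =
    (fine (green R g D (z i) (z (s i))))%:E by rewrite green_fin.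
have prodJ (F : 'I_M -> R) :
    (\prod_(i < M | (i < s i)%N) F i = \prod_(i <- J) F i)%R.
  by rewrite big_filter big_enum_cond; apply: eq_bigl.
rewrite /pairing_weight prodJ.
rewrite -(esum_prod_functions [::] (fun i w => path_weight_ge0 w) fs);
  last first.
  by rewrite filter_uniq ?enum_uniq.
apply: eq_esum => v [vA _]; congr EFin.
rewrite /zbridge_weight pe prodJ.
by apply: eq_big_seq => i; rewrite JE e2 => ->.
Qed.

Lemma esum_zbridge :
  \esum_(b in [set b | zbridge D z b]) (zbridge_weight b)%:E =
  (pairing_sum R g D z)%:E.
Proof.
rewrite /pairing_sum -sumEFin.
rewrite (eq_bigr (fun s => \esum_(b in [set b | zbridge D z b])
   if partner b == s then (zbridge_weight b)%:E else 0)) => [|s sP]; last first.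
  rewrite -esum_zbridge_pairing // (esum_mkcondr [set b | zbridge D z b] [set b
    | partner b = s]).
  by apply: eq_esum => b _; case: eqP => sE;
    [rewrite mem_set | rewrite memNset].
rewrite -esum_sum => [|b s _ _]; last first.
  by case: ifP => // _; rewrite lee_fin ltW // zbridge_weight_gt0.
apply: eq_esum => b [bP _]; rewrite (bigD1 (partner b)) //= eqxx big1 ?adde0 //.
by move=> s /andP[_]; rewrite eq_sym => /negbTE ->.
Qed.

(** The Green's functions in the weight of the pairing cancel the normalizations of the bridge
    probabilities. *)
Lemma zbridge_massE (b : zpaths Gam M) : zbridge D z b ->
  zbridge_mass R g D z b = (zbridge_weight b / pairing_sum R g D z)%R.
Proof.
move=> zb; rewrite /zbridge_mass; case: asboolP => // _.
rewrite -mulrA mulrCA [RHS]mulrC; congr (_ * _)%R.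
rewrite /pairing_weight -big_split /=; apply: eq_bigr => i si.
case: (zb) => _ /(_ i)[bi _]; rewrite /bridge_prob; case: asboolP => // _.
rewrite mulrC divfK // gt_eqF // -lte_fin green_fin.
apply: (@lt_le_trans _ _ (path_weight R g (b i).2)%:E).
  by rewrite lte_fin path_weight_gt0.
apply: esum_ge; exists [set (b i).2]; last by rewrite fsbig_set1.
by split=> [|w ->].
Qed.

Lemma pairing_sum_gt0 (b : zpaths Gam M) : zbridge D z b ->
  (0 < pairing_sum R g D z)%R.
Proof.
move=> zb; rewrite -lte_fin -esum_zbridge.
apply: (@lt_le_trans _ _ (zbridge_weight b)%:E).
  by rewrite lte_fin zbridge_weight_gt0.
apply: esum_ge; exists [set b]; last by rewrite fsbig_set1.
by split=> [|w ->].
Qed.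

End PairingSum.

(** * The loop measure and the soup *)

Section LoopMeasure.
Context {R : realType} (g : nat) (Gam : graph) (D : subgraph Gam).
Hypothesis Gam_regular : regular g Gam.
Hypothesis D_green : green_finite R g D.
Variables (F1 F2 : {fset vertex Gam}).
Hypothesis F1D : forall x, x \in F1 -> vset D x.
Local Open Scope ereal_scope.
Local Notation nu := (loop_measure R g D).
Local Notation pw := (path_weight R g).
Local Notation crossing := (crossing_class D F1 F2).
Implicit Types (l : seq (dart Gam)) (c : uloop Gam) (A B : set (uloop Gam)).

Definition loops_in A : set (seq (dart Gam)) :=
  [set l | rooted_loop D l /\ A (loop_class l)].

Definition loop_mass l : R := (pw l / (size l)%:R / 2)%R.

Lemma loop_mass_ge0 l : 0 <= (loop_mass l)%:E.
Proof. by rewrite lee_fin !divr_ge0 // path_weight_ge0. Qed.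

Lemma loop_measure_ge0 A : 0 <= nu A.
Proof. by apply: esum_ge0 => l _; exact: loop_mass_ge0. Qed.

Lemma loop_measureID A B : nu A = nu (A `&` B) + nu (A `\` B).
Proof.
rewrite {1}/loop_measure (esumID (loops_in B)) => [|l _];
  last exact: loop_mass_ge0.
congr (_ + _); rewrite /loop_measure; congr esum; apply/seteqP; split=> l /=.
- by case=> -[Dl Al] [_ Bl].
- by case=> Dl [Al Bl].
- by case=> -[Dl Al] nB; split=> //; split=> // Bl; apply: nB.
- by case=> Dl [Al Bl]; split=> // -[_].
Qed.

Lemma loop_measure_sub A B : A `<=` B -> nu A <= nu B.
Proof. by move=> AB; apply: esum_subset => l [Dl /AB]. Qed.

Lemma rooted_loop_class l k : rooted_loop D l -> loop_class l k ->
  rooted_loop D k.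
Proof.
case=> l0 [x [Dx _ lw lD]] lk; have k0 : k != [::].
  by rewrite -size_eq0 (size_loop_class lk) size_eq0.
have [y yk] : exists y, walk y k y.
  by case: lk => i [->|->];
    [exact: walk_rot lw | exact: walk_rot (walk_rev lw)].
have kD e : e \in k -> dset D e.
  case: lk => i [->|->]; rewrite mem_rot; first exact: lD.
  by rewrite mem_revpath => /lD/dset_drev; rewrite drevK.
have Dy : vset D y.
  case: k k0 yk kD {lk} => // e k _ /andP[/eqP <- _] kD.
  by apply/dset_src/kD; rewrite mem_head.
by split=> //; exists y.
Qed.

(** The class has 2n / [symmetries l] rooted representatives, each of mass g^-n / (2n). *)
Lemma loop_measure_class l : rooted_loop D l ->
  nu [set loop_class l] = (pw l / (symmetries l)%:R)%:E.
Proof.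
move=> Dl; have l0 : l != [::] by case: Dl.
have -> : nu [set loop_class l] = \esum_(k in [set` undup (dihedral l)])
  (loop_mass l)%:E.
  transitivity (\esum_(k in [set` undup (dihedral l)]) (loop_mass k)%:E).
    congr esum; apply/seteqP; split=> k /=; rewrite mem_undup.
      by move=> [_ /loop_class_eqP /(loop_classE _ l0)].
    move=> /(loop_classE _ l0) lk; split; first exact: rooted_loop_class lk.
    exact: loop_class_eq.
  apply: eq_esum => k /=; rewrite mem_undup =>
    /(loop_classE _ l0)/size_loop_class kl.
  by rewrite /loop_mass /path_weight kl.
rewrite esum_fset; [|exact: finite_seq|by move=> k _; exact: loop_mass_ge0].
rewrite -fsbig_seq ?undup_uniq // sumEFin; congr EFin.
rewrite big_const_seq count_predT iter_addr_0 -[LHS]mulr_natr /loop_mass.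
have s0 : (symmetries l)%:R != 0%R :> R by
  rewrite pnatr_eq0 -lt0n symmetries_gt0.
have n0 : (size l)%:R != 0%R :> R by rewrite pnatr_eq0 size_eq0.
have : ((size (undup (dihedral l)))%:R * (symmetries l)%:R = 2 * (size l)%:R :>
  R)%R.
  by rewrite -!natrM size_loop_class_symmetries // -mul2n.
move=> e; apply: (mulIf s0); rewrite /= [RHS]divfK //. rewrite -[LHS]mulrA e;
  field.
exact: n0.
Qed.

(** The sources of the reversed loop are the targets of [l], and a closed walk has the same vertices
    as sources and as targets. *)
Lemma closed_walk_hits l k x : walk x l x -> loop_class l k ->
  has (fun e => src e \in F1) k -> has (fun e => src e \in F1) l.
Proof.
move=> lw [i [->|->]]; rewrite has_rot // => /hasP[e].
rewrite mem_revpath => el eF; case: l lw el => // f w fw.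
have := map_f (@tgt Gam) => /[apply]; rewrite (walk_tgts fw) /tgt drevK.
case/andP: fw => /eqP <- _; rewrite mem_rcons -map_cons => /mapP[d dw ed].
by apply/hasP; exists d; rewrite // -ed.
Qed.

(** A loop through x is encoded by its rerooting at the first visit to x and the index of that
    visit. A bridge of length n from x to x arises from at most n indices, each with mass g^-n /
    (2n). *)
Lemma esum_loops_through x : vset D x ->
  \esum_(l in [set l | rooted_loop D l /\ has (fun e => src e == x) l])
    (loop_mass l)%:E <= green R g D x x.
Proof.
move=> Dx; set S := [set l | _].
pose phi l := (rot (find (fun e => src e == x) l) l, find (fun e =>
  src e == x) l).
pose a (p : seq (dart Gam) * nat) := (loop_mass p.1)%:E.
have a0 p : 0 <= a p by exact: loop_mass_ge0.
have phi_inj : set_inj S phi.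
  move=> l k _ _ [e1 e2]; move: e1; rewrite e2 => /rot_inj; exact.
rewrite (eq_esum (b := a \o phi)) => [|l _]; last first.
  by rewrite /a /= /loop_mass /path_weight size_rot.
rewrite -(esum_image S phi a phi_inj).
have phiS : phi @` S `<=` bridge D x x `*`` (fun l => `I_(size l)).
  move=> _ [l [[l0 [y [_ _ lw lD]]] hl] <-]; rewrite /phi /=.
  set k := find _ l; have k_lt : (k < size l)%N by rewrite -has_find.
  split; last by rewrite /= size_rot.
  have [z zl] := walk_rot k lw.
  have zx : z = x.
    move: zl; rewrite /rot; case dE : (drop k l) => [|e w].
      by move/(congr1 size): dE; rewrite size_drop /=; lia.
    move=> /= /andP[/eqP <- _].
    have -> : e = nth e l k by rewrite -[k]addn0 -nth_drop dE.
    exact/eqP/(nth_find e hl).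
  rewrite zx in zl; split=> // e; rewrite mem_rot; exact: lD.
apply: le_trans (esum_subset a phiS) _.
rewrite -(esum_esum (a := fun l (k : nat) => (loop_mass l)%:E)) => [|l k _ _];
  last first.
  exact: loop_mass_ge0.
apply: le_esum => l _.
have -> : `I_(size l) = [set` iota 0 (size l)].
  by apply/seteqP; split=> k /=; rewrite mem_iota.
rewrite esum_fset; [|exact: finite_seq|by move=> k _; exact: loop_mass_ge0].
rewrite -fsbig_seq ?iota_uniq // sumEFin lee_fin big_const_seq count_predT
  iter_addr_0.
rewrite size_iota.
rewrite -[leLHS]mulr_natr /loop_mass; have [->|l0] := eqVneq l [::].
  by rewrite mulr0 path_weight_ge0.
have n0 : (size l)%:R != 0%R :> R by rewrite pnatr_eq0 size_eq0.
rewrite mulrAC divfK // ler_pdivrMr // ler_peMr ?path_weight_ge0 //.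
by rewrite ler1n.
Qed.

(** A crossing loop passes through some vertex of the finite set F1, so the Green's functions on the
    diagonal of F1 bound the mass. *)
Lemma loop_measure_crossing : nu [set c | crossing c] < +oo.
Proof.
pose S x := [set l | rooted_loop D l /\ has (fun e => src e == x) l].
apply: (@le_lt_trans _ _ (\sum_(x <- F1) \esum_(l in S x) (loop_mass l)%:E));
  last first.
  rewrite big_seq; apply: lte_sum_pinfty => x xF.
  apply: le_lt_trans (esum_loops_through (F1D xF)) _.
  by apply: D_green; exact: F1D.
have -> : \sum_(x <- F1) \esum_(l in S x) (loop_mass l)%:E =
    \esum_(l in setT) \sum_(x <- F1) (if l \in S x then (loop_mass l)%:E else
      0).
  rewrite esum_sum => [|l x _ _]; last by case: ifP => // _;
    exact: loop_mass_ge0.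
  by apply: eq_bigr => x _; rewrite esum_mkcond.
rewrite /loop_measure esum_mkcond; apply: le_esum => l _.
have ge0 : 0 <= \sum_(x <- F1) (if l \in S x then (loop_mass l)%:E else 0).
  by apply: sume_ge0 => x _; case: ifP => // _; exact: loop_mass_ge0.
case: ifPn => [/set_mem[Dl [_ /asboolP[k lk kF] _]]|//].
have [_ [y [_ _ lw _]]] := Dl.
have /hasP[e el eF] := closed_walk_hits lw lk kF.
rewrite (bigD1_seq (src e)) //= mem_set; last first.
  by split=> //; apply/hasP; exists e.
rewrite leeDl //; apply: sume_ge0 => x _; case: ifP => // _;
  exact: loop_mass_ge0.
Qed.

End LoopMeasure.

Section Multiplicities.
Context {R : realType} {X : choiceType}.
Implicit Types (m : X -> nat) (A : set X).
Local Notation npts := (@npoints R _).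
Local Open Scope ereal_scope.

Lemma npoints_set1 m x : npts m [set x] = (m x)%:R%:E.
Proof. by rewrite /npoints esum_set1. Qed.

Lemma npoints_eq0 m A : npts m A = 0 <-> forall x, A x -> m x = 0%N.
Proof.
split=> [m0 x Ax|mA]; last by rewrite /npoints esum1 // => x /mA ->.
have : npts m [set x] <= npts m A by apply: esum_subset => _ ->.
by rewrite m0 npoints_set1 lee_fin lern0 => /eqP.
Qed.

Lemma npoints_finite m A k : npts m A = k%:R%:E ->
  finite_set [set x | A x /\ m x != 0%N].
Proof.
move=> mk; have : finite_set [set x | A x /\ 1%:E <= (m x)%:R%:E :> \bar R].
  apply: esum_finite_large => //.
  by rewrite -/(npts m A) mk ltry.
by apply: sub_finite_set => x [Ax mx]; split=> //; rewrite lee_fin ler1n lt0n.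
Qed.

End Multiplicities.

(** At rate 0 the law is the Dirac mass at 0, which the formula reproduces with 0^0 = 1. *)
Lemma poisson_prob_set1 (R : realType) (r : R) k : 0 <= r ->
  poisson_prob r 0%N [set k] = (r ^+ k / k`!%:R * expR (- r))%:E.
Proof.
move=> r0; rewrite /poisson_prob; case: ifPn => [r_gt0|].
  by rewrite esum_set1 ?lee_fin ?poisson_pmf_ge0 // /poisson_pmf r_gt0.
rewrite -leNgt => r_le0; have -> : r = 0 by apply/eqP; rewrite eq_le r_le0.
rewrite oppr0 expR0 mulr1 diracE in_set1 expr0n eq_sym.
by case: k => [|k]; rewrite /= ?divr1 ?mul0r.
Qed.

(** * The law of the crossing loops *)

Section Soup.
Context {R : realType} (g : nat) (Gam : graph) (D : subgraph Gam).
Hypothesis Gam_regular : regular g Gam.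
Hypothesis D_green : green_finite R g D.
Variables (F1 F2 : {fset vertex Gam}).
Hypothesis F1D : forall x, x \in F1 -> vset D x.
Context {d : measure_display} {Om : measurableType d} (P : probability Om R).
Variable N : Om -> uloop Gam -> nat.
Hypothesis N_soup : loop_soup P g D N 1.
Local Open Scope ereal_scope.
Local Notation nu := (loop_measure R g D).
Local Notation pw := (path_weight R g).
Local Notation crossing := (crossing_class D F1 F2).
Local Notation npts := (@npoints R _).
Local Notation Cset := [set c | crossing c].
Local Notation crossing_loops := (crossing_loops F1 F2 N).

Definition class_mass (c : uloop Gam) : R :=
  (pw (xget [::] c) / (class_symmetries c)%:R)%R.

Lemma loop_measure_set1 c : crossing c -> nu [set c] = (class_mass c)%:E.
Proof.
case=> -[l Dl <-] _ _; rewrite loop_measure_class // /class_mass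
  class_symmetriesE.
by rewrite /path_weight (size_loop_class (xget_loop_class l)).
Qed.

Lemma nu_lt_pinfty A : A `<=` Cset -> nu A < +oo.
Proof.
move=> AC; apply: le_lt_trans (loop_measure_crossing Gam_regular D_green F2
  F1D).
exact: loop_measure_sub.
Qed.

Lemma nu_fineK A : A `<=` Cset -> (fine (nu A))%:E = nu A.
Proof.
by move=> AC; rewrite fineK // ge0_fin_numE ?nu_lt_pinfty // loop_measure_ge0.
Qed.

Definition crossing_rate : R := fine (nu Cset).

Lemma crossing_rateE cs : uniq cs -> (forall c, c \in cs -> crossing c) ->
  crossing_rate = (\sum_(c <- cs) class_mass c + fine (nu (Cset `\` [set`
    cs])))%R.
Proof.
elim: cs => [_ _|c cs IH /= /andP[ccs ucs] csC].
  by rewrite big_nil add0r set_nil setD0.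
have sub A : Cset `\` A `<=` Cset by move=> x [].
rewrite IH //; last by move=> c' c'cs; apply: csC; rewrite inE c'cs orbT.
rewrite big_cons -addrA addrCA; congr (_ + _)%R.
apply: EFin_inj; rewrite EFinD !nu_fineK // (loop_measureID D Gam_regular _ [set
  c]) //.
have cC : crossing c by apply: csC; rewrite mem_head.
congr (_ + _).
  rewrite -loop_measure_set1 //; congr nu; apply/seteqP;
    split=> [x [_ ->]//|x ->].
  by split=> //; split=> //=; apply/negP.
congr nu; apply/seteqP; split=> x /=; rewrite inE.
  by move=> [[Cx xcs] xc]; split=> //; apply/negP; rewrite negb_or; apply/andP;
    split; apply/negP => // /eqP.
move=> [Cx /negP]; rewrite negb_or => /andP[/eqP xc /negP xcs]; by [].
Qed.

Lemma soup_event A k : A `<=` Cset ->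
  measurable [set w | npts (N w) A = k%:R%:E] /\
  P [set w | npts (N w) A = k%:R%:E] =
    ((fine (nu A)) ^+ k / k`!%:R * expR (- fine (nu A)))%:E.
Proof.
move=> AC; case: N_soup => _ /(_ A k) + _; rewrite mul1e =>
  /(_ (nu_lt_pinfty AC))[mE ->].
by split=> //; rewrite poisson_prob_set1 // fine_ge0 // loop_measure_ge0.
Qed.

Lemma crossing_loopsE w L : (forall c, L c != 0%N -> crossing c) ->
  crossing_loops w = L <-> (forall c, crossing c -> N w c = L c).
Proof.
move=> LC; split=> [<- c [_ c1 c2]|NL]; first by
  rewrite /Defs.crossing_loops c1 c2.
apply/funext => c; rewrite /Defs.crossing_loops; case: ifPn => [/andP[c1 c2]|].
  have [Dc|nDc] := pselect (uloops D c); first by apply: NL.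
  have -> : L c = 0%N by apply/eqP; apply: contrapT => /negP/LC[].
  by case: N_soup => Nu _ _; apply/eqP; apply: contrapT => /negP/Nu.
by move=> nc; apply/esym/eqP; apply: contrapT => /negP/LC[_ c1 c2];
  rewrite c1 c2 in nc.
Qed.

(** Independence is applied to the singletons of [cs] and to the set of all other crossing classes,
    which must be empty of loops; the exponential factors combine into the total rate. *)
Lemma probability_crossing_loops L cs : uniq cs ->
  (forall c, c \in cs -> crossing c) -> (forall c, L c != 0%N -> c \in cs) ->
  measurable [set w | crossing_loops w = L] /\
  P [set w | crossing_loops w = L] =
  (expR (- crossing_rate) *
    \prod_(c <- cs) (class_mass c ^+ L c / (L c)`!%:R))%:E.
Proof.
move=> ucs csC Lcs; set n := size cs.
pose A (i : 'I_n.+1) : set (uloop Gam) :=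
  if (i < n)%N then [set nth set0 cs i] else Cset `\` [set` cs].
pose k (i : 'I_n.+1) := if (i < n)%N then L (nth set0 cs i) else 0%N.
have AC i : A i `<=` Cset.
  by rewrite /A; case: ifP => [i_lt c ->|_ c []//]; apply/csC/mem_nth.
pose E i := [set w | npts (N w) (A i) = (k i)%:R%:E].
have LE : [set w | crossing_loops w = L] = \bigcap_i E i.
  apply/seteqP; split=> w /=.
    move=> /crossing_loopsE NL i _; rewrite /E /= /A /k; case: ifP => i_lt.
      rewrite npoints_set1 NL //; last by apply/csC/mem_nth.
      by move=> c /Lcs/csC.
    apply/npoints_eq0 => c [Cc cs_c]; rewrite NL //; last by move=> c' /Lcs/csC.
    by apply/eqP; apply: contrapT => /negP/Lcs.
  move=> EN; apply/crossing_loopsE; first by move=> c /Lcs/csC.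
  move=> c Cc; have [ccs|ncs] := boolP (c \in cs).
    have i_lt : (index c cs < n)%N by rewrite index_mem.
    have := EN (Ordinal (leqW i_lt)) I;
      rewrite /E /= /A /k /= i_lt nth_index //.
    by rewrite npoints_set1 => -[] /eqP; rewrite eqr_nat => /eqP.
  have := EN ord_max I; rewrite /E /= /A /k /= ltnn => /npoints_eq0 -> //.
    by apply/esym/eqP; apply: contraNT ncs; exact: Lcs.
  by split=> //; exact/negP.
rewrite LE; split.
  by apply: fin_bigcap_measurable => // i _; case: (soup_event (k i) (AC i)).
case: N_soup => _ _ /(_ n.+1 A k) -> //; last 2 first.
- by move=> i; rewrite mul1e; exact: nu_lt_pinfty.
- move=> i j _ _ [c []]; rewrite /A; case: ifP => i_lt; case: ifP => j_lt.
  + move=> -> /eqP; rewrite nth_uniq // => /eqP ij; exact: val_inj.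
  + by move=> -> [_]; rewrite /= mem_nth.
  + by move=> [_ /=] + ce; rewrite ce mem_nth.
  + move=> _ _; apply: val_inj => /=; have := ltn_ord i; have := ltn_ord j; lia.
have Plast : P (E ord_max) = (expR (- fine (nu (Cset `\` [set` cs]))))%:E.
  by rewrite (soup_event _ (AC _)).2 /A /k /= ltnn fact0 expr0 divr1 mul1r.
rewrite big_ord_recr Plast.
rewrite (eq_bigr (fun i : 'I_n =>
  (class_mass (nth set0 cs i) ^+ L (nth set0 cs i) /
  (L (nth set0 cs i))`!%:R * expR (- class_mass (nth set0 cs i)))%R%:E));
    last first.
  move=> i _; rewrite (soup_event _ (AC _)).2 /A /k /= ltn_ord.
  by rewrite loop_measure_set1 //; apply/csC/mem_nth.
rewrite -(big_mkord xpredT (fun i =>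
  (class_mass (nth set0 cs i) ^+ L (nth set0 cs i) /
  (L (nth set0 cs i))`!%:R * expR (- class_mass (nth set0 cs i)))%R%:E)).
rewrite -(big_nth set0 xpredT (fun c => (class_mass c ^+ L c /
  (L c)`!%:R * expR (- class_mass c))%R%:E)).
rewrite prodEFin /= -EFinM big_split /= -mulrA mulrC; congr (_ * _)%:E.
by rewrite -expR_sum -expRD (crossing_rateE ucs csC) opprD sumrN.
Qed.

(** The events of having exactly k crossing loops have Poisson probabilities, which sum to 1. *)
Lemma crossing_loops_finite : exists2 A : set Om, measurable A /\ P A = 1 &
  A `<=` [set w | finite_set [set c | crossing_loops w c != 0%N]].
Proof.
pose E k := [set w | npts (N w) Cset = k%:R%:E].
have mE k : measurable (E k) := (soup_event k (@subset_refl _ Cset)).1.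
exists (\bigcup_k E k); first split.
- by apply: bigcup_measurable => k _; exact: mE.
- rewrite measure_bigcup // => [|k1 k2 _ _ [w []]]; last first.
    by rewrite /E /= => -> [] /eqP; rewrite eqr_nat => /eqP.
  rewrite (eq_eseriesr (g := fun k => poisson_prob crossing_rate 0%N [set k])).
    rewrite -(measure_bigcup (poisson_prob crossing_rate 0%N) setT (fun k =>
      [set k])) //.
      rewrite (_ : \bigcup_(k in setT) [set k] = setT);
        first exact: probability_setT.
      by apply/seteqP; split=> // k _; exists k.
    by move=> k1 k2 _ _ [k [-> ->]].
  move=> k _; rewrite poisson_prob_set1; last by
    rewrite fine_ge0 // loop_measure_ge0.
  exact: (soup_event k (@subset_refl _ Cset)).2.
- move=> w [k _ /npoints_finite]; apply: sub_finite_set => c /=.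
  rewrite /Defs.crossing_loops; case: ifP => [/andP[c1 c2] Nc|_]; last by
    rewrite eqxx.
  by split=> //; split=> //; case: N_soup => Nu _ _; exact: Nu Nc.
Qed.

Lemma countable_crossing : countable Cset.
Proof.
pose S := loops_in D Cset.
have Sc : countable S.
  have := @esum_countable R _ S (@loop_mass R g Gam); apply=> [l [[l0 _] _]|].
    by rewrite !divr_gt0 ?path_weight_gt0 ?ltr0n ?lt0n ?size_eq0.
  exact: nu_lt_pinfty (@subset_refl _ Cset).
apply: sub_countable Sc; apply: card_le_trans (card_image_le (@loop_class Gam)
  S).
apply: subset_card_le => c Cc; case: (Cc) => -[l Dl lc] _ _.
by exists l => //; split=> //=; rewrite lc.
Qed.

Definition finite_configurations : set (uloop Gam -> nat) :=
  [set L | finite_set [set c | L c != 0%N] /\ forall c, L c != 0%N ->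
    crossing c].

(** A finite multiset of crossing classes is encoded by a list of integers, through an enumeration
    of the classes. *)
Lemma countable_configurations : countable finite_configurations.
Proof.
have [C0|/set0P[x0 Cx0]] := eqVneq Cset set0.
  apply: finite_set_countable; apply: (@sub_finite_set _ _ [set fun=> 0%N]) =>
    //.
  move=> L [_ LC]; apply/funext => c; apply/eqP; apply: contrapT => /negP/LC Cc.
  by have : Cset c by []; rewrite C0.
have [B [e [eB eKE]]] := countable_enumeration countable_crossing Cx0.
have /choice[f fP] : forall c, exists n, crossing c -> e n = c.
  move=> c; have [Cc|nC] := pselect (crossing c); last by exists 0%N.
  have : Cset c by []; rewrite -eKE => -[n _ en]; by exists n.
pose F (s : seq nat) : uloop Gam -> nat := fun c => count_mem c (map e s).
apply: (@sub_countable _ _ _ [set: seq nat]); last exact: countableP.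
apply: card_le_trans (card_image_le F setT); apply: subset_card_le =>
  L [finL LC].
pose cs := fset_set [set c | L c != 0%N].
have csE c : (c \in cs) = (L c != 0%N).
  by rewrite in_fset_set //; apply/idP/idP => [/set_mem|Lc]; last exact/mem_set.
exists (map f (flatten [seq nseq (L c) c | c <- cs])) => //; apply/funext => c.
rewrite /F -map_comp (_ : map _ _ = flatten [seq nseq (L c) c | c <- cs]);
  last first.
  rewrite -[RHS]map_id; apply/eq_in_map => c' /flattenP[_ /mapP[c'' c''cs ->]].
  by rewrite mem_nseq => /andP[_ /eqP ->] /=; apply: fP; apply: LC;
    rewrite -csE.
rewrite count_flatten sumnE !big_map.
have [ccs|ncs] := boolP (c \in cs).
  rewrite (bigD1_seq c) ?fset_uniq //= count_nseq /= eqxx mul1n big1 ?addn0 //.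
  by move=> c' /negbTE c'c; rewrite count_nseq /= c'c.
rewrite big1_seq => [|c' /= c'cs]; first by move: ncs; rewrite csE negbK =>
  /eqP.
by rewrite count_nseq /=; case: eqP => // c'c; rewrite -c'c c'cs in ncs.
Qed.

End Soup.

(** * The conditional law of the missing parts *)

Section ConditionalLaw.
Context (R : realType) (g : nat) (Gam : graph).
Hypothesis Gam_regular : regular g Gam.
Variable D : subgraph Gam.
Hypothesis D_green : green_finite R g D.
Variables (F1 F2 : {fset vertex Gam}).
Hypothesis F1D : forall x, x \in F1 -> vset D x.
Hypothesis F2D : forall x, x \in F2 -> vset D x.
Hypothesis F12 : forall x, x \in F1 -> x \notin F2.
Variable listing : (upath Gam -> nat) -> seq (seq (dart Gam)).
Hypothesis listingP : listing_rule F1 F2 listing.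
Local Open Scope ereal_scope.
Local Notation D1 := (remove_vertices D F1).
Local Notation configurations := (finite_configurations D F1 F2).
Local Notation pw := (path_weight R g).
Local Notation zb h := (zbridge D1 (@zpoint Gam h)).
Implicit Types (L : uloop Gam -> nat) (h : seq (seq (dart Gam))).

(** At vertices outside [D1] there is no bridge and the sum is 0; elsewhere it is bounded by that of
    [D]. *)
Lemma green_remove_vertices x y : green R g D1 x y < +oo.
Proof.
have [[[Dx _] [Dy _]]|nD] := pselect (vset D1 x /\ vset D1 y); last first.
  rewrite /green (_ : bridge D1 x y = set0) ?esum_set0 ?ltry //.
  by rewrite -subset0 => w [? ? _ _]; apply: nD.
apply: le_lt_trans (D_green Dx Dy); apply: esum_subset => w [_ _ wk wD].
by split=> // e /wD[].
Qed.

Lemma existT_zpaths_inj M : injective (existT (zpaths Gam) M).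
Proof.
move=> b1 b2 /eqP; rewrite -tag_eqE /tag_eq eqxx /= => /eqP.
by rewrite /tagged_as; case: eqP => // e; rewrite (eq_axiomK e).
Qed.

Definition excursion_listing L := listing (excursion_mult F1 F2 L).

Definition classes L : seq (uloop Gam) := fset_set [set c | L c != 0%N].

(** * The completions for one configuration of loops *)

Section OneConfiguration.
Variable L : uloop Gam -> nat.
Hypothesis LP : configurations L.
Local Notation cs := (classes L).
Local Notation h := (excursion_listing L).

Lemma classes_uniq : uniq cs. Proof. exact: fset_uniq. Qed.

Lemma mem_classes c : (c \in cs) = (L c != 0%N).
Proof.
rewrite in_fset_set; last exact: LP.1.
by apply/idP/idP => [/set_mem|Lc]; last exact/mem_set.
Qed.

Lemma classes_sup c : L c != 0%N -> c \in cs. Proof. by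
  rewrite mem_classes. Qed.

Lemma classes_crossing c : c \in cs -> crossing_class D F1 F2 c.
Proof. by rewrite mem_classes => /(LP.2 c). Qed.

(** The listing rule applies only to finite multisets of excursions; a gluing of [L] shows that the
    excursions of [L] form one. *)
Lemma count_listing u :
  count (fun w => `[< path_class w = u >]) h = class_excursions F1 F2 L cs u.
Proof.
have [T [G GE]] := gluing_of_mult F2D F12 classes_uniq classes_sup LP.2.
have csG c : concat_mult G c != 0%N -> c \in cs by rewrite GE;
  exact: classes_sup.
have mG u' : excursion_mult F1 F2 L u' != 0%N ->
    exists t, path_class (exc G t) = u'.
  move=> m0; have /card_gt0P[t] :
      (0 < #|[set t | `[< path_class (exc G t) = u' >]]%SET|)%N.
    rewrite -(double_excursions_concat u' classes_uniq csG) double_gt0 lt0n.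
    apply: contraNneq m0 => <-; apply/eqP.
    by apply: eq_bigr => c _; rewrite GE.
  by rewrite inE => /asboolP; exists t.
apply: listingP => [|u' /mG[t <-]]; last by exists (exc G t) => //;
  exact: exc_excursion.
apply: (@sub_finite_set _ _ [set` [seq (path_class (exc G t) : upath Gam) | t <-
  enum T]]).
  move=> u' /mG[t <-] /=; apply/mapP; exists t => //; by rewrite mem_enum.
exact: finite_seq.
Qed.

Lemma walk_excursion_listing w : w \in h -> walk_excursion D F1 F2 w.
Proof.
exact: (walk_excursion_list F2D F12 classes_uniq classes_sup LP.2
  count_listing).
Qed.

Lemma completion_listing : exists2 b, zb h b & concatenation h b = L.
Proof.
apply: (completion_exists F2D F12 walk_excursion_listing classes_uniq
  classes_sup LP.2).
exact: count_listing.
Qed.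

Lemma pairing_sum_listing_gt0 : (0 < pairing_sum R g D1 (@zpoint Gam h))%R.
Proof.
have [b bP _] := completion_listing.
exact: (pairing_sum_gt0 Gam_regular green_remove_vertices bP).
Qed.

(** The glued loops have the excursions of the list with the same multiplicities, and the rule
    depends on nothing else, so it returns the same list. *)
Lemma configuration_concatenation b : zb h b ->
  configurations (concatenation h b) /\ excursion_listing (concatenation h b) =
    h.
Proof.
move=> bP; have LbP : configurations (concatenation h b).
  split; last by move=> c; exact: (concatenation_crossing F12
    walk_excursion_listing bP).
  have [cs' _ csb] := concatenation_support walk_excursion_listing bP.
  by apply: (@sub_finite_set _ _ [set` cs']) => [c /csb //|]; exact: finite_seq.
split=> //; rewrite /excursion_listing; congr listing; apply/funext => u.
have csb c : concatenation h b c != 0%N -> c \in classes (concatenation h b).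
  move=> c0; rewrite in_fset_set ?inE //; exact: LbP.1.
rewrite -[LHS]/(class_excursions F1 F2 (concatenation h b) (classes _) u).
rewrite (concatenation_excursions walk_excursion_listing bP _ (fset_uniq _)
  csb).
exact: count_listing.
Qed.

Lemma completions_listing : exists bs : seq (zpaths Gam (size (extremities h))),
  [/\ uniq bs, (0 < size bs)%N,
      forall b, b \in bs <-> zb h b /\ concatenation h b = L,
      (size bs * \prod_(c <- cs) ((L c)`! * class_symmetries c ^ L c) =
        #|relabellings h|)%N &
      forall b, b \in bs ->
        uniform_mass (completions D F1 h L) (existT (zpaths Gam) _ b) = ((size
          bs)%:R^-1)%R :> R].
Proof.
have [b0 b0P b0L] := completion_listing.
have csL c : concatenation h b0 c != 0%N -> c \in cs by rewrite b0L;
  exact: classes_sup.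
have [bs [ubs bsP] bsE] :=
  card_completions walk_excursion_listing b0P classes_uniq csL.
rewrite b0L in bsP bsE; exists bs.
have b0bs : b0 \in bs by apply/bsP.
split=> // [|b bbs]; first by case: (bs) b0bs.
rewrite /uniform_mass asboolT; last by exists b => //; exact/bsP.
congr (_%:R^-1)%R.
have cE : completions D F1 h L = [set` [seq existT (zpaths Gam) _ b' | b' <-
  bs]].
  apply/seteqP; split=> x /=.
    by case=> b' b'P <-; apply/mapP; exists b' => //; exact/bsP.
  by case/mapP=> b' /bsP b'P ->; exists b'.
have fin : finite_set (completions D F1 h L) by rewrite cE; exact: finite_seq.
rewrite -(size_map (existT (zpaths Gam) _) bs); apply: perm_size;
  apply: uniq_perm.
- exact: fset_uniq.
- by rewrite map_inj_uniq //; exact: existT_zpaths_inj.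
- move=> x; rewrite in_fset_set // cE; apply/idP/idP => [/set_mem //|xb].
  exact/mem_set.
Qed.

End OneConfiguration.


(** * The joint law of the excursions and the bridge *)

Context {d : measure_display} {Om : measurableType d} (P : probability Om R).
Variable N : Om -> uloop Gam -> nat.
Hypothesis N_soup : loop_soup P g D N 1.
Variable beta : Om -> any_zpaths Gam.
Hypothesis beta_missing : missing_parts P D F1 F2 N listing beta.
Local Notation crossing_loops := (crossing_loops F1 F2 N).
Local Notation eta := (excursion_list F1 F2 N listing).
Local Notation zbw := (@zbridge_weight R g Gam _).

Definition config_event L : set Om := [set w | crossing_loops w = L].
Definition bridge_event h b : set Om :=
  config_event (concatenation h b) `&`
  [set w | beta w = existT (zpaths Gam) (size (extremities h)) b].

Lemma measurable_config_event L : configurations L ->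
  measurable (config_event L).
Proof.
move=> LP; have := probability_crossing_loops Gam_regular D_green F1D N_soup
  (classes_uniq L) (classes_crossing LP) (classes_sup LP).
by case.
Qed.

Lemma crossing_loops_configuration w :
  finite_set [set c | crossing_loops w c != 0%N] ->
    configurations (crossing_loops w).
Proof.
move=> fin; split=> // c; rewrite /Defs.crossing_loops.
case: ifP => [/andP[c1 c2] Nc|_]; last by rewrite eqxx.
by split=> //; case: N_soup => Nu _ _; exact: Nu Nc.
Qed.

Lemma configuration0 : configurations (fun=> 0%N).
Proof.
split=> [|c] //.
rewrite (_ : [set _ | _] = set0) ?finite_set0 //.
by rewrite -subset0 => c.
Qed.

(* The fset_set of an infinite set is empty, so that infinitely many crossing *)
(* loops are listed as if there were none. *)
Lemma excursion_list_infinite w : ~ configurations (crossing_loops w) ->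
  eta w = excursion_listing (fun=> 0%N).
Proof.
move=> nL; have inf : infinite_set [set c | crossing_loops w c != 0%N].
  by move=> fin; apply/nL/crossing_loops_configuration.
rewrite /excursion_list /excursion_listing; congr listing; apply/funext => u.
have e0 L : fset_set [set c | L c != 0%N] = fset0 ->
  excursion_mult F1 F2 L u = 0%N.
  by rewrite /excursion_mult => ->; rewrite big_seq_fset0.
rewrite (e0 (crossing_loops w)); last by rewrite /fset_set; case: pselect.
rewrite (e0 (fun=> 0%N)) // (_ : [set _ | _] = set0) ?fset_set0 //.
by rewrite -subset0 => c.
Qed.

Lemma eta_configuration w : exists2 L,
  configurations L & eta w = excursion_listing L.
Proof.
have [LP|nLP] := pselect (configurations (crossing_loops w)).
  by exists (crossing_loops w).
by exists (fun=> 0%N); [exact: configuration0 | exact: excursion_list_infinite].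
Qed.

Lemma measurable_eta (E : set (seq (seq (dart Gam)))) : measurable (eta @^-1`
  E).
Proof.
pose U := \bigcup_(L in configurations) config_event L.
have mU : measurable U.
  apply: measurable_countable_bigcup; last exact: measurable_config_event.
  exact: (countable_configurations Gam_regular D_green F2 F1D).
(* A countable union over configurations, together with the event of infinitely many crossing loops
   when the list of the empty configuration is in [E]. *)
have -> : eta @^-1` E =
    \bigcup_(L in configurations `&` [set L | E (excursion_listing L)])
      config_event L `|`
    (if `[< E (excursion_listing (fun=> 0%N)) >] then ~` U else set0).
  apply/seteqP; split=> w /=.
    move=> Ew; have [LP|nLP] := pselect (configurations (crossing_loops w)).
      by left; exists (crossing_loops w).
    right; rewrite excursion_list_infinite // in Ew.
    case: asboolP => // _ [L LP wL]; apply: nLP.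
    by rewrite (wL : crossing_loops w = L).
  case=> [[L [LP LE] wL]|].
    by rewrite /excursion_list (wL : crossing_loops w = L).
  case: asboolP => // E0 nU.
  rewrite /preimage /= excursion_list_infinite // => LP.
  by apply: nU; exists (crossing_loops w).
apply: measurableU; last by case: ifP => // _; exact: measurableC.
apply: measurable_countable_bigcup => [|L LPE];
  last exact: measurable_config_event LPE.1.
apply: sub_countable (countable_configurations Gam_regular D_green F2 F1D).
by apply: subset_card_le => L [].
Qed.

Lemma completions_listing_of L h : configurations L ->
  excursion_listing L = h ->
  exists bs : seq (zpaths Gam (size (extremities h))),
  [/\ uniq bs, (0 < size bs)%N,
      forall b, b \in bs <-> zb h b /\ concatenation h b = L,
      (size bs * \prod_(c <- classes L) ((L c)`! * class_symmetries c ^ L c) =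
        #|relabellings h|)%N &
      forall b, b \in bs ->
        P (config_event L `&` [set w | beta w = existT (zpaths Gam) _ b]) =
        P (config_event L) * ((size bs)%:R^-1)%R%:E].
Proof.
move=> LP <-; have [bs [ubs bs0 bsP bsE bsU]] := completions_listing LP.
exists bs; split=> // b bbs; case: beta_missing => _ /(_ L LP.1) ->.
by rewrite -/(excursion_listing L) bsU.
Qed.

Lemma config_eventE L : configurations L -> P (config_event L) =
  (expR (- crossing_rate (R := R) g D F1 F2) *
   \prod_(c <- classes L) (class_mass g c ^+ L c / (L c)`!%:R))%R%:E.
Proof.
move=> LP; have := probability_crossing_loops Gam_regular D_green F1D N_soup
  (classes_uniq L) (classes_crossing LP) (classes_sup LP).
by case.
Qed.

(* The probability of completing h by a Z-bridge b depends on b only through *)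
(* zbridge_weight b, the remaining factor being list_weight h: the automorphisms *)
(* of the loops enter the intensity of the soup and the number of completions. *)
Definition list_weight h : R :=
  (expR (- crossing_rate (R := R) g D F1 F2) *
   g%:R^-1 ^+ (\sum_(i < size (extremities h)) size (excursion_from h i))./2 /
   #|relabellings h|%:R)%R.

Lemma sum_size_zbridge h b : zb h b ->
  (\sum_(i < size (extremities h)) size (b i).2)%N =
  (\sum_(i < size (extremities h) | (i < partner b i)%N) size (b i).2).*2.
Proof.
move=> bP; have sK := partnerK bP.
rewrite (bigID (fun i : 'I_(size (extremities h)) =>
  (i < partner b i)%N)) /= -addnn; congr addn.
rewrite (reindex_inj (inv_inj sK)) /=; apply: eq_big => [i|i _].
  by rewrite sK -leqNgt leq_eqVlt (inj_eq val_inj) eq_sym (negbTE (partner_neq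
    bP i)).
by case: bP => _ /(_ i)[_ ->]; rewrite size_revpath.
Qed.

(** The masses of the classes give g^-|L| / |Aut L|, and the uniform choice gives |Aut L| / |Aut h|;
    the length |L| is the sum of those of the excursions and of the bridges. *)
Lemma probability_bridge_event L0 h b : configurations L0 ->
  excursion_listing L0 = h ->
  zb h b -> P (@bridge_event h b) = (list_weight h * zbw b)%R%:E.
Proof.
move=> L0P hE bP; set L := concatenation h b.
have hP w : w \in h -> walk_excursion D F1 F2 w.
  by rewrite -hE; exact: walk_excursion_listing.
have [LP LE] : configurations L /\ excursion_listing L = h.
  by move: b bP @L; rewrite -hE => b bP; exact: configuration_concatenation.
have [bs [ubs bs0 bsP bsE bsU]] := completions_listing_of LP LE.
have bbs : b \in bs by apply/bsP.
rewrite /bridge_event bsU // config_eventE // -EFinM; congr EFin.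
have dsz := double_size_concatenation hP bP (classes_uniq L) (classes_sup LP).
rewrite sum_size_zbridge // in dsz.
set X := (\sum_(i < _) _)%N in dsz; set Y := (\sum_(i < _ | _) _)%N in dsz.
set S := (\sum_(c <- _) _)%N in dsz.
(* [X] counts each excursion from both of its ends, [Y] each bridge once. *)
have SE : S = (X./2 + Y)%N by lia.
rewrite /list_weight -/X -bsE natrM invfM.
have -> : (zbw b = g%:R^-1 ^+ Y)%R by rewrite -prodrXr.
have -> : (\prod_(c <- classes L) (class_mass g c ^+ L c / (L c)`!%:R) =
    g%:R^-1 ^+ S * ((\prod_(c <- classes L) ((L c)`! * class_symmetries c ^ L
      c))%N%:R)^-1
    :> R)%R.
  rewrite -prodrXr natr_prod -prodfV -big_split /=; apply: eq_bigr => c _.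
  rewrite /class_mass /path_weight expr_div_n natrM natrX invfM.
  by rewrite mulnC exprM mulrAC mulrA.
rewrite SE exprD; move: (_%:R^-1)%R (_%:R^-1)%R (expR _) (_ ^+ _)%R (_ ^+ Y)%R
  => *.
by ring.
Qed.

(** For each configuration, the probabilities of its completions add up to that of the
    configuration, so [beta] fails to be a completion with probability 0; there are countably many
    configurations. *)
Lemma null_event : exists N0 : set Om, [/\ measurable N0, P N0 = 0 &
  forall w, ~ N0 w -> configurations (crossing_loops w) /\
    completions D F1 (eta w) (crossing_loops w) (beta w)].
Proof.
have [A0 [mA0 PA0] A0P] :=
  crossing_loops_finite Gam_regular D_green F2 F1D N_soup.
pose B L := config_event L `\` beta @^-1` completions D F1 (excursion_listing L)
  L.
have mB L : configurations L -> measurable (B L).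
  by move=> LP; apply: measurableD;
    [exact: measurable_config_event | case: beta_missing].
have cL := countable_configurations Gam_regular D_green F2 F1D.
exists (~` A0 `|` \bigcup_(L in configurations) B L); split.
- apply: measurableU; first exact: measurableC.
  exact: measurable_countable_bigcup.
- rewrite measureU0; [|exact: measurableC|exact: measurable_countable_bigcup|].
    by have := probability_setC P mA0; rewrite PA0 subee.
  apply: probability_bigcup0 => // L LP.
  have [bs [ubs bs0 bsP _ bsU]] := completions_listing_of LP erefl.
  have BE : P (B L) = P (config_event L) -
      P (config_event L `&` beta @^-1` completions D F1 (excursion_listing L)
        L).
    apply: measureD; [exact: measurable_config_event | by case: beta_missing |].
    have : P (config_event L) < +oo by rewrite config_eventE // ltry.
    exact.
  rewrite BE.
  have [p [p0 pE]] : exists p, (0 <= p)%R /\ P (config_event L) = p%:E.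
    exists (fine (P (config_event L))); split; first by rewrite fine_ge0.
    by rewrite fineK // config_eventE.
  suff -> : P (config_event L `&` beta @^-1` completions D F1 (excursion_listing
    L) L)
      = P (config_event L) by rewrite pE subee.
  have -> : config_event L `&` beta @^-1` completions D F1 (excursion_listing L)
    L =
      \bigcup_(b in [set` bs]) (config_event L `&`
        [set w | beta w = existT (zpaths Gam) _ b]).
    apply/seteqP; split=> w /=.
      by case=> wL [b bP wb]; exists b; [exact/bsP | split].
    by case=> b /= /bsP bP [wL wb]; split=> //; exists b.
  rewrite measure_countable_bigcup.
  + rewrite (eq_esum (b := fun=> P (config_event L) * ((size bs)%:R^-1)%R%:E))
    => [|b /bsU //].
    rewrite pE -EFinM esum_fset.
    * rewrite -fsbig_seq // sumEFin big_const_seq count_predT iter_addr_0.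
      by rewrite -[X in X%:E]mulr_natr mulfVK // pnatr_eq0 -lt0n.
    * exact: finite_seq.
    * by move=> b _; rewrite lee_fin mulr_ge0.
  + exact/finite_set_countable/finite_seq.
  + move=> b _; apply: measurableI; first exact: measurable_config_event.
    by case: beta_missing => mb _; exact: (mb [set existT (zpaths Gam) _ b]).
  + by move=> b1 b2 _ _ [w [[_ /= ->] [_ /= /existT_zpaths_inj]]].
- move=> w /not_orP[/contrapT /A0P fin nB].
  have LP := crossing_loops_configuration fin; split=> //.
  apply: contrapT => nC; apply: nB; exists (crossing_loops w) => //.
Qed.

Lemma probability_list_bridge L0 h (A : set (any_zpaths Gam)) :
  configurations L0 -> excursion_listing L0 = h ->
  P (eta @^-1` [set h] `&` beta @^-1` A) = (list_weight h)%:E *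
  \esum_(b in [set b | zb h b /\ A (existT (zpaths Gam) _ b)]) (zbw b)%:E.
Proof.
move=> L0P hE; set Z := [set b | _].
have Zc : countable Z.
  apply: (@esum_countable R _ Z (fun b => zbw b)) => [b _|].
    exact: zbridge_weight_gt0.
  apply: (@le_lt_trans _ _ (\esum_(b in [set b | zb h b]) (zbw b)%:E)).
    by apply: esum_subset => b [].
  by rewrite (esum_zbridge Gam_regular green_remove_vertices) ltry.
have cP b : zb h b -> configurations (concatenation h b) /\
    excursion_listing (concatenation h b) = h.
  by move: b; rewrite -hE => b; exact: configuration_concatenation.
have mE b : Z b -> measurable (@bridge_event h b).
  move=> [bP _]; apply: measurableI;
    first exact: measurable_config_event (cP b bP).1.
  by case: beta_missing => mb _; exact: (mb [set existT (zpaths Gam) _ b]).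
have lw0 : (0 <= list_weight h)%R.
  by rewrite divr_ge0 // mulr_ge0 ?expR_ge0 // exprn_ge0 // invr_ge0.
rewrite -esumZl // => [|b]; last by rewrite lee_fin ltW // zbridge_weight_gt0.
rewrite (eq_esum (b := fun b => P (@bridge_event h b))) => [|b [bP _]];
  last first.
  by rewrite (probability_bridge_event L0P hE bP) EFinM.
rewrite -measure_countable_bigcup //; last first.
  move=> b1 b2 _ _ [w [[_ /= e1] [_ /= e2]]]; apply: existT_zpaths_inj.
  by rewrite -e1 -e2.
have mX : measurable (eta @^-1` [set h] `&` beta @^-1` A).
  by apply: measurableI; [exact: measurable_eta | case: beta_missing].
have mU : measurable (\bigcup_(b in Z) @bridge_event h b).
  exact: measurable_countable_bigcup.
have [N0 [mN0 PN0 N0P]] := null_event.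
(* One event contains the union of the bridge events, and is contained in it up to the null
   event. *)
apply/eqP; rewrite eq_le; apply/andP; split; last first.
  apply: le_measure; rewrite ?inE // => w [b [bP Ab] [wL wb]]; split.
    by rewrite /preimage /= /excursion_list (wL : crossing_loops w = _);
      exact: (cP b bP).2.
  by rewrite /preimage /= (wb : beta w = _).
rewrite -(measureU0 mU mN0 PN0); apply: le_measure; rewrite ?inE //.
  exact: measurableU.
move=> w [wh wA]; have [|nN] := pselect (N0 w); first by right.
have [LP] := N0P w nN; rewrite (wh : eta w = h) => -[b [bP bL] wb].
left; exists b; split=> //; first by rewrite wb.
Qed.

(** The partition function is positive for every outcome, as each list comes from a configuration
    and so has a completion. The integral over the discrete variable [eta] reduces the rest to one
    list at a time. *)
Theorem bridge_conditional_law :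
  {ae P, forall w, (0 < pairing_sum R g D1 (@zpoint Gam (eta w)))%R} /\
  conditional_distribution P eta beta
    (fun h => zbridge_measure R g D1 (extremities h)).
Proof.
split.
  by apply: aeW => w; have [L LP ->] := eta_configuration w;
    exact: pairing_sum_listing_gt0.
move=> E A; split; first exact: measurable_eta.
pose K := excursion_listing @` configurations.
have Kc : countable K.
  apply: sub_countable (countable_configurations Gam_regular D_green F2 F1D).
  exact: card_image_le.
have etaK w : K (eta w) by have [L LP ->] := eta_configuration w; exists L.
have mu0 h : 0 <= zbridge_measure R g D1 (extremities h) A.
  apply: esum_ge0 => b _; rewrite lee_fin /zbridge_mass; case: ifP => // _.
  have pg0 s : (0 <= pairing_weight R g D1 (tnth (in_tuple (extremities h)))
    s)%R.
    apply: prodr_ge0 => i _; apply: fine_ge0; apply: esum_ge0 => w _.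
    by rewrite lee_fin path_weight_ge0.
  rewrite mulr_ge0 // ?divr_ge0 ?sumr_ge0 //; apply: prodr_ge0 => i _.
  rewrite /bridge_prob; case: ifP => // _; rewrite divr_ge0 ?path_weight_ge0 //.
  apply: fine_ge0; apply: esum_ge0 => w _.
  by rewrite lee_fin path_weight_ge0.
rewrite (integral_countable P E Kc etaK measurable_eta mu0).
have -> : eta @^-1` E `&` beta @^-1` A =
    \bigcup_(h in K `&` E) (eta @^-1` [set h] `&` beta @^-1` A).
  apply/seteqP; split=> w; first by move=> [wE wA]; exists (eta w).
  by move=> [h [_ Eh] [/= wh wA]]; split=> //;
    rewrite /preimage /= (wh : eta w = h).
rewrite measure_countable_bigcup; last 3 first.
- by apply: sub_countable Kc; apply: subset_card_le => h [].
- by move=> h _; apply: measurableI;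
  [exact: measurable_eta | case: beta_missing].
- by move=> h1 h2 _ _ [w [[/= <- _] [/= <- _]]].
apply: eq_esum => h [[L LP hE] _].
have PS0 : (0 < pairing_sum R g D1 (@zpoint Gam h))%R.
  by rewrite -hE; exact: pairing_sum_listing_gt0.
(* The case of all bridges in [probability_list_bridge]: the normalizing constant is the partition
   function. *)
have Ph : P (eta @^-1` [set h]) = (list_weight h * pairing_sum R g D1 (@zpoint
  Gam h))%R%:E.
  rewrite -[eta @^-1` _]setIT -(preimage_setT beta) (probability_list_bridge _
    LP hE).
  rewrite [RHS]EFinM -(esum_zbridge Gam_regular green_remove_vertices);
    congr (_ * esum _ _).
  by apply/seteqP; split=> b // -[].
rewrite (probability_list_bridge A LP hE) Ph.
have -> : zbridge_measure R g D1 (extremities h) A =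
    ((pairing_sum R g D1 (@zpoint Gam h))^-1)%R%:E *
    \esum_(b in [set b | zb h b /\ A (existT (zpaths Gam) _ b)]) (zbw b)%:E.
  rewrite -esumZl ?invr_ge0 ?ltW // => [|b]; last by
    rewrite lee_fin ltW // zbridge_weight_gt0.
  rewrite /zbridge_measure [RHS]esum_mkcond [LHS]esum_mkcond; apply: eq_esum =>
    b _.
  case: ifPn => [/set_mem Ab|/negP nA]; last first.
    by case: ifPn => // /set_mem[_ Ab]; case: nA; exact/mem_set.
  have [bP|nbP] := pselect (zb h b); last first.
    rewrite memNset => [|[]//].
    by rewrite /zbridge_mass asboolF.
  rewrite mem_set // (zbridge_massE Gam_regular green_remove_vertices bP).
  by rewrite mulrC EFinM.
rewrite muleAC -EFinM mulrC mulfK ?gt_eqF //.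
Qed.

End ConditionalLaw.

Theorem proposition3 (R : realType) (g : nat) (Gam : graph)
    (Gam_regular : regular g Gam)
    (D : subgraph Gam) (D_green : green_finite R g D)
    (F1 F2 : {fset vertex Gam})
    (F1D : forall x, x \in F1 -> vset D x)
    (F2D : forall x, x \in F2 -> vset D x)
    (F12 : forall x, x \in F1 -> x \notin F2)
    (d : measure_display) (Om : measurableType d) (P : probability Om R)
    (N : Om -> uloop Gam -> nat) (N_soup : loop_soup P g D N 1)
    (listing : (upath Gam -> nat) -> seq (seq (dart Gam)))
    (listingP : listing_rule F1 F2 listing)
    (beta : Om -> any_zpaths Gam)
    (beta_missing : missing_parts P D F1 F2 N listing beta) :
  let eta := excursion_list F1 F2 N listing in
  {ae P, forall w,
     0 < pairing_sum R g (remove_vertices D F1) (@zpoint Gam (eta w))} /\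
  conditional_distribution P eta beta
    (fun h => zbridge_measure R g (remove_vertices D F1) (extremities h)).
Proof.
exact: (bridge_conditional_law Gam_regular D_green F1D F2D F12 listingP N_soup
  beta_missing).
Qed.
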